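(* Let $f:\mathbb R^d\to\mathbb R$ be a bounded continuous function, and let $v:[0,1]\times\mathbb R^d\to\mathbb R$ be the unique continuous viscosity solution (in the sense given in the context) of the nonlinear parabolic equation $$-v_t(t,x)-\frac12\sup_{A\in\Lambda}\mathrm{Tr}\left(AA^Tv_{xx}(t,x)\right)=0,\quad (t,x)\in[0,1)\times\mathbb R^d,$$ satisfying the terminal condition $v(1,x)=f(x)$, $x\in\mathbb R^d$. Then $$\lim_{n\to\infty}\ \sup_{A_0^{n-1}\in\mathfrak A_0^{n-1}}\mathsf E f\left(\sum_{j=0}^{n-1}\frac{A_j\xi_{j+1}}{\sqrt n}\right)=v(0,0).$$
   Context: Probabilistic setting. $(\Omega,\mathscr F,\mathbb P,(\mathscr F_j)_{j=0}^\infty)$ is a filtered probability space and $(\xi_j)_{j=1}^\infty$ is an adapted sequence of i.i.d. $d$-dimensional random variables (so $\xi_j$ is $\mathscr F_j$-measurable) such that $\xi_j$ is independent from $\mathscr F_{j-1}$ for every $j\ge1$. The filtration $\mathscr F_j$ may be larger than the one generated by $\xi_1,\dots,\xi_j$. With $\xi=(\xi^r)_{r=1}^d$ denoting a random variable distributed as $\xi_j$, it is assumed that $$\mathsf E\xi=0,\qquad \left(\mathsf E(\xi^r\xi^l)\right)_{r,l=1}^d=I,$$ where $I$ is the identity matrix. $\mathbb M_d$ and $\mathbb S_d$ are the sets of real $d\times d$ matrices and real symmetric $d\times d$ matrices, respectively. $\Lambda\subset\mathbb M_d$ is a nonempty compact set. For $0\le s\le n-1$, $\mathfrak A_s^{n-1}$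 is the set of all finite sequences $A_s^{n-1}=(A_j)_{j=s}^{n-1}$ such that each $A_j:\Omega\to\Lambda$ is $\mathscr F_j$-measurable. Viscosity solutions. Put $Q^\circ=[0,1)\times\mathbb R^d$, $Q=[0,1]\times\mathbb R^d$, and $G(S)=\frac12\sup_{A\in\Lambda}\mathrm{Tr}(AA^TS)$ for $S\in\mathbb S_d$. Subscripts $t$ and $xx$ denote the time derivative and the Hessian matrix in $x$. $C^2_b(\mathbb R^{d+1})$ is the set of test functions whose derivatives up to the second order are continuous and bounded. A bounded upper semicontinuous (resp., lower semicontinuous) function $u:Q\to\mathbb R$ is a viscosity subsolution (resp., supersolution) of the terminal value problem if $u(1,x)\le f(x)$ (resp., $u(1,x)\ge f(x)$) on $\mathbb R^d$ and for any $\varphi\in C^2_b(\mathbb R^{d+1})$ and $(\overline t,\overline x)\in Q^\circ$ such that $(\overline t,\overline x)$ is the strict global maximum (resp., minimum) point of $u-\varphi$ on $Q^\circ$, the inequality $$-\varphi_t(\overline t,\overline x)-G\left(\varphi_{xx}(\overline t,\overline x)\right)\le0\quad(\text{resp., }\ge0)$$ holds. (Points with $\overline t=0$ are included.) A bounded continuous function $u:Q\to\mathbb R$ is a viscosity solution of the terminal value problem if it is both a viscosity subsolution and a viscosity supersolution. *)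

(* Defs.v *)
From HB Require Import structures.
From mathcomp Require Import all_boot all_order all_algebra.
From mathcomp Require Import all_classical all_reals all_analysis.

Import Order.TTheory GRing.Theory Num.Theory.
Import numFieldNormedType.Exports.

Local Open Scope classical_set_scope.
Local Open Scope ring_scope.

Definition borel {T : topologicalType} : set (set T) := <<s open >>.

Definition filtration {disp : measure_display} {Omega : measurableType disp}
    (F : nat -> set (set Omega)) :=
  [/\ forall j, sigma_algebra setT (F j),
      forall j, F j `<=` measurable &
      forall i j, (i <= j)%N -> F i `<=` F j].

Definition measurable_wrt {Omega : Type} {T : topologicalType}
    (G : set (set Omega)) (X : Omega -> T) :=
  forall B, borel B -> G (X @^-1` B).

Definition independent_of {disp : measure_display}
    {Omega : measurableType disp} {R : realType} {T : topologicalType}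
    (P : probability Omega R) (G : set (set Omega)) (X : Omega -> T) :=
  forall B E, borel B -> G E -> P (X @^-1` B `&` E) = (P (X @^-1` B) * P E)%E.

Definition iid {disp : measure_display} {Omega : measurableType disp}
    {R : realType} {T : topologicalType} (P : probability Omega R)
    (X : nat -> Omega -> T) :=
  (forall (s : seq nat) (B : nat -> set T), uniq s ->
     (forall j, j \in s -> borel (B j)) ->
     P (\bigcap_(j in [set` s]) (X j @^-1` B j)) =
       (\prod_(j <- s) P (X j @^-1` B j))%E) /\
  (forall j B, borel B -> P (X j @^-1` B) = P (X 0%N @^-1` B)).

Definition strategies {R : realType} {d : nat} {Omega : Type}
    (F : nat -> set (set Omega)) (Lambda : set 'M[R]_d) (n : nat) :
    set ('I_n -> Omega -> 'M[R]_d) :=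
  [set A | forall j : 'I_n,
     (forall w, Lambda (A j w)) /\ measurable_wrt (F j) (A j)].

Definition Q0 {R : realType} {d : nat} : set (R * 'cV[R]_d) :=
  [set z | 0 <= z.1 < 1].

Definition Q {R : realType} {d : nat} : set (R * 'cV[R]_d) :=
  [set z | 0 <= z.1 <= 1].

Definition G {R : realType} {d : nat} (Lambda : set 'M[R]_d) (S : 'M[R]_d) : R :=
  2^-1 * sup [set \tr (A *m A^T *m S) | A in Lambda].

(* The coordinate directions of R^(d+1): [None] is time, [Some i] is x_i. *)
Definition axis {R : realType} {d : nat} (k : option 'I_d) : R * 'cV[R]_d :=
  if k is Some i then (0, delta_mx i 0) else (1, 0).

Definition bounded_continuous {R : realType} {V : normedModType R}
    (g : V -> R) :=
  continuous g /\ [bounded g x | x in [set: V]].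

Definition C2b {R : realType} {d : nat} (phi : R * 'cV[R]_d -> R) :=
  [/\ bounded_continuous phi,
      forall k, (forall z, derivable phi z (axis k)) /\
        bounded_continuous ('D_(axis k) phi) &
      forall k l, (forall z, derivable ('D_(axis k) phi) z (axis l)) /\
        bounded_continuous ('D_(axis l) ('D_(axis k) phi))].

Definition time_derivative {R : realType} {d : nat}
    (phi : R * 'cV[R]_d -> R) (z : R * 'cV[R]_d) : R :=
  'D_(axis None) phi z.

Definition hessian {R : realType} {d : nat}
    (phi : R * 'cV[R]_d -> R) (z : R * 'cV[R]_d) : 'M[R]_d :=
  \matrix_(i, j) 'D_(axis (Some j)) ('D_(axis (Some i)) phi) z.

Definition usc_on {R : realType} {T : topologicalType} (D : set T)
    (u : T -> R) :=
  forall z, D z -> forall a, u z < a -> \forall w \near within D (nbhs z), u w < a.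

Definition lsc_on {R : realType} {T : topologicalType} (D : set T)
    (u : T -> R) :=
  forall z, D z -> forall a, a < u z -> \forall w \near within D (nbhs z), a < u w.

Definition strict_max_on {R : realType} {T : Type} (D : set T) (g : T -> R)
    (z : T) :=
  D z /\ forall w, D w -> w <> z -> g w < g z.

Definition strict_min_on {R : realType} {T : Type} (D : set T) (g : T -> R)
    (z : T) :=
  D z /\ forall w, D w -> w <> z -> g z < g w.

(* A function on [0,1] x R^d is a total function on R x R^d of which only the
   values on Q matter. *)
Definition viscosity_subsolution {R : realType} {d : nat}
    (Lambda : set 'M[R]_d) (f : 'cV[R]_d -> R) (u : R * 'cV[R]_d -> R) :=
  [/\ [bounded u z | z in Q], usc_on Q u,
      forall x, u (1, x) <= f x &
      forall phi z, C2b phi -> strict_max_on Q0 (fun w => u w - phi w) z ->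
        - time_derivative phi z - G Lambda (hessian phi z) <= 0].

Definition viscosity_supersolution {R : realType} {d : nat}
    (Lambda : set 'M[R]_d) (f : 'cV[R]_d -> R) (u : R * 'cV[R]_d -> R) :=
  [/\ [bounded u z | z in Q], lsc_on Q u,
      forall x, f x <= u (1, x) &
      forall phi z, C2b phi -> strict_min_on Q0 (fun w => u w - phi w) z ->
        0 <= - time_derivative phi z - G Lambda (hessian phi z)].

Definition viscosity_solution {R : realType} {d : nat}
    (Lambda : set 'M[R]_d) (f : 'cV[R]_d -> R) (u : R * 'cV[R]_d -> R) :=
  [/\ [bounded u z | z in Q], {within Q, continuous u},
      viscosity_subsolution Lambda f u & viscosity_supersolution Lambda f u].

(* Main.v *)
Require Import Defs.
From HB Require Import structures.
From mathcomp Require Import all_boot all_order all_algebra.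
From mathcomp Require Import all_classical all_reals all_analysis.
From mathcomp Require Import measurable_realfun lra ring.

(** The limit is identified by confronting the viscosity solution [v] directly with
    expectations along controlled random walks; uniqueness for the equation is never
    invoked. Two facts make this possible.

    On the side of the noise, a smooth function evaluated along a walk of step
    [eta = 1 / n] moves in mean, during one step, by [eta] times the generator of the
    control in force, up to an error [o(eta)] that only depends on the bounds of
    three derivatives ([mean_second]). As no moment beyond the second is available, the
    remainder is the truncated second moment [rho], which vanishes by dominated
    convergence.

    On the side of the equation, if a smooth [g] dominates [v] at time [T], then
    [v (t, x)] is at most [g x + (T - t) * G (D^2 g x)] up to [O((T - t)^2)]
    ([one_step]). Indeed an explicit function of this shape would otherwise be crossed
    by [v], and a small perturbation of it would touch [v] from above at a strict global
    maximum, against the definition of a subsolution ([touch_above]). Minorants are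
    treated symmetrically, one constant control at a time.

    These facts need smooth functions, whereas [v] is only continuous. The
    smoothing is an iterated box average [mol]: derivatives of averages are difference
    quotients of averages, so that they exist along the coordinate axes with explicit
    bounds, and averages commute with the transition operators of the walk. Mollification
    is uniformly close to the identity only on balls; the barrier [beta], whose mean along
    the walks is controlled, accounts for what happens outside.

    Upper bound ([walk_upper]). For a constant control [A], iterating [supersolution_step]
    from a smooth minorant shows that [v (t, .)] dominates the iterates of the transition
    operator of [A] applied to [v (T, .)]. Refining the time step, mollifying and expanding
    gives the inequality [upper_generator]: the mollified solution is a classical
    supersolution for each constant control, with an error quadratic in [T - t]. It holds at every
    point, hence at the random position and the random control of an arbitrary strategy,
    and the errors of the [n] steps add up to [o(1)].

    Lower bound ([walk_lower]). On bounded Hessians, [G] is almost the maximum over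
    finitely many controls ([finite_controls]). The values of the dynamic programming
    recursion restricted to these controls are Lipschitz in space, and after a
    mollification at a finer scale [subsolution_step] shows that they dominate [v] up to a
    small error ([value_le_bellman]). They are attained by a strategy, which selects a
    maximizer at the current position: conditionally on the past, position and control are
    constants ([mean_freeze]). *)

Set Implicit Arguments.
Unset Strict Implicit.
Unset Printing Implicit Defensive.

Import Order.TTheory GRing.Theory Num.Theory.
Import numFieldNormedType.Exports.

Local Open Scope classical_set_scope.
Local Open Scope ring_scope.

(** * Bounded measurable functions under a probability *)

Section BoundedExpectation.
Context {R : realType} {disp : measure_display} {T : measurableType disp}.
Variable mu : probability T R.

Lemma bounded_integrable (f : T -> R) (C : R) :
  measurable_fun setT f -> (forall w, `|f w| <= C) ->
  mu.-integrable setT (EFin \o f).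
Proof.
move=> mf fC; apply: measurable_bounded_integrable => //.
- by apply: (le_lt_trans (probability_le1 mu measurableT)); rewrite ltry.
- exists C; split; first exact: num_real.
  by move=> M CM w _; apply: le_trans (fC w) (ltW CM).
Qed.

Lemma mean_cst (c : R) : \int[mu]_w c = c.
Proof. by rewrite /Rintegral integral_cst//= probability_setT mule1. Qed.

Lemma mean_le (f g : T -> R) :
  mu.-integrable setT (EFin \o f) -> mu.-integrable setT (EFin \o g) ->
  (forall w, f w <= g w) -> \int[mu]_w f w <= \int[mu]_w g w.
Proof. by move=> fi gi fg; apply: le_Rintegral. Qed.

Lemma mean_norm_le (f : T -> R) (C : R) :
  measurable_fun setT f -> (forall w, `|f w| <= C) -> `|\int[mu]_w f w| <= C.
Proof.
move=> mf fC; have fi := bounded_integrable mf fC.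
apply: le_trans (le_normr_Rintegral measurableT fi) _.
rewrite -[leRHS]mean_cst; apply: mean_le => //.
- by apply: (@bounded_integrable _ C) => [|w]; [exact: measurableT_comp|rewrite normr_id].
- apply: (@bounded_integrable _ `|C|) => // w.
Qed.

End BoundedExpectation.

(** * Random vectors with measurable coordinates *)

Definition cmeas {R : realType} {d : nat} {disp} {T : measurableType disp}
  (Z : T -> 'cV[R]_d) := forall i, measurable_fun setT (fun w => Z w i 0).

Section Cmeas.
Context {R : realType} {d : nat} {disp : measure_display} {T : measurableType disp}.
Implicit Types (Z : T -> 'cV[R]_d).

Lemma cmeasD Z1 Z2 : cmeas Z1 -> cmeas Z2 -> cmeas (fun w => Z1 w + Z2 w).
Proof.
move=> m1 m2 i; under eq_fun do rewrite mxE.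
by apply: measurable_funD.
Qed.

Lemma cmeasZ Z (c : R) : cmeas Z -> cmeas (fun w => c *: Z w).
Proof.
move=> m1 i; under eq_fun do rewrite mxE.
by apply: measurable_funM.
Qed.

Lemma cmeas_cst (a : 'cV[R]_d) : cmeas (fun _ : T => a).
Proof. by move=> i; apply: measurable_cst. Qed.

Lemma cmeasM (A : T -> 'M[R]_d) Z :
  (forall i j, measurable_fun setT (fun w => A w i j)) ->
  cmeas Z -> cmeas (fun w => A w *m Z w).
Proof.
move=> mA mZ i; under eq_fun do rewrite mxE.
by apply: measurable_sum => j; apply: measurable_funM.
Qed.

(** An open set of matrices is a countable union of rational boxes, and the preimage
    of a box only involves the entries. *)
Lemma entries_open m n (Z : T -> 'M[R]_(m, n)) (U : set 'M[R]_(m, n)) :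
  (forall i j, measurable_fun setT (fun w => Z w i j)) -> open U -> measurable (Z @^-1` U).
Proof.
move=> mZ oU.
pose box (qk : 'M[rat]_(m, n) * nat) : set 'M[R]_(m, n) :=
  ball (map_mx ratr qk.1 : 'M[R]_(m, n)) (qk.2.+1%:R^-1 : R).
pose F qk := if `[< box qk `<=` U >] then Z @^-1` box qk else set0.
have -> : Z @^-1` U = \bigcup_qk F qk.
  apply/seteqP; split => [w /= Uw|w [qk _]]; last first.
    by rewrite /F; case: asboolP => // sub; exact: sub.
  have /nbhs_ballP[e /= e0 eU] : nbhs (Z w) U by exact: open_nbhs_nbhs.
  have [k ke] : exists k : nat, (k.+1%:R^-1 : R) < e / 2.
    have [k] := ltr_add_invr (y := 0) (x := e / 2) ltac:(by rewrite divr_gt0).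
    by rewrite add0r => ?; exists k.
  have k0 : (0 : R) < k.+1%:R^-1 by rewrite invr_gt0 ltr0Sn.
  have /choice[q qP] : forall p : 'I_m * 'I_n, exists q : rat,
      ratr q \in `](Z w p.1 p.2 - k.+1%:R^-1), (Z w p.1 p.2 + k.+1%:R^-1)[.
    by move=> p; apply: rat_in_itvoo; rewrite ltrD2l (lt_trans _ k0)// oppr_lt0.
  pose qm : 'M[rat]_(m, n) := \matrix_(i, j) q (i, j).
  have inb : box (qm, k) (Z w).
    split=> // i j; rewrite /= !mxE /ball /= ltr_norml.
    have := qP (i, j); rewrite in_itv/= => /andP[h1 h2].
    by move: (_.+1%:R^-1) h1 h2 => r h1 h2; apply/andP; split; lra.
  exists (qm, k) => //; rewrite /F; case: asboolP => // nsub.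
  exfalso; apply: nsub => y yb; apply: eU.
  split=> // i j.
  have := inb.2 i j; have := yb.2 i j; rewrite /= !mxE /ball /= !ltr_norml.
  move=> /andP[h1 h2] /andP[h3 h4].
  by move: (_.+1%:R^-1) ke h1 h2 h3 h4 => r *; apply/andP; split; lra.
apply: countable_bigcupT_measurable; first exact: countableP.
move=> qk.
rewrite /F; case: ifP => _ //.
have -> : Z @^-1` box qk = \bigcap_(p in [set: 'I_m * 'I_n])
    (fun w => Z w p.1 p.2) @^-1` ball (ratr (qk.1 p.1 p.2) : R) (qk.2.+1%:R^-1 : R).
  apply/seteqP; split=> w /=.
    by move=> b p _; have := b.2 p.1 p.2; rewrite /= mxE.
  move=> b; split=> [|i j]; first by rewrite invr_gt0 ltr0Sn.
  by rewrite mxE; exact: (b (i, j)).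
apply: fin_bigcap_measurable => // p _.
rewrite -[X in measurable X]setTI; apply: mZ => //.
by apply: open_measurable; apply: ball_open; rewrite invr_gt0 ltr0Sn.
Qed.

Lemma cmeas_open Z (U : set 'cV[R]_d) : cmeas Z -> open U -> measurable (Z @^-1` U).
Proof. by move=> mZ; apply: entries_open => i j; rewrite (ord1 j); exact: mZ. Qed.

Lemma cmeas_comp (h : 'cV[R]_d -> R) Z :
  continuous h -> cmeas Z -> measurable_fun setT (fun w => h (Z w)).
Proof.
move=> ch mZ; apply: (measurability _ (RGenOpens.measurableE R)).
move=> _ [_ [a [b ->] <-]]; rewrite setTI.
rewrite (_ : _ @^-1` _ = Z @^-1` (h @^-1` `]a, b[%classic)) //.
apply: cmeas_open => //.
by apply: open_comp => [x _|]; [exact: ch|exact: itv_open].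
Qed.

End Cmeas.

(** * Limits and products under the integral *)

Lemma mean_cvg {R : realType} {disp} {T : measurableType disp}
    (mu : probability T R) (f_ : nat -> T -> R) (f g : T -> R) :
  (forall n, measurable_fun setT (f_ n)) -> measurable_fun setT f ->
  mu.-integrable setT (EFin \o g) ->
  (forall n w, `|f_ n w| <= g w) ->
  (forall w, f_ n w @[n --> \oo] --> f w) ->
  \int[mu]_w f_ n w @[n --> \oo] --> \int[mu]_w f w.
Proof.
move=> mf_ mf ig f_g f_f.
have [|||||fi _ cv] := @dominated_convergence _ _ _ mu setT measurableT
    (fun n => EFin \o f_ n) (EFin \o f) (EFin \o g).
- by move=> n; apply/measurable_EFinP.
- exact/measurable_EFinP.
- by apply: aeW => w _ /=; apply: cvg_EFin; [exact: nearW|exact: f_f].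
- by [].
- by apply: aeW => w n _ /=; rewrite lee_fin.
apply: fine_cvg => /=; rewrite fineK; first exact: cv.
exact: integrable_fin_num.
Qed.

(** Reduces continuity of an integral in its parameter to dominated convergence. *)
Lemma seq_continuous {R : realType} {V : normedModType R} (F : V -> R) (x : V) :
  (forall u : nat -> V, u n @[n --> \oo] --> x -> F (u n) @[n --> \oo] --> F x) ->
  {for x, continuous F}.
Proof.
move=> H; apply/(@cvgrPdist_le _ R^o) => e e0; apply: contrapT => nn.
have /choice[u uP] : forall n : nat, exists y, `|x - y| < n.+1%:R^-1 /\ e < `|F x - F y|.
  move=> n; apply: contrapT => nex; apply: nn.
  have n0 : (0 : R) < n.+1%:R^-1 by rewrite invr_gt0 ltr0Sn.
  apply: filterS (nbhsx_ballx x _ n0) => y; rewrite -ball_normE /= => xy.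
  by rewrite leNgt; apply/negP => ey; apply: nex; exists y.
have ux : u n @[n --> \oo] --> x.
  apply/cvgrPdist_lt => r r0; near=> n; apply: lt_trans (uP n).1 _.
  by near: n; exact: near_infty_natSinv_lt (PosNum r0).
have /(@cvgrPdist_le _ R^o)/(_ e e0)[N _ /(_ N (leqnn N))] := H u ux.
by rewrite leNgt (uP N).2.
Unshelve. all: by end_near. Qed.

(** * Averages of translates *)

(** The bound is carried along because every error below is proportional to it. *)
Definition cb {R : realType} {d : nat} (h : 'cV[R]_d -> R) (C : R) :=
  continuous h /\ forall x, `|h x| <= C.

Definition avg {R : realType} {d : nat} {disp} {T : measurableType disp}
    (mu : probability T R) (Y : T -> 'cV[R]_d) (h : 'cV[R]_d -> R) (x : 'cV[R]_d) : R :=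
  \int[mu]_w h (x + Y w).

Section Cont.
Context {R : realType} {T : topologicalType}.
Implicit Types f g : T -> R.

Lemma contD f g : continuous f -> continuous g -> continuous (fun x => f x + g x).
Proof. by move=> cf cg x; apply: cvgD; [exact: cf|exact: cg]. Qed.

Lemma contN f : continuous f -> continuous (fun x => - f x).
Proof. by move=> cf x; apply: cvgN; exact: cf. Qed.

Lemma contM f g : continuous f -> continuous g -> continuous (fun x => f x * g x).
Proof. by move=> cf cg x; apply: cvgM; [exact: cf|exact: cg]. Qed.

End Cont.

Lemma cont_shift {R : realType} {V : normedModType R} (h : V -> R) (a : V) :
  continuous h -> continuous (fun x => h (x + a)).
Proof.
move=> ch x; apply: (@continuous_comp _ _ _ (fun x => x + a) h); last exact: ch.
by apply: cvgD; [exact: cvg_id|exact: cvg_cst].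
Qed.

Section Cb.
Context {R : realType} {d : nat}.
Implicit Types (h g : 'cV[R]_d -> R) (C D : R).

Lemma cb_ge0 h C : cb h C -> 0 <= C.
Proof. by move=> [_ /(_ 0)]; apply: le_trans. Qed.

Lemma cb_cst (c : R) : cb (fun _ : 'cV[R]_d => c) `|c|.
Proof. by split => [x|x //]; exact: cst_continuous. Qed.

Lemma cbD h g C D : cb h C -> cb g D -> cb (fun x => h x + g x) (C + D).
Proof.
move=> [ch hC] [cg gD]; split => [|x]; first exact: contD.
by rewrite (le_trans (ler_normD _ _))// lerD.
Qed.

Lemma cbN h C : cb h C -> cb (fun x => - h x) C.
Proof.
move=> [ch hC]; split => [|x]; first exact: contN.
by rewrite normrN.
Qed.

Lemma cbB h g C D : cb h C -> cb g D -> cb (fun x => h x - g x) (C + D).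
Proof. by move=> hC /cbN gD; apply: cbD. Qed.

Lemma cbM h g C D : cb h C -> cb g D -> cb (fun x => h x * g x) (C * D).
Proof.
move=> [ch hC] [cg gD]; split => [|x]; first exact: contM.
by rewrite normrM ler_pM.
Qed.

Lemma cbZ (c : R) h C : cb h C -> cb (fun x => c * h x) (`|c| * C).
Proof. by apply: cbM; exact: cb_cst. Qed.

Lemma cb_le h C D : C <= D -> cb h C -> cb h D.
Proof. by move=> CD [ch hC]; split => // x; apply: le_trans (hC x) CD. Qed.

Lemma cb_shift h C (a : 'cV[R]_d) : cb h C -> cb (fun x => h (x + a)) C.
Proof.
by move=> [ch hC]; split => //; exact: cont_shift.
Qed.

End Cb.

Section Avg.
Context {R : realType} {d : nat} {disp : measure_display} {T : measurableType disp}.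
Variables (mu : probability T R) (Y : T -> 'cV[R]_d).
Hypothesis mY : cmeas Y.
Implicit Types (h g : 'cV[R]_d -> R) (C D : R).

Lemma avg_measurable h C x : cb h C -> measurable_fun setT (fun w => h (x + Y w)).
Proof.
by move=> [ch _]; apply: (cmeas_comp ch); apply: cmeasD => //; exact: cmeas_cst.
Qed.

Lemma avg_integrable h C x : cb h C ->
  mu.-integrable setT (EFin \o (fun w => h (x + Y w))).
Proof.
move=> hC; apply: (@bounded_integrable _ _ _ _ _ C); first exact: avg_measurable hC.
by move=> w; apply: hC.2.
Qed.

Lemma avg_cb h C : cb h C -> cb (avg mu Y h) C.
Proof.
move=> hC; split => [x|x]; last first.
  apply: mean_norm_le; first exact: avg_measurable hC.
  by move=> w; apply: hC.2.
apply: seq_continuous => u ux.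
apply: (@mean_cvg _ _ _ _ _ _ (fun=> C)).
- by move=> n; exact: avg_measurable hC.
- exact: avg_measurable hC.
- by apply: (@bounded_integrable _ _ _ _ _ `|C|).
- by move=> n w; apply: hC.2.
- move=> w; apply: continuous_cvg; first exact: hC.1.
  by apply: cvgD => //; exact: cvg_cst.
Qed.

Lemma avg_cst (c : R) x : avg mu Y (fun=> c) x = c.
Proof. exact: mean_cst. Qed.

Lemma avgD h g C D x : cb h C -> cb g D ->
  avg mu Y (fun y => h y + g y) x = avg mu Y h x + avg mu Y g x.
Proof.
by move=> hC gD; rewrite /avg RintegralD//; [exact: avg_integrable hC|exact: avg_integrable gD].
Qed.

Lemma avgB h g C D x : cb h C -> cb g D ->
  avg mu Y (fun y => h y - g y) x = avg mu Y h x - avg mu Y g x.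
Proof.
by move=> hC gD; rewrite /avg RintegralB//; [exact: avg_integrable hC|exact: avg_integrable gD].
Qed.

Lemma avgZ h C c x : cb h C -> avg mu Y (fun y => c * h y) x = c * avg mu Y h x.
Proof. by move=> hC; rewrite /avg RintegralZl//; exact: avg_integrable hC. Qed.

Lemma avg_le h g C D x : cb h C -> cb g D -> (forall y, h y <= g y) ->
  avg mu Y h x <= avg mu Y g x.
Proof.
by move=> hC gD hg; apply: mean_le; [exact: avg_integrable hC|exact: avg_integrable gD|].
Qed.

Lemma avg_shift h a x : avg mu Y (fun y => h (y + a)) x = avg mu Y h (x + a).
Proof. by rewrite /avg; under eq_Rintegral do rewrite addrAC. Qed.

End Avg.

(** By Fubini. This is why mollification commutes with the transition operators. *)
Lemma avg_comm {R : realType} {d : nat} {d1 d2 : measure_display}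
  {T1 : measurableType d1} {T2 : measurableType d2}
  (m1 : probability T1 R) (m2 : probability T2 R)
  (Y1 : T1 -> 'cV[R]_d) (Y2 : T2 -> 'cV[R]_d) (h : 'cV[R]_d -> R) (C : R) :
  cmeas Y1 -> cmeas Y2 -> cb h C ->
  avg m1 Y1 (avg m2 Y2 h) = avg m2 Y2 (avg m1 Y1 h).
Proof.
move=> mY1 mY2 hC; apply/funext => x.
pose F (z : T1 * T2) := h (x + (Y1 z.1 + Y2 z.2)).
have mF : measurable_fun setT F.
  apply: (cmeas_comp hC.1); apply: cmeasD; first exact: cmeas_cst.
  apply: cmeasD => i.
    by apply: (measurableT_comp (mY1 i)); exact: measurable_fst.
  by apply: (measurableT_comp (mY2 i)); exact: measurable_snd.
have iF : (m1 \x m2)%E.-integrable setT (EFin \o F).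
  apply: measurable_bounded_integrable => //.
  - rewrite -setXTT [ltLHS]product_measure1E//.
    by rewrite [X in (_ * X)%E]probability_setT mule1 [ltLHS]probability_setT ltry.
  - exists C; split; first exact: num_real.
    by move=> M CM z _; apply: le_trans (hC.2 _) (ltW CM).
have /(congr1 fine) := Fubini iF.
rewrite /avg /Rintegral /= => E.
transitivity (fine (\int[m1]_x1 \int[m2]_y (EFin \o F) (x1, y))).
  congr fine; apply: eq_integral => w _.
  rewrite -[RHS]fineK.
    by congr (_%:E); congr fine; apply: eq_integral => w' _; rewrite /F /= addrA.
  apply: integrable_fin_num => //.
  under eq_fun do rewrite /F/= addrA.
  exact: (avg_integrable m2 mY2 (x + Y1 w) hC).
rewrite E; congr fine; apply: eq_integral => w _.
rewrite -[LHS]fineK.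
  by congr (_%:E); congr fine; apply: eq_integral => w' _; rewrite /F /= (addrC (Y1 _)) addrA.
apply: integrable_fin_num => //.
under eq_fun do rewrite /F/= (addrC (Y1 _)) addrA.
exact: (avg_integrable m1 mY1 (x + Y2 w) hC).
Qed.

(** * Box averages *)

(** Directional derivatives only see the restriction to a line. *)
Lemma is_derive_line {R : realType} {V : normedModType R} (f : V -> R) (x v : V) (l : R) :
  is_derive (0 : R) (1 : R) (fun t : R => f (x + t *: v)) l <-> is_derive x v f l.
Proof.
have E : (fun t : R => t^-1 *: (((fun t : R => f (x + t *: v)) \o shift 0) (t *: 1) - f (x + 0 *: v)))
       = (fun t : R => t^-1 *: ((f \o shift x) (t *: v) - f x)).
  apply/funext => t /=; rewrite scale0r !addr0.
  by rewrite (_ : t *: 1 = t) ?(addrC x)//; exact: mulr1.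
by split=> -[dl el]; split; rewrite /derivable /derive ?E // in dl el *; rewrite -?E.
Qed.

Lemma is_derive1_comp {R : realFieldType} (f g : R -> R) (x a b : R) :
  is_derive (g x) 1 f a -> is_derive x 1 g b ->
  is_derive x 1 (fun y => f (g y)) (a * b).
Proof.
move=> [df fa] [dg gb]; split.
  apply/derivable1_diffP; apply: (@differentiable_comp _ _ _ _ g f).
    exact/derivable1_diffP.
  exact/derivable1_diffP.
by rewrite -derive1E (derive1_comp dg df) !derive1E fa gb.
Qed.

Lemma is_derive_affine {R : realFieldType} (a b x : R) :
  is_derive x (1 : R) (fun s => a + b * s) b.
Proof.
have := is_deriveD (is_derive_cst a x (1 : R)) (is_deriveZ b (is_derive_id x (1 : R))).
by rewrite add0r /GRing.scale /= mulr1.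
Qed.

Section UniformMean.
Context {R : realType}.
Implicit Types k : R -> R.

Lemma mu_itv (a b : R) : (@lebesgue_measure R `[a, b] < +oo)%E.
Proof.
rewrite lebesgue_measure_itv/=; case: ifP => _; last by rewrite ltry.
by rewrite -EFinB ltry.
Qed.

Definition unif : probability (measurableTypeR R) R := uniform_prob (@ltr01 R).

Lemma unif_mean k (C : R) : continuous k -> (forall s, `|k s| <= C) ->
  \int[unif]_s k s = \int[lebesgue_measure]_(s in `[0, 1]) k s.
Proof.
move=> ck kC.
have mk : measurable_fun setT k by exact: continuous_measurable_fun.
have mk1 D : measurable_fun D k by apply: measurable_funTS.
have ik : unif.-integrable setT (EFin \o k) by exact: (@bounded_integrable _ _ _ unif k C).
have mu01 := mu_itv 0 1.
have il : (@lebesgue_measure R).-integrable `[0, 1] (EFin \o k).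
  apply: measurable_bounded_integrable => //; first exact: mk1.
  by exists C; split; [exact: num_real|move=> M CM w _; apply: le_trans (kC w) (ltW CM)].
have ilc : (@lebesgue_measure R).-integrable `[0, 1] (EFin \o cst C).
  apply: measurable_bounded_integrable => //.
  by exists `|C|; split; [exact: num_real|move=> M CM w _; exact: ltW CM].
have iuc : unif.-integrable setT (EFin \o cst C).
  by apply: (@bounded_integrable _ _ _ _ _ `|C|).
have : \int[unif]_s (k s + C) = \int[lebesgue_measure]_(s in `[0, 1]) (k s + C).
  rewrite /Rintegral integral_uniform//=.
  - by rewrite subr0 invr1 mul1e.
  - by apply/measurable_EFinP; apply: measurable_funD.
  - by move=> s; rewrite lee_fin -lerBlDr sub0r; have := kC s; rewrite ler_norml => /andP[].
rewrite RintegralD// RintegralD// mean_cst Rintegral_cst//.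
rewrite [fine (lebesgue_measure _)](_ : _ = 1) ?mulr1; first by move/addIr.
by rewrite lebesgue_measure_itv/= lte_fin ltr01 oppr0 adde0.
Qed.

(** The derivative at the origin of a moving average is a difference quotient,
    because it is computed from a primitive. *)
Lemma unif_mean_derive k (C delta : R) : 0 < delta ->
  continuous k -> (forall s, `|k s| <= C) ->
  is_derive (0 : R) (1 : R) (fun t => \int[unif]_s k (t + delta * s))
    ((k delta - k 0) / delta).
Proof.
move=> d0 ck kC.
pose K (r : R) := \int[lebesgue_measure]_(t in `[(-1), r]) k t.
have dK (r : R) : -1 < r -> is_derive r 1 K (k r).
  move=> r1.
  have [||||dKr eKr] := @continuous_FTC1 _ k (BLeft (-1)) r (r + 1).
  - by rewrite ltrDl.
  - apply: measurable_bounded_integrable => //.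
    + exact: mu_itv.
    + by apply: measurable_funTS; exact: continuous_measurable_fun.
    + by exists C; split; [exact: num_real|move=> M CM w _; apply: le_trans (kC w) (ltW CM)].
  - by rewrite /= lte_fin.
  - exact: ck.
  by split; [exact: dKr|rewrite -derive1E; exact: eKr].
have E (t : R) : -1 < t -> \int[unif]_s k (t + delta * s) = (K (t + delta) - K t) / delta.
  move=> t1.
  have ckt : continuous (fun s => k (t + delta * s)).
    move=> s; apply: (@continuous_comp _ _ _ (fun s => t + delta * s) k); last exact: ck.
    by apply: cvgD; [exact: cvg_cst|apply: cvgM; [exact: cvg_cst|exact: cvg_id]].
  rewrite (unif_mean ckt (C := C))//.
  have dF (s : R) : -1 < t + delta * s ->
      is_derive s 1 (fun s => K (t + delta * s) / delta) (k (t + delta * s)).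
    move=> ts; have dKs := dK _ ts.
    have : is_derive s 1 (fun s => t + delta * s) delta.
      exact: is_derive_affine.
    move=> dl.
    have := is_derive1_comp (g := fun s => t + delta * s) dKs dl.
    move/(is_deriveZ delta^-1); rewrite /GRing.scale /=.
    have -> : delta^-1 * (k (t + delta * s) * delta) = k (t + delta * s).
      by rewrite mulrCA mulVf ?mulr1 ?gt_eqF.
    by congr is_derive; apply/funext => y; rewrite mulrC.
  have ts (s : R) : 0 <= s -> -1 < t + delta * s.
    by move=> s0; rewrite (lt_le_trans t1)// lerDl mulr_ge0// ltW.
  have cF (s : R) : 0 <= s -> {for s, continuous (fun s => K (t + delta * s) / delta)}.
    move=> s0; apply/differentiable_continuous/derivable1_diffP.
    by have [] := dF _ (ts _ s0).
  rewrite /Rintegral (@continuous_FTC2 _ _ (fun s => K (t + delta * s) / delta))//.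
  - by rewrite -EFinB /= mulr1 mulr0 addr0 -mulrBl.
  - by apply: continuous_subspaceT.
  - split.
    + move=> s; rewrite in_itv/= => /andP[s0 _].
      by have [] := dF _ (ts _ (ltW s0)).
    + by apply: cvg_at_right_filter; apply: cF.
    + by apply: cvg_at_left_filter; apply: cF.
  - move=> s; rewrite in_itv/= => /andP[s0 _].
    by rewrite derive1E; have [_ ->] := dF _ (ts _ (ltW s0)).
have N1 : (-1 : R) < 0 by rewrite ltrN10.
have N1d : (-1 : R) < 0 + delta by rewrite add0r (lt_trans N1).
have dd : is_derive (0 : R) (1 : R) (fun t : R => (K (t + delta) - K t) / delta)
    ((k delta - k 0) / delta).
  have dl : is_derive (0 : R) (1 : R) (fun t : R => t + delta) 1.
    have := is_derive_affine delta 1 (0 : R).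
    by under eq_fun do rewrite mul1r addrC.
  have d1 := is_derive1_comp (g := fun t => t + delta) (dK _ N1d) dl.
  have d2 := dK _ N1.
  have := is_deriveZ delta^-1 (is_deriveB d1 d2).
  rewrite /GRing.scale /= mulr1 add0r [delta^-1 * _]mulrC.
  by congr is_derive; apply/funext => y; rewrite mulrC.
apply: near_eq_is_derive dd.
near=> t; apply/esym/E; near: t.
exact: lt_nbhsr.
Unshelve. all: by end_near. Qed.
End UniformMean.

Section Coordinates.
Context {R : realType} {d : nat}.

Definition ev (i : 'I_d) : 'cV[R]_d := delta_mx i 0.

Lemma coord_le_norm (x : 'cV[R]_d) i : `|x i 0| <= `|x|.
Proof.
rewrite [leRHS]/Num.norm /= mx_normrE.
by apply/bigmax_geP; right; exists (i, 0).
Qed.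

Lemma norm_le_coord (x : 'cV[R]_d) (c : R) : 0 <= c ->
  (forall i, `|x i 0| <= c) -> `|x| <= c.
Proof.
move=> c0 xc; rewrite [leLHS]/Num.norm /= mx_normrE.
by apply/bigmax_leP; split => // -[i j] _ /=; rewrite ord1.
Qed.

Lemma norm_ev_le (t : R) i : `|t *: ev i| <= `|t|.
Proof.
apply: norm_le_coord => // j; rewrite !mxE eqxx andbT normrM.
by case: eqP => _; rewrite ?normr1 ?normr0 ?mulr1 ?mulr0.
Qed.

Lemma cv_sum_ev (x : 'cV[R]_d) : x = \sum_i x i 0 *: ev i.
Proof.
apply/colP => j; rewrite summxE (bigD1 j)//= !mxE !eqxx mulr1 big1 ?addr0// => k kj.
by rewrite !mxE eq_sym (negbTE kj) mulr0.
Qed.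

End Coordinates.

Section Boxes.
Context {R : realType} {d : nat}.
Variable delta : R.
Hypothesis delta0 : 0 < delta.
Implicit Types (h g : 'cV[R]_d -> R) (C D : R) (l : seq 'I_d).

Definition box_disp (i : 'I_d) (s : measurableTypeR R) : 'cV[R]_d := (delta * s) *: ev i.

Definition box (i : 'I_d) h : 'cV[R]_d -> R := avg (@unif R) (box_disp i) h.

Arguments box : simpl never.

Definition boxes l h := foldr box h l.

Definition dq (i : 'I_d) h (x : 'cV[R]_d) : R := (h (x + delta *: ev i) - h x) / delta.

Lemma cmeas_box i : cmeas (box_disp i).
Proof.
move=> j; rewrite /box_disp; under eq_fun do rewrite mxE.
by apply: measurable_funM => //; apply: measurable_funM.
Qed.

Lemma boxes_cb l h C : cb h C -> cb (boxes l h) C.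
Proof. by move=> hC; elim: l => //= i l; apply: avg_cb; exact: cmeas_box. Qed.

Lemma dq_cb i h C : cb h C -> cb (dq i h) (C * (2 / delta)).
Proof.
move=> hC; have := cbZ delta^-1 (cbB (cb_shift (delta *: ev i) hC) hC).
rewrite ger0_norm ?invr_ge0 ?ltW//.
rewrite (_ : delta^-1 * (C + C) = C * (2 / delta)); last by rewrite mulrC; ring.
rewrite (_ : (fun x => _) = dq i h) //.
by apply/funext => x; rewrite mulrC.
Qed.

Lemma cont_line h (x v : 'cV[R]_d) : continuous h -> continuous (fun t : R => h (x + t *: v)).
Proof.
move=> ch t.
apply: (@continuous_comp _ _ _ (fun t : R => x + t *: v) h); last exact: ch.
by apply: cvgD; [exact: cvg_cst|apply: cvgZr_tmp; exact: cvg_id].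
Qed.

Lemma box_derive i h C x : cb h C -> is_derive x (ev i) (box i h) (dq i h x).
Proof.
move=> hC; apply/is_derive_line.
have := @unif_mean_derive R (fun t => h (x + t *: ev i)) C delta delta0
   (@cont_line h _ _ hC.1) (fun s => hC.2 _).
rewrite scale0r addr0; congr is_derive.
apply/funext => t; rewrite /box /avg /box_disp.
by apply: eq_Rintegral => s _; rewrite -addrA scalerDl.
Qed.

Lemma box_comm i j h C : cb h C -> box i (box j h) = box j (box i h).
Proof. by apply: avg_comm; exact: cmeas_box. Qed.

Lemma boxes_rem l i h C : cb h C -> i \in l -> boxes l h = box i (boxes (rem i l) h).
Proof.
move=> hC; elim: l => //= j l IH; rewrite inE eq_sym.
case: eqVneq => [->//|ji]; rewrite /= => il.
by rewrite (IH il) (box_comm j i (boxes_cb (rem i l) hC)).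
Qed.

Lemma boxes_perm l l' h C : cb h C -> perm_eq l l' -> boxes l h = boxes l' h.
Proof.
move=> hC; elim: l l' => [|i l IH] l' ll'.
  by move: ll'; rewrite perm_sym => /perm_nilP ->.
have il' : i \in l' by rewrite -(perm_mem ll') mem_head.
rewrite (boxes_rem hC il') /= (IH (rem i l'))//.
by rewrite -(perm_cons i); apply: perm_trans ll' _; exact: perm_to_rem.
Qed.

Lemma dqC i j h : dq i (dq j h) = dq j (dq i h).
Proof.
apply/funext => x; rewrite /dq (addrAC _ _ (delta *: ev j)); ring.
Qed.

Lemma avg_dq {disp} {T : measurableType disp} (mu : probability T R) Y i h C :
  cmeas Y -> cb h C -> avg mu Y (dq i h) = dq i (avg mu Y h).
Proof.
move=> mY hC; apply/funext => x; rewrite /dq.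
have hs := cb_shift (delta *: ev i) hC.
rewrite -avg_shift -(avgB _ mY x hs hC) mulrC -(avgZ _ mY _ x (cbB hs hC)).
by congr (avg _ _ _ _); apply/funext => y; rewrite mulrC.
Qed.

Lemma box_dq i j h C : cb h C -> box j (dq i h) = dq i (box j h).
Proof. by apply: avg_dq; exact: cmeas_box. Qed.

Lemma boxes_dq i l h C : cb h C -> boxes l (dq i h) = dq i (boxes l h).
Proof.
move=> hC; elim: l => //= j l ->; rewrite (box_dq _ _ (C := C))//.
exact: boxes_cb.
Qed.

(** Each box average provides one derivative in its direction: differentiating
    trades it for a difference quotient, which commutes with the other averages. *)
Lemma boxes_derive i l h C x : cb h C -> i \in l ->
  is_derive x (ev i) (boxes l h) (boxes (rem i l) (dq i h) x).
Proof.
move=> hC il; rewrite (boxes_rem hC il) (boxes_dq _ _ hC).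
apply: box_derive; exact: boxes_cb hC.
Qed.

Lemma boxes_deriveE i l h C : cb h C -> i \in l ->
  'D_(ev i) (boxes l h) = boxes (rem i l) (dq i h).
Proof. by move=> hC il; apply/funext => x; have [_] := boxes_derive x hC il. Qed.

Lemma boxesB l h g C D x : cb h C -> cb g D ->
  boxes l (fun y => h y - g y) x = boxes l h x - boxes l g x.
Proof.
move=> hC gD; elim: l x => //= i l IH x.
have -> : boxes l (fun y => h y - g y) = (fun y => boxes l h y - boxes l g y).
  exact/funext.
exact: (avgB _ (cmeas_box i) x (boxes_cb l hC) (boxes_cb l gD)).
Qed.

Lemma boxesD l h g C D x : cb h C -> cb g D ->
  boxes l (fun y => h y + g y) x = boxes l h x + boxes l g x.
Proof.
move=> hC gD; elim: l x => //= i l IH x.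
have -> : boxes l (fun y => h y + g y) = (fun y => boxes l h y + boxes l g y).
  exact/funext.
exact: (avgD _ (cmeas_box i) x (boxes_cb l hC) (boxes_cb l gD)).
Qed.

Lemma boxesZ l h c C x : cb h C -> boxes l (fun y => c * h y) x = c * boxes l h x.
Proof.
move=> hC; elim: l x => //= i l IH x.
have -> : boxes l (fun y => c * h y) = (fun y => c * boxes l h y) by apply/funext.
exact: (avgZ _ (cmeas_box i) c x (boxes_cb l hC)).
Qed.

Lemma boxes_cst l c x : boxes l (fun=> c) x = c.
Proof.
elim: l x => //= i l IH x; rewrite (_ : boxes l _ = (fun=> c)); last exact/funext.
exact: avg_cst.
Qed.

Lemma boxes_le l h g C D x : cb h C -> cb g D -> (forall y, h y <= g y) ->
  boxes l h x <= boxes l g x.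
Proof.
move=> hC gD hg; elim: l x => //= i l IH x.
by apply: (avg_le _ (cmeas_box i) x (boxes_cb l hC) (boxes_cb l gD)).
Qed.

Lemma boxes_avg {disp} {T : measurableType disp} (mu : probability T R) Y l h C :
  cmeas Y -> cb h C -> boxes l (avg mu Y h) = avg mu Y (boxes l h).
Proof.
move=> mY hC; elim: l => //= i l ->; apply: avg_comm => //; first exact: cmeas_box.
exact: boxes_cb hC.
Qed.

Lemma box_bound i h C (x : 'cV[R]_d) (c : R) : cb h C ->
  (forall s : R, 0 <= s <= 1 -> h (x + (delta * s) *: ev i) <= c) -> box i h x <= c.
Proof.
move=> hC hc; rewrite /box /avg /box_disp.
have ck : continuous (fun s : R => h (x + (delta * s) *: ev i)).
  under eq_fun do rewrite mulrC -scalerA.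
  exact: (@cont_line h _ _ hC.1).
rewrite (unif_mean ck (C := C)); last by move=> s; apply: hC.2.
have mu1 : fine (@lebesgue_measure R `[0%R, 1%R]) = 1.
  by rewrite lebesgue_measure_itv/= lte_fin ltr01 oppr0 adde0.
have := @Rintegral_cst _ _ _ (@lebesgue_measure R) `[0%R, 1%R]%classic _ c.
rewrite mu1 mulr1 => <-//; apply: le_Rintegral => //.
- apply: measurable_bounded_integrable => //; first exact: mu_itv.
    by apply: measurable_funTS; exact: continuous_measurable_fun.
  by exists C; split; [exact: num_real|move=> M CM w _; apply: le_trans (hC.2 _) (ltW CM)].
- apply: measurable_bounded_integrable => //; first exact: mu_itv.
  by exists `|c|; split; [exact: num_real|move=> M CM w _; exact: ltW CM].
Qed.

(** A box average of a function only involves its values at distance at most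
    [delta], whence the rate of approximation. *)
Lemma boxes_bound l h C (x : 'cV[R]_d) (c : R) : cb h C ->
  (forall y, `|y| <= delta *+ size l -> h (x + y) <= c) -> boxes l h x <= c.
Proof.
move=> hC; elim: l x => [x|i l IH x] hc /=; first by rewrite -[x]addr0; apply: hc; rewrite normr0.
apply: (box_bound (boxes_cb l hC)) => s /andP[s0 s1]; apply: IH => y yl.
rewrite -addrA; apply: hc; rewrite (le_trans (ler_normD _ _))// mulrS lerD//.
apply: le_trans (norm_ev_le _ _) _.
by rewrite ger0_norm ?ler_piMr ?mulr_ge0 ?(ltW delta0).
Qed.

Lemma boxes_near l h C (x : 'cV[R]_d) (c e : R) : cb h C ->
  (forall y, `|y| <= delta *+ size l -> `|h (x + y) - c| <= e) ->
  `|boxes l h x - c| <= e.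
Proof.
move=> hC hc; rewrite ler_norml; apply/andP; split.
  rewrite lerBrDr -lerN2 opprD opprK -[leLHS]mulN1r -(boxesZ _ _ _ hC).
  apply: (boxes_bound (cbZ (-1) hC)) => y yl; have := hc y yl.
  by rewrite ler_norml => /andP[]; lra.
rewrite lerBlDr; apply: (boxes_bound hC) => y yl; have := hc y yl.
by rewrite ler_norml => /andP[_]; lra.
Qed.

End Boxes.

(** * Smoothness along the coordinate axes *)

(** Only derivatives along the axes are required: they suffice for Taylor expansions,
    made one coordinate at a time, and they are what box averages provide. *)
Fixpoint sm {R : realType} {d : nat} (n : nat) (K : R) (g : 'cV[R]_d -> R) : Prop :=
  cb g K /\ match n with
  | 0 => True
  | m.+1 => forall i, (forall x, derivable g x (ev i)) /\ sm m K ('D_(ev i) g)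
  end.

Section Sm.
Context {R : realType} {d : nat}.
Implicit Types (h g : 'cV[R]_d -> R) (K C : R) (l : seq 'I_d).

Lemma sm_le n K K' g : K <= K' -> sm n K g -> sm n K' g.
Proof.
move=> KK'; elim: n g => [|n IH] g /= [cg H]; split=> //; try exact: cb_le cg.
by move=> i; have [? ?] := H i; split=> //; exact: IH.
Qed.

Lemma sm_cb n K g : sm n K g -> cb g K.
Proof. by case: n => [|n] []. Qed.

Lemma sm_D n K g i : sm n.+1 K g -> sm n K ('D_(ev i) g).
Proof. by move=> [_ /(_ i)[]]. Qed.

Lemma sm_derivable n K g i x : sm n.+1 K g -> derivable g x (ev i).
Proof. by move=> [_ /(_ i)[]]. Qed.

Lemma sm_pred n K g : sm n.+1 K g -> sm n K g.
Proof.
elim: n g => [|n IH] g [cg H]; split=> // i; have [? ?] := H i; split=> //.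
exact: IH.
Qed.

(** Each derivative consumes one average and costs a factor from its difference quotient. *)
Lemma boxes_sm n delta l h C : 0 < delta -> (forall i, (n <= count_mem i l)%N) ->
  cb h C -> sm n (C * (1 + 2 / delta) ^+ n) (boxes delta l h).
Proof.
move=> d0; elim: n l h C => [|n IH] l h C nl hC.
  by rewrite expr0 mulr1; split => //; exact: boxes_cb.
have q0 : 0 <= 2 / delta by rewrite divr_ge0 ?ltW.
have C0 := cb_ge0 hC.
split=> [|i].
  apply: cb_le (boxes_cb delta l hC).
  by rewrite ler_peMr// exprn_ege1// lerDl.
have il : i \in l by rewrite -has_pred1 has_count; apply: leq_trans (nl i).
split=> [x|]; first by have [] := boxes_derive d0 x hC il.
rewrite (boxes_deriveE d0 hC il).
apply: sm_le (IH (rem i l) (dq delta i h) _ _ (dq_cb d0 i hC)).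
  rewrite exprS [leRHS]mulrA ler_wpM2r ?exprn_ge0 ?addr_ge0// ler_wpM2l//; lra.
move=> j; rewrite count_mem_rem; case: eqVneq => _; last by rewrite subn0 ltnW.
by rewrite subn1 -ltnS prednK// (leq_ltn_trans _ (nl j)).
Qed.

(** Both orders of derivation give the same iterated difference quotient. *)
Lemma boxes_sym delta l h C i j : 0 < delta -> (forall i, (2 <= count_mem i l)%N) -> cb h C ->
  'D_(ev j) ('D_(ev i) (boxes delta l h)) = 'D_(ev i) ('D_(ev j) (boxes delta l h)).
Proof.
move=> d0 nl hC.
have in1 k : k \in l by rewrite -has_pred1 has_count; apply: leq_trans (nl k).
have in2 k k' : k \in rem k' l.
  rewrite -has_pred1 has_count count_mem_rem subn_gt0 (leq_ltn_trans (leq_b1 _))//.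
rewrite (boxes_deriveE d0 hC (in1 i)) (boxes_deriveE d0 hC (in1 j)).
rewrite (boxes_deriveE d0 (dq_cb d0 i hC) (in2 j i)).
rewrite (boxes_deriveE d0 (dq_cb d0 j hC) (in2 i j)) dqC; apply: (boxes_perm _ (dq_cb d0 _ (dq_cb d0 _ hC))).
apply/permP => P; rewrite !count_rem !in2 !in1 /= subnAC.
by [].
Qed.

End Sm.

(** * Taylor expansions *)

Section Taylor.
Context {R : realType}.

Lemma mvt_bound (f f' : R -> R) (t K : R) :
  (forall s, is_derive s (1 : R) f (f' s)) ->
  (forall s, `|s| <= `|t| -> `|f' s| <= K) -> `|f t - f 0| <= K * `|t|.
Proof.
move=> df fK.
have cf (A : set R) : {within A, continuous f}.
  apply: continuous_subspaceT => s; apply/differentiable_continuous/derivable1_diffP.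
  by have [] := df s.
have [t0|t0|->] := ltgtP t 0; last by rewrite subrr !normr0 mulr0.
- have [s] := MVT t0 (fun s _ => df s) (cf _).
  rewrite in_itv/= => /andP[s1 s2] E.
  rewrite distrC E normrM sub0r normrN ler_wpM2r// fK//.
  by rewrite (ltr0_norm s2) (ltr0_norm t0) lerN2 ltW.
- have [s] := MVT t0 (fun s _ => df s) (cf _).
  rewrite in_itv/= => /andP[s1 s2] E.
  rewrite E normrM subr0 ler_wpM2r// fK//.
  by rewrite (gtr0_norm s1) (gtr0_norm t0) ltW.
Qed.

Context {d : nat}.
Implicit Types (g : 'cV[R]_d -> R) (x y : 'cV[R]_d) (l : seq 'I_d).

Lemma line_derive g x i (s : R) : (forall x, derivable g x (ev i)) ->
  is_derive s (1 : R) (fun t : R => g (x + t *: ev i)) ('D_(ev i) g (x + s *: ev i)).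
Proof.
move=> dg; apply/is_derive_line.
have : is_derive (x + s *: ev i) (ev i) g ('D_(ev i) g (x + s *: ev i)) by exact: derivableP.
move/is_derive_line; congr is_derive; apply/funext => t.
by rewrite -addrA -scalerDl /GRing.scale/= mulr1.
Qed.

Lemma dir0 K g x i (t : R) : sm 1 K g -> `|g (x + t *: ev i) - g x| <= K * `|t|.
Proof.
move=> gK0; have dg z : derivable g z (ev i) by exact: sm_derivable gK0.
have [_ gK] := sm_cb (sm_D i gK0).
have := @mvt_bound _ _ t K (fun s => line_derive x s dg) (fun s _ => gK _).
by rewrite scale0r addr0.
Qed.

Lemma dir1 K g x i (t : R) : (forall z, derivable g z (ev i)) -> sm 1 K ('D_(ev i) g) ->
  `|g (x + t *: ev i) - g x - t * 'D_(ev i) g x| <= K * `|t| ^+ 2.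
Proof.
move=> dg g1.
pose f (s : R) := g (x + s *: ev i) - s * 'D_(ev i) g x.
have df (s : R) : is_derive s (1 : R) f ('D_(ev i) g (x + s *: ev i) - 'D_(ev i) g x).
  apply: is_deriveB; first exact: line_derive.
  have := is_derive_affine 0 ('D_(ev i) g x) s.
  by under eq_fun do rewrite add0r mulrC.
have fK (s : R) : `|s| <= `|t| ->
    `|'D_(ev i) g (x + s *: ev i) - 'D_(ev i) g x| <= K * `|t|.
  move=> st; apply: le_trans (dir0 _ _ _ g1) _.
  by rewrite ler_wpM2l// (cb_ge0 (sm_cb g1)).
have := mvt_bound df fK.
rewrite /f scale0r addr0 mul0r subr0 expr2 mulrA.
by congr (_ <= _); congr (`|_|); rewrite addrAC.
Qed.

Lemma dir2 K g x i (t : R) : sm 3 K g ->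
  `|g (x + t *: ev i) - g x - t * 'D_(ev i) g x - t ^+ 2 / 2 * 'D_(ev i) ('D_(ev i) g) x|
  <= K * `|t| ^+ 3.
Proof.
move=> gK0; have dg z : derivable g z (ev i) by exact: sm_derivable gK0.
have g1 := sm_D i gK0.
set b := 'D_(ev i) ('D_(ev i) g) x.
pose f (s : R) := g (x + s *: ev i) - s * 'D_(ev i) g x - s ^+ 2 / 2 * b.
have df (s : R) : is_derive s (1 : R) f
    ('D_(ev i) g (x + s *: ev i) - 'D_(ev i) g x - s * b).
  apply: is_deriveB.
    apply: is_deriveB; first exact: line_derive.
    have := is_derive_affine 0 ('D_(ev i) g x) s.
    by under eq_fun do rewrite add0r mulrC.
  have D : is_derive s (1 : R) (fun r : R => (b / 2) * (r * r)) ((b / 2) * (s * 1 + s * 1)) :=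
    is_deriveZ (b / 2) (is_deriveM (is_derive_id s (1 : R)) (is_derive_id s (1 : R))).
  have -> : s * b = (b / 2) * (s * 1 + s * 1) by field.
  by rewrite (_ : (fun r : R => r ^+ 2 / 2 * b) = (fun r : R => (b / 2) * (r * r)))//; apply/funext => r; ring.
have fK (s : R) : `|s| <= `|t| ->
    `|'D_(ev i) g (x + s *: ev i) - 'D_(ev i) g x - s * b| <= K * `|t| ^+ 2.
  move=> st; apply: le_trans (dir1 _ _ (fun z => @sm_derivable _ _ _ _ _ i z g1) (sm_D i g1)) _.
  by rewrite ler_wpM2l// ?(cb_ge0 (sm_cb g1))// lerXn2r// nnegrE.
have := mvt_bound df fK.
rewrite /f scale0r addr0 mul0r expr0n /= mul0r mul0r !subr0 -[leRHS]mulrA -exprSr => H.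
by rewrite (_ : _ - g x - _ - _ = g (x + t *: ev i) - t * 'D_(ev i) g x - t ^+ 2 / 2 * b - g x)//; ring.
Qed.

(** Displacements are completed one coordinate after the other, so that only the
    mean value theorem on lines is needed. *)
Definition partial_sum l y : 'cV[R]_d := \sum_(i <- l) y i 0 *: ev i.

Lemma taylor0 K g x y l : sm 1 K g ->
  `|g (x + partial_sum l y) - g x| <= K * `|y| * (size l)%:R.
Proof.
move=> gK; rewrite /partial_sum; elim: l => [|i l IH].
  by rewrite big_nil addr0 subrr normr0 mulr0.
rewrite big_cons addrCA [_ *: _ + _]addrC.
have h1 := dir0 (x + \sum_(j <- l) y j 0 *: ev j) i (y i 0) gK.
apply: le_trans (ler_distD (g (x + \sum_(j <- l) y j 0 *: ev j)) _ _) _.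
rewrite /= -natr1 mulrDr mulr1 [leRHS]addrC lerD// (le_trans h1)// ler_wpM2l ?coord_le_norm//.
exact: cb_ge0 (sm_cb gK).
Qed.

Lemma taylor1 K g x y l : 0 <= K -> (forall i z, derivable g z (ev i)) ->
  (forall i, sm 1 K ('D_(ev i) g)) ->
  `|g (x + partial_sum l y) - g x - \sum_(i <- l) y i 0 * 'D_(ev i) g x|
  <= K * `|y| ^+ 2 * (size l)%:R ^+ 2.
Proof.
move=> K0 dg gK.
elim: l => [|i l IH].
  by rewrite /partial_sum !big_nil addr0 subr0 subrr normr0 expr0n/= mulr0.
rewrite /partial_sum big_cons addrCA [_ *: _ + _]addrC -/(partial_sum l y).
set z := x + partial_sum l y in IH *.
have h1 := dir1 z (y i 0) (dg i) (gK i).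
have h2 := taylor0 x y l (gK i); rewrite -/z in h2.
have yi := coord_le_norm y i.
rewrite big_cons /= -natr1; set m := (size l)%:R in h2 IH *.
have m0 : 0 <= m by rewrite /m ler0n.
have h1' : `|g (z + y i 0 *: ev i) - g z - y i 0 * 'D_(ev i) g z| <= K * `|y| ^+ 2.
  by apply: le_trans h1 _; rewrite ler_wpM2l// lerXn2r// nnegrE.
have h2' : `|y i 0 * ('D_(ev i) g z - 'D_(ev i) g x)| <= K * `|y| ^+ 2 * m.
  rewrite normrM (_ : K * `|y| ^+ 2 * m = `|y| * (K * `|y| * m)); last by ring.
  by apply: ler_pM.
move: h1' h2' IH; set S := \sum_(j <- l) _.
set a := g (z + _); set b := g z; set c := g x; set u := 'D__ _ _; set v := 'D__ _ _.
set w := y i 0 => h1' h2' IH.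
have -> : a - c - (w * v + S) = (a - b - w * u) + w * (u - v) + (b - c - S) by ring.
apply: le_trans (ler_normD _ _) _; apply: le_trans (lerD (ler_normD _ _) (lexx _)) _.
apply: le_trans (lerD (lerD h1' h2') IH) _.
have KY : 0 <= K * `|y| ^+ 2 by rewrite mulr_ge0// exprn_ge0.
move: KY; move: (K * _) => KY KY0.
have -> : KY + KY * m + KY * m ^+ 2 = KY * (1 + m + m ^+ 2) by ring.
rewrite ler_wpM2l//; nra.
Qed.

Lemma quad_cons (I : Type) (i : I) (l : seq I) (y : I -> R) (c : I -> I -> R) :
  (forall a b, c a b = c b a) ->
  \sum_(a <- i :: l) \sum_(b <- i :: l) y a * y b * c a b =
  y i ^+ 2 * c i i + 2 * (y i * \sum_(b <- l) y b * c i b)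
  + \sum_(a <- l) \sum_(b <- l) y a * y b * c a b.
Proof.
move=> sym; rewrite big_cons big_cons.
under [X in _ + _ + X = _]eq_bigr do rewrite big_cons.
rewrite big_split /= mulr_sumr.
under [X in _ + X + _ = _]eq_bigr do rewrite -mulrA.
under [X in _ + _ + (X + _) = _]eq_bigr do rewrite sym [y _ * y i]mulrC -mulrA.
ring.
Qed.

Lemma taylor2 K g x y l (c1 : 'I_d -> R) (c2 : 'I_d -> 'I_d -> R) : sm 3 K g ->
  (forall i, c1 i = 'D_(ev i) g x) ->
  (forall i j, c2 i j = 'D_(ev j) ('D_(ev i) g) x) ->
  (forall i j, c2 i j = c2 j i) ->
  `|g (x + partial_sum l y) - g x - \sum_(i <- l) y i 0 * c1 i
    - 2^-1 * \sum_(i <- l) \sum_(j <- l) y i 0 * y j 0 * c2 i j|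
  <= K * `|y| ^+ 3 * (size l)%:R ^+ 3.
Proof.
move=> gK c1E c2E sym; have K0 := cb_ge0 (sm_cb gK).
elim: l => [|i l IH].
  by rewrite /partial_sum !big_nil addr0 !subrr mulr0 subrr normr0 expr0n/= mulr0.
rewrite /partial_sum big_cons addrCA [_ *: _ + _]addrC -/(partial_sum l y).
set z := x + partial_sum l y in IH *.
have h1 := dir2 z i (y i 0) gK.
have h2 := taylor1 x y l K0 (fun j z => @sm_derivable _ _ _ _ _ j z (sm_D i gK)) (fun j => sm_D j (sm_D i gK)); rewrite -/z in h2.
have h3 := taylor0 x y l (sm_D i (sm_D i gK)); rewrite -/z in h3.
have yi := coord_le_norm y i.
rewrite [X in _ - X - _]big_cons.
rewrite [X in 2^-1 * X](quad_cons i l (fun a => y a 0) sym).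
rewrite [size _]/= -[(size l).+1%:R]natr1.
have E : \sum_(j <- l) y j 0 * 'D_(ev j) ('D_(ev i) g) x = \sum_(j <- l) y j 0 * c2 i j.
  by apply: eq_bigr => j _; rewrite c2E.
rewrite E -c1E in h2; rewrite -c2E in h3.
move: h1 h2 h3 IH.
set S1 := \sum_(j <- l) y j 0 * c2 i j.
set S := \sum_(j <- l) y j 0 * c1 j.
set SS := \sum_(a <- l) \sum_(b <- l) _.
set a := g (z + _); set b := g z; set c := g x.
set u := 'D_(ev i) g z; set u2 := 'D_(ev i) ('D_(ev i) g) z.
set m := (size l)%:R; set w := y i 0 in yi * => h1 h2 h3 IH.
have m0 : 0 <= m by rewrite /m ler0n.
have h1' : `|a - b - w * u - w ^+ 2 / 2 * u2| <= K * `|y| ^+ 3.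
  by apply: le_trans h1 _; rewrite ler_wpM2l// lerXn2r// nnegrE.
have h2' : `|w * (u - c1 i - S1)| <= K * `|y| ^+ 3 * m ^+ 2.
  rewrite normrM (_ : K * `|y| ^+ 3 * m ^+ 2 = `|y| * (K * `|y| ^+ 2 * m ^+ 2)); last by ring.
  by apply: ler_pM.
have h3' : `|w ^+ 2 / 2 * (u2 - c2 i i)| <= K * `|y| ^+ 3 * m.
  rewrite normrM (_ : K * `|y| ^+ 3 * m = `|y| ^+ 2 * (K * `|y| * m)); last by ring.
  apply: ler_pM => //; rewrite normrM normrX [`|2^-1|]ger0_norm ?invr_ge0//.
  apply: (@le_trans _ _ (`|w| ^+ 2)); last by rewrite lerXn2r// nnegrE.
  by rewrite ler_piMr ?exprn_ge0// invf_le1// ler1n.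
have -> : a - c - (w * c1 i + S) - 2^-1 * (w ^+ 2 * c2 i i + 2 * (w * S1) + SS) =
   (a - b - w * u - w ^+ 2 / 2 * u2) + w * (u - c1 i - S1) + w ^+ 2 / 2 * (u2 - c2 i i)
   + (b - c - S - 2^-1 * SS) by field.
apply: le_trans (ler_normD _ _) _; apply: le_trans (lerD (ler_normD _ _) (lexx _)) _.
apply: le_trans (lerD (lerD (ler_normD _ _) (lexx _)) (lexx _)) _.
apply: le_trans (lerD (lerD (lerD h1' h2') h3') IH) _.
have KY : 0 <= K * `|y| ^+ 3 by rewrite mulr_ge0// exprn_ge0.
move: KY; move: (K * _) => KY KY0.
have -> : KY + KY * m ^+ 2 + KY * m + KY * m ^+ 3 = KY * (1 + m ^+ 2 + m + m ^+ 3) by ring.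
rewrite ler_wpM2l//; nra.
Qed.

Definition grad_dot g x y := \sum_i y i 0 * 'D_(ev i) g x.

Definition hess_dot g x y := \sum_i \sum_j y i 0 * y j 0 * 'D_(ev j) ('D_(ev i) g) x.

Lemma partial_sum_enum y : partial_sum (index_enum 'I_d) y = y.
Proof. by rewrite [RHS]cv_sum_ev. Qed.

Lemma size_index_enum_ord : size (index_enum 'I_d) = d.
Proof. by rewrite -[RHS]card_ord cardT /index_enum -enumT. Qed.

Lemma taylor_first K g x y : 0 <= K -> (forall i z, derivable g z (ev i)) ->
  (forall i, sm 1 K ('D_(ev i) g)) ->
  `|g (x + y) - g x - grad_dot g x y| <= K * d%:R ^+ 2 * `|y| ^+ 2.
Proof.
move=> K0 dg gK; have := taylor1 x y (index_enum 'I_d) K0 dg gK.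
by rewrite partial_sum_enum size_index_enum_ord mulrAC.
Qed.

Lemma lipschitz_sm K g x y : sm 1 K g -> `|g (x + y) - g x| <= K * d%:R * `|y|.
Proof.
move=> gK; have := taylor0 x y (index_enum 'I_d) gK.
by rewrite partial_sum_enum size_index_enum_ord mulrAC.
Qed.

(** The remainder is cubic for small increments and quadratic for large ones,
    so that its mean only needs second moments. *)
Lemma taylor_second K g x y : sm 3 K g ->
  (forall i j, 'D_(ev j) ('D_(ev i) g) = 'D_(ev i) ('D_(ev j) g)) ->
  `|g (x + y) - g x - grad_dot g x y - 2^-1 * hess_dot g x y|
  <= K * 2 * d%:R ^+ 3 * (`|y| ^+ 2 * Num.min 1 `|y|).
Proof.
move=> gK sym; have K0 := cb_ge0 (sm_cb gK).
have h3 := @taylor2 _ _ x y (index_enum 'I_d) _ _ gK (fun i => erefl) (fun i j => erefl)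
  (fun i j => congr1 (@^~ x) (sym i j)).
rewrite partial_sum_enum size_index_enum_ord in h3.
have h2 := taylor_first x y K0 (fun i z => @sm_derivable _ _ _ _ _ i z gK) (fun i => sm_pred (sm_D i gK)).
have d0 : (0 : R) <= d%:R by rewrite ler0n.
have hh : `|hess_dot g x y| <= K * d%:R ^+ 2 * `|y| ^+ 2.
  rewrite /hess_dot; apply: le_trans (ler_norm_sum _ _ _) _.
  apply: (@le_trans _ _ (\sum_(i < d) \sum_(j < d) K * `|y| ^+ 2)).
    apply: ler_sum => i _; apply: le_trans (ler_norm_sum _ _ _) _.
    apply: ler_sum => j _; rewrite !normrM mulrC ler_pM//.
      exact: (sm_cb (sm_D j (sm_D i gK))).2.
    by rewrite expr2 ler_pM// coord_le_norm.
  have sc (c : R) : \sum_(j < d) c = c * d%:R by rewrite sumr_const card_ord mulr_natr.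
  rewrite (eq_bigr (fun=> K * `|y| ^+ 2 * d%:R)) => [|i _]; last exact: sc.
  by rewrite sc (_ : _ * _ * _ = K * d%:R ^+ 2 * `|y| ^+ 2)//; ring.
(* Large increments: the second order term is itself quadratic. *)
have [y1|y1] := lerP 1 `|y|.
  apply: le_trans (ler_normB _ _) _.
  apply: le_trans (lerD h2 (lexx _)) _; rewrite normrM ger0_norm ?invr_ge0//.
  rewrite mulr1; apply: le_trans (lerD (lexx _) (ler_wpM2l _ hh)) _; first by rewrite invr_ge0.
  have KY : 0 <= K * `|y| ^+ 2 by rewrite mulr_ge0// exprn_ge0.
  have dd : (d%:R : R) ^+ 2 <= d%:R ^+ 3.
    by rewrite -!natrX ler_nat [leqRHS]expnS; case: (d) => // m; rewrite leq_pmull.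
  have := ler_wpM2l KY dd; have : 0 <= K * `|y| ^+ 2 * d%:R ^+ 2 by rewrite mulr_ge0// exprn_ge0.
  have -> : K * d%:R ^+ 2 * `|y| ^+ 2 = K * `|y| ^+ 2 * d%:R ^+ 2 by ring.
  have -> : K * 2 * d%:R ^+ 3 * `|y| ^+ 2 = 2 * (K * `|y| ^+ 2 * d%:R ^+ 3) by ring.
  move: (_ * d%:R ^+ 2) (_ * d%:R ^+ 3) => u v; lra.
apply: le_trans h3 _.
have -> : K * 2 * d%:R ^+ 3 * (`|y| ^+ 2 * `|y|) = 2 * (K * `|y| ^+ 3 * d%:R ^+ 3) by ring.
have : 0 <= K * `|y| ^+ 3 * d%:R ^+ 3 by rewrite !mulr_ge0// exprn_ge0.
move: (_ * d%:R ^+ 3) => u; lra.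
Qed.

End Taylor.

(** * Test functions *)

Section BoundedContinuous.
Context {R : realType} {V : normedModType R}.
Implicit Types g h : V -> R.

Lemma bcP g : bounded_continuous g <-> continuous g /\ exists C, forall x, `|g x| <= C.
Proof.
split=> [[cg [M [Mr gM]]]|[cg [C gC]]]; split => //.
  by exists (M + 1) => x; apply: gM => //; rewrite ltrDl.
by exists C; split; [exact: num_real|move=> M CM x _; apply: le_trans (gC x) (ltW CM)].
Qed.

Lemma bc_cst (c : R) : bounded_continuous (fun _ : V => c).
Proof. by apply/bcP; split; [exact: cst_continuous|exists `|c|]. Qed.

Lemma bcD g h : bounded_continuous g -> bounded_continuous h ->
  bounded_continuous (fun x => g x + h x).
Proof.
move=> /bcP[cg [C gC]] /bcP[ch [D hD]]; apply/bcP; split; first exact: contD.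
by exists (C + D) => x; rewrite (le_trans (ler_normD _ _))// lerD.
Qed.

Lemma bcM g h : bounded_continuous g -> bounded_continuous h ->
  bounded_continuous (fun x => g x * h x).
Proof.
move=> /bcP[cg [C gC]] /bcP[ch [D hD]]; apply/bcP; split; first exact: contM.
by exists (C * D) => x; rewrite normrM ler_pM.
Qed.

End BoundedContinuous.

Lemma is_deriveM' {R : realType} {V : normedModType R} (f g : V -> R) z v (a b : R) :
  is_derive z v f a -> is_derive z v g b ->
  is_derive z v (fun z => f z * g z) (a * g z + f z * b).
Proof.
by move=> da db; have := is_deriveM da db; rewrite /GRing.scale /= addrC [g z * a]mulrC.
Qed.

Section Jets.
Context {R : realType} {d : nat}.
Notation V := 'cV[R]_d.
Notation QT := (R * 'cV[R]_d)%type.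
Implicit Types (phi psi : QT -> R) (k l : option 'I_d).

(** Carrying the derivatives as parameters allows those of a composite test function to
    be computed structurally. *)
Definition jet phi (p1 : option 'I_d -> QT -> R) (p2 : option 'I_d -> option 'I_d -> QT -> R) :=
  [/\ bounded_continuous phi,
      forall k, (forall z, is_derive z (axis k) phi (p1 k z)) /\ bounded_continuous (p1 k) &
      forall k l, (forall z, is_derive z (axis l) (p1 k) (p2 k l z)) /\
        bounded_continuous (p2 k l)].

Lemma jetE phi p1 p2 : jet phi p1 p2 ->
  [/\ C2b phi, forall z, time_derivative phi z = p1 None z &
      forall z i j, hessian phi z i j = p2 (Some i) (Some j) z].
Proof.
move=> [bp h1 h2].
have E1 k : 'D_(axis k) phi = p1 k by apply/funext => z; have [_] := (h1 k).1 z.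
have E2 k l : 'D_(axis l) (p1 k) = p2 k l by apply/funext => z; have [_] := (h2 k l).1 z.
split=> [|z|z i j].
- split=> // [k|k l]; rewrite ?E1 ?E2.
    by split; [move=> z; have [] := (h1 k).1 z|exact: (h1 k).2].
  by split; [move=> z; have [] := (h2 k l).1 z|exact: (h2 k l).2].
- by rewrite /time_derivative; have /(congr1 (fun F => F z)) := E1 None.
- by rewrite mxE; have /(congr1 (fun F => F z)) := E2 (Some i) (Some j); rewrite -E1.
Qed.

Lemma C2b_jet phi : C2b phi ->
  jet phi (fun k => 'D_(axis k) phi) (fun k l => 'D_(axis l) ('D_(axis k) phi)).
Proof.
move=> [bp h1 h2]; split=> [|k|k l]; first by [].
  by split=> [z|]; [apply: derivableP; exact: (h1 k).1|exact: (h1 k).2].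
by split=> [z|]; [apply: derivableP; exact: (h2 k l).1|exact: (h2 k l).2].
Qed.

Lemma jet_cst c : jet (fun=> c) (fun _ _ => 0) (fun _ _ _ => 0).
Proof.
split=> [|k|k l]; [exact: bc_cst| |].
  by split=> [z|]; [exact: is_derive_cst|exact: bc_cst].
by split=> [z|]; [exact: is_derive_cst|exact: bc_cst].
Qed.

Lemma jetD phi psi p1 p2 q1 q2 : jet phi p1 p2 -> jet psi q1 q2 ->
  jet (fun z => phi z + psi z) (fun k z => p1 k z + q1 k z)
      (fun k l z => p2 k l z + q2 k l z).
Proof.
move=> [bp hp1 hp2] [bq hq1 hq2]; split=> [|k|k l]; [exact: bcD| |].
  split=> [z|]; last exact: bcD (hp1 k).2 (hq1 k).2.
  by apply: is_deriveD; [exact: (hp1 k).1|exact: (hq1 k).1].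
split=> [z|]; last exact: bcD (hp2 k l).2 (hq2 k l).2.
by apply: is_deriveD; [exact: (hp2 k l).1|exact: (hq2 k l).1].
Qed.

Lemma jetM phi psi p1 p2 q1 q2 : jet phi p1 p2 -> jet psi q1 q2 ->
  jet (fun z => phi z * psi z) (fun k z => p1 k z * psi z + phi z * q1 k z)
      (fun k l z => (p2 k l z * psi z + p1 k z * q1 l z) + (p1 l z * q1 k z + phi z * q2 k l z)).
Proof.
move=> [bp hp1 hp2] [bq hq1 hq2]; split=> [|k|k l]; [exact: bcM| |].
  split=> [z|].
    by apply: is_deriveM'; [exact: (hp1 k).1|exact: (hq1 k).1].
  by apply: bcD; apply: bcM => //; [exact: (hp1 k).2|exact: (hq1 k).2].
split=> [z|].
  apply: is_deriveD; apply: is_deriveM'.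
  - exact: (hp2 k l).1.
  - exact: (hq1 l).1.
  - exact: (hp1 l).1.
  - exact: (hq2 k l).1.
by apply: bcD; apply: bcD; apply: bcM => //; solve [exact: (hp1 _).2|exact: (hq1 _).2|
  exact: (hp2 _ _).2|exact: (hq2 _ _).2].
Qed.

Lemma jetZ c phi p1 p2 : jet phi p1 p2 ->
  jet (fun z => c * phi z) (fun k z => c * p1 k z) (fun k l z => c * p2 k l z).
Proof.
move=> hp; have := jetM (jet_cst c) hp.
congr jet; do ?[apply/funext => ?]; by rewrite ?(mul0r, add0r, addr0).
Qed.

Definition zcoord k (z : QT) : R := if k is Some i then z.2 i 0 else z.1.

Lemma coord_line k l z (t : R) :
  zcoord k (z + t *: axis l) = zcoord k z + t * (k == l)%:R.
Proof.
case: k l => [i|] [j|] /=.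
- by rewrite !mxE eqxx andbT.
- by rewrite scaler0 addr0 mulr0 addr0.
- by rewrite mulr0 addr0 [t *: 0]mulr0 addr0.
- by rewrite [t *: 1]mulr1 mulr1.
Qed.

Lemma coordz_continuous k : continuous (zcoord k).
Proof.
case: k => [i|] z; last exact: cvg_fst.
apply: (@continuous_comp _ _ _ snd (fun x : V => x i 0)); first exact: cvg_snd.
exact: coord_continuous.
Qed.

Definition jet1 (r r1 r2 : R -> R) :=
  [/\ bounded_continuous r, bounded_continuous r1, bounded_continuous r2,
      forall s, is_derive s (1 : R) r (r1 s) & forall s, is_derive s (1 : R) r1 (r2 s)].

Lemma bc_coord (r : R -> R) k : bounded_continuous r -> bounded_continuous (fun z => r (zcoord k z)).
Proof.
move=> /bcP[cr [C rC]]; apply/bcP; split; last by exists C => z.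
move=> z; apply: (@continuous_comp _ _ _ (zcoord k) r); last exact: cr.
exact: coordz_continuous.
Qed.

Lemma derive_coord (r r1 : R -> R) k l z : (forall s, is_derive s (1 : R) r (r1 s)) ->
  is_derive z (axis l) (fun z => r (zcoord k z)) (r1 (zcoord k z) * (k == l)%:R).
Proof.
move=> dr; apply/is_derive_line.
under eq_fun do rewrite coord_line mulrC.
apply: is_derive1_comp; last exact: is_derive_affine.
by rewrite mulr0 addr0.
Qed.

Lemma jet_coord r r1 r2 m : jet1 r r1 r2 ->
  jet (fun z => r (zcoord m z)) (fun k z => r1 (zcoord m z) * (m == k)%:R)
      (fun k l z => r2 (zcoord m z) * (m == l)%:R * (m == k)%:R).
Proof.
move=> [b0 b1 b2 d1 d2]; split=> [|k|k l]; first exact: bc_coord.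
  split=> [z|]; first exact: derive_coord.
  by apply: bcM; [exact: bc_coord|exact: bc_cst].
split=> [z|]; last first.
  by apply: bcM (bc_cst _); apply: bcM (bc_cst _); exact: bc_coord.
have := is_deriveM' (derive_coord m l z d2) (is_derive_cst ((m == k)%:R : R) z (axis l)).
by rewrite mulr0 addr0.
Qed.

Lemma bc_space (g : V -> R) K : cb g K -> bounded_continuous (fun z : QT => g z.2).
Proof.
move=> [cg gK]; apply/bcP; split; last by exists K => z.
move=> z; apply: (@continuous_comp _ _ _ snd g); last exact: cg.
exact: cvg_snd.
Qed.

Lemma derive_space (g : V -> R) l (z : QT) : (forall i x, derivable g x (ev i)) ->
  is_derive z (axis l) (fun z : QT => g z.2) (if l is Some i then 'D_(ev i) g z.2 else 0).
Proof.
move=> dg; case: l => [i|]; apply/is_derive_line => /=.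
  have D : is_derive z.2 (ev i) g ('D_(ev i) g z.2) by apply: derivableP; exact: dg.
  exact: (proj2 (is_derive_line g z.2 (ev i) _) D).
under eq_fun do rewrite scaler0 addr0.
exact: is_derive_cst.
Qed.

Lemma jet_space K (g : V -> R) : sm 2 K g ->
  jet (fun z => g z.2) (fun k z => if k is Some i then 'D_(ev i) g z.2 else 0)
    (fun k l z => if k is Some i then if l is Some j then 'D_(ev j) ('D_(ev i) g) z.2 else 0
                  else 0).
Proof.
move=> gK; split=> [|k|k l]; first exact: bc_space (sm_cb gK).
  split=> [z|]; first by apply: derive_space => i x; exact: sm_derivable gK.
  by case: k => [i|]; [exact: bc_space (sm_cb (sm_D i gK))|exact: bc_cst].
case: k => [i|]; last first.
  split=> [z|]; [exact: is_derive_cst|exact: bc_cst].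
split=> [z|]; first by apply: derive_space => j x; exact: sm_derivable (sm_D i gK).
by case: l => [j|]; [exact: bc_space (sm_cb (sm_D j (sm_D i gK)))|exact: bc_cst].
Qed.

End Jets.

(** * Bump functions *)

Section Bumps.
Context {R : realType}.
Implicit Types (c s : R).

Lemma jet1_cst c : jet1 (fun _ : R => c) (fun=> 0) (fun=> 0).
Proof.
by split=> [|||s|s]; try exact: bc_cst; exact: is_derive_cst.
Qed.

Lemma jet1D (r r1 r2 q q1 q2 : R -> R) : jet1 r r1 r2 -> jet1 q q1 q2 ->
  jet1 (fun s => r s + q s) (fun s => r1 s + q1 s) (fun s => r2 s + q2 s).
Proof.
move=> [b0 b1 b2 d1 d2] [c0 c1 c2 e1 e2].
by split=> [|||s|s]; try exact: bcD; apply: is_deriveD.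
Qed.

Lemma jet1M (r r1 r2 q q1 q2 : R -> R) : jet1 r r1 r2 -> jet1 q q1 q2 ->
  jet1 (fun s => r s * q s) (fun s => r1 s * q s + r s * q1 s)
    (fun s => (r2 s * q s + r1 s * q1 s) + (r1 s * q1 s + r s * q2 s)).
Proof.
move=> [b0 b1 b2 d1 d2] [c0 c1 c2 e1 e2].
split=> [|||s|s]; try by repeat first [exact: bcM|apply: bcD].
  exact: is_deriveM'.
by apply: is_deriveD; apply: is_deriveM'.
Qed.

Lemma jet1_affine (r r1 r2 : R -> R) (a b : R) : jet1 r r1 r2 ->
  jet1 (fun s => r (a + b * s)) (fun s => b * r1 (a + b * s)) (fun s => b ^+ 2 * r2 (a + b * s)).
Proof.
move=> [b0 b1 b2 d1 d2].
have ca : continuous (fun s : R => a + b * s).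
  move=> s; apply/differentiable_continuous/derivable1_diffP.
  by have [] := is_derive_affine a b s.
have bca (q : R -> R) : bounded_continuous q -> bounded_continuous (fun s => q (a + b * s)).
  move=> /bcP[cq [C qC]]; apply/bcP; split; last by exists C => s.
  by move=> s; apply: (@continuous_comp _ _ _ (fun s => a + b * s) q); [exact: ca|exact: cq].
split=> [|||s|s]; try by [exact: bca|apply: bcM (bc_cst _) _; exact: bca].
  rewrite mulrC; apply: (is_derive1_comp (g := fun s => a + b * s)) => //; exact: is_derive_affine.
rewrite expr2 -mulrA [b * r2 _]mulrC; apply: is_deriveZ.
by apply: (is_derive1_comp (g := fun s => a + b * s)) => //; exact: is_derive_affine.
Qed.

(** Rational functions replace smooth functions of compact support: both are bounded, and
    their derivatives are polynomials in them, hence bounded too. *)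
Definition wit c s : R := (c + s ^+ 2)^-1.
Definition agn c s : R := s * (c + s ^+ 2)^-1.

Context (c : R) (c1 : 1 <= c).

Let den_gt0 s : 0 < c + s ^+ 2.
Proof. by rewrite ltr_wpDr ?sqr_ge0// (lt_le_trans ltr01). Qed.

Lemma wit_gt0 s : 0 < wit c s.
Proof. by rewrite invr_gt0. Qed.

Lemma wit_le1 s : wit c s <= 1.
Proof. by rewrite invf_le1// (le_trans c1)// lerDl sqr_ge0. Qed.

Lemma agn_le1 s : `|agn c s| <= 1.
Proof.
rewrite normrM normfV (gtr0_norm (den_gt0 s)) ler_pdivrMr// mul1r.
have : 0 <= (`|s| - 1) ^+ 2 by rewrite sqr_ge0.
have := sqr_ge0 `|s|; rewrite sqrrB real_normK ?num_real// expr1n mulr1.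
have := normr_ge0 s; move: c1; move: (s ^+ 2) => u; lra.
Qed.

Lemma wit_derive s : is_derive s (1 : R) (wit c) (- 2 * agn c s * wit c s).
Proof.
have d1 : is_derive s (1 : R) (fun r : R => c + r * r) (0 + (s * 1 + s * 1)) :=
  is_deriveD (is_derive_cst c s (1 : R))
   (is_deriveM (is_derive_id s (1 : R)) (is_derive_id s (1 : R))).
have n0 : c + s * s != 0 by rewrite gt_eqF// -expr2.
have := @is_deriveV _ (fun r : R => c + r * r) _ _ _ n0 d1.
have -> : wit c = (fun y => (c + y * y)^-1) by apply/funext.
move=> D; apply: is_derive_eq D _.
by rewrite /agn /GRing.scale /= !expr2; field.
Qed.

Lemma agn_derive s : is_derive s (1 : R) (agn c) (- wit c s + 2 * c * wit c s ^+ 2).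
Proof.
have := is_deriveM' (is_derive_id s (1 : R)) (wit_derive s).
move=> D; apply: is_derive_eq D _.
rewrite /agn /wit /=; field.
by rewrite gt_eqF.
Qed.

Lemma bc_wit : bounded_continuous (wit c).
Proof.
apply/bcP; split; last by exists 1 => s; rewrite gtr0_norm ?wit_gt0// wit_le1.
move=> s; apply/differentiable_continuous/derivable1_diffP.
by have [] := wit_derive s.
Qed.

Lemma bc_agn : bounded_continuous (agn c).
Proof.
apply/bcP; split; last by exists 1 => s; exact: agn_le1.
move=> s; apply/differentiable_continuous/derivable1_diffP.
by have [] := agn_derive s.
Qed.

Lemma jet1_wit : jet1 (wit c) (fun s => - 2 * agn c s * wit c s)
  (fun s => - 2 * (- wit c s + 2 * c * wit c s ^+ 2) * wit c s
            + - 2 * agn c s * (- 2 * agn c s * wit c s)).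
Proof.
have [bw ba] := (bc_wit, bc_agn).
split=> [|||s|s]; first by [].

- by do 2!apply: bcM => //; exact: bc_cst.
- apply: bcD; last by do ?[apply: bcM => //]; exact: bc_cst.
  apply: bcM => //; apply: bcM (bc_cst _) _; apply: bcD.
    by under eq_fun do rewrite -mulN1r; apply: bcM (bc_cst _) bw.
  by apply: bcM (bc_cst _) _; under eq_fun do rewrite expr2; exact: bcM.
- exact: wit_derive.
- apply: is_deriveM'; last exact: wit_derive.
  exact: is_deriveZ (agn_derive s).
Qed.

Lemma jet1_agn : jet1 (agn c) (fun s => - wit c s + 2 * c * wit c s ^+ 2)
  (fun s => - (- 2 * agn c s * wit c s) + 2 * c * (2 * wit c s * (- 2 * agn c s * wit c s))).
Proof.
have [bw ba] := (bc_wit, bc_agn).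
split=> [|||s|s]; first by [].

- apply: bcD; first by under eq_fun do rewrite -mulN1r; apply: bcM (bc_cst _) bw.
  by apply: bcM (bc_cst _) _; under eq_fun do rewrite expr2; exact: bcM.
- apply: bcD; first by under eq_fun do rewrite -mulN1r; do ?[apply: bcM => //]; exact: bc_cst.
  by do ?[apply: bcM => //]; exact: bc_cst.
- exact: agn_derive.
- apply: is_deriveD; first exact: is_deriveN (wit_derive s).
  apply: is_deriveZ; have := is_deriveM' (wit_derive s) (wit_derive s).
  under eq_fun do rewrite -expr2.
  by move=> D; apply: is_derive_eq D _; ring.
Qed.

End Bumps.

Section Theta.
Context {R : realType}.
Implicit Types (s : R).

(** Equal to [s ^ 4 / (1 + s ^ 2) ^ 2]: bounded, flat to third order at the origin, and
    positive elsewhere. *)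
Definition theta s : R := (1 - wit 1 s) * (1 - wit 1 s).

Lemma theta_jet : exists t1 t2, [/\ jet1 theta t1 t2, t1 0 = 0 & t2 0 = 0].
Proof.
have J := jet1D (jet1_cst 1) (jet1M (jet1_cst (-1)) (jet1_wit (lexx (1 : R)))).
have JJ := jet1M J J.
rewrite (_ : (fun s => _) = theta) in JJ; last first.
  by apply/funext => s; rewrite /theta mulN1r.
have w0 : wit (1 : R) 0 = 1 by rewrite /wit expr0n addr0 invr1.
have a0 : agn (1 : R) 0 = 0 by rewrite /agn mul0r.
eexists; eexists; split; first exact: JJ.
  by cbv beta; rewrite !w0 !a0; ring.
by cbv beta; rewrite !w0 !a0; ring.
Qed.

Lemma witE s : 1 - wit 1 s = s ^+ 2 * wit 1 s.
Proof.
have := wit_gt0 (lexx (1 : R)) s; rewrite /wit invr_gt0 => p.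
by field; rewrite gt_eqF.
Qed.

Lemma theta_ge0 s : 0 <= theta s.
Proof. by rewrite /theta -expr2 sqr_ge0. Qed.

Lemma theta0 : theta 0 = 0.
Proof. by rewrite /theta witE expr0n mul0r mul0r. Qed.

Lemma theta_gt0 s : s != 0 -> 0 < theta s.
Proof.
move=> s0; rewrite /theta witE.
by rewrite pmulr_rgt0 mulr_gt0 ?wit_gt0 ?exprn_even_gt0.
Qed.

Lemma theta_le s r : 0 <= s -> s <= r -> theta s <= theta r.
Proof.
move=> s0 sr; have w r' := wit_le1 (lexx (1 : R)) r'.
have : wit 1 r <= wit 1 s.
  have r0 := le_trans s0 sr.
  rewrite /wit lef_pV2 ?posrE ?ltr_wpDr ?sqr_ge0// lerD2l.
  by rewrite lerXn2r ?nnegrE.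
by have := w s; have := w r => *; apply: ler_pM; rewrite ?subr_ge0// lerD2l lerN2.
Qed.

Lemma theta_ge s : 1 <= `|s| -> 4^-1 <= theta s.
Proof.
move=> s1; have : wit 1 s <= 2^-1.
  rewrite /wit lef_pV2 ?posrE ?ltr_wpDr ?sqr_ge0//.
  have : 1 <= `|s| ^+ 2 by rewrite exprn_ege1.
  rewrite real_normK ?num_real//; move: (s ^+ 2) => u; lra.
have := wit_le1 (lexx (1 : R)) s; rewrite /theta; move: (wit 1 s) => w; nra.
Qed.

End Theta.

(** * Touching from above *)

Lemma lipschitz_continuous {R : realType} {V W : normedModType R} (f : V -> W) (Lp : R) :
  (forall x y, `|f x - f y| <= Lp * `|x - y|) -> continuous f.
Proof.
move=> fl x; apply/cvgrPdist_le => e e0.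
have L0 : 0 < `|Lp| + 1 by rewrite ltr_wpDl.
near=> y; apply: le_trans (fl x y) _.
apply: (@le_trans _ _ ((`|Lp| + 1) * `|x - y|)).
  by rewrite ler_wpM2r// (le_trans (ler_norm _))// lerDl.
rewrite -ler_pdivlMl//; near: y; apply: cvgr_dist_le => //.
by rewrite mulr_gt0// invr_gt0.
Unshelve. all: by end_near. Qed.

Section Penalty.
Context {R : realType} {d : nat}.
Notation QT := (R * 'cV[R]_d)%type.
Implicit Types (a z : QT).

Lemma sum_delta (F : option 'I_d -> R) k : \sum_m F m * (m == k)%:R = F k.
Proof.
rewrite (bigD1 k)//= eqxx mulr1 big1 ?addr0// => m mk.
by rewrite (negbTE mk) mulr0.
Qed.

Lemma jet_sum (I : Type) (r : seq I) (phi : I -> QT -> R) p1 p2 :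
  (forall i, jet (phi i) (p1 i) (p2 i)) ->
  jet (fun z => \sum_(i <- r) phi i z) (fun k z => \sum_(i <- r) p1 i k z)
    (fun k l z => \sum_(i <- r) p2 i k l z).
Proof.
move=> h; elim: r => [|i r IH].
  have := @jet_cst R d 0.
  by congr jet; do ?[apply/funext => ?]; rewrite big_nil.
have := jetD (h i) IH.
by congr jet; do ?[apply/funext => ?]; rewrite big_cons.
Qed.

(** Flatness at [a] makes the derivatives of a test function at a contact point [a]
    insensitive to adding any multiple of this penalty. *)
Definition pen a z : R := \sum_k theta (zcoord k z - zcoord k a).

(** The bounds are uniform in [a] because the penalties are translates of each other. *)
Lemma jet_pen : exists (q1 : QT -> option 'I_d -> QT -> R)
    (q2 : QT -> option 'I_d -> option 'I_d -> QT -> R) (B : R),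
  [/\ forall a, jet (pen a) (q1 a) (q2 a),
      forall a k z, `|q1 a k z| <= B, forall a k l z, `|q2 a k l z| <= B,
      forall a k, q1 a k a = 0 & forall a k l, q2 a k l a = 0].
Proof.
have [t1 [t2 [J t10 t20]]] := @theta_jet R.
have [/bcP[_ [B1 h1]] /bcP[_ [B2 h2]]] : bounded_continuous t1 /\ bounded_continuous t2.
  by case: J.
exists (fun a k z => t1 (zcoord k z - zcoord k a)).
exists (fun a k l z => t2 (zcoord k z - zcoord k a) * (k == l)%:R).
exists (Num.max B1 B2); split=> [a|a k z|a k l z|a k|a k l].
- have Ja m : jet1 (fun s => theta (s - zcoord m a)) (fun s => t1 (s - zcoord m a))
      (fun s => t2 (s - zcoord m a)).
    have := jet1_affine (- zcoord m a) 1 J.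
    by congr jet1; apply/funext => s; rewrite ?expr1n ?mul1r addrC ?mul1r.
  have := jet_sum (index_enum (option 'I_d)) (fun m => jet_coord m (Ja m)).
  congr jet; apply/funext => k; apply/funext => z; first exact: sum_delta.
  by apply/funext => w; rewrite sum_delta.
- by rewrite le_max h1.
- rewrite normrM; case: eqP => _; rewrite ?normr1 ?normr0 ?mulr1 ?mulr0 le_max ?h2 ?orbT//.
  by rewrite (le_trans _ (h1 0)).
- by rewrite subrr.
- by rewrite subrr t20 mul0r.
Qed.

Lemma pen_ge0 a z : 0 <= pen a z.
Proof. by apply: sumr_ge0 => k _; exact: theta_ge0. Qed.

Lemma pen_ge a z k : theta (zcoord k z - zcoord k a) <= pen a z.
Proof. by rewrite /pen (bigD1 k)//= lerDl sumr_ge0// => m _; exact: theta_ge0. Qed.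

Lemma pen_self a : pen a a = 0.
Proof. by rewrite /pen big1// => k _; rewrite subrr theta0. Qed.

Lemma coord_inj a z : (forall k, zcoord k z = zcoord k a) -> z = a.
Proof.
case: z a => [s x] [t y] h; congr pair; first exact: (h None).
by apply/colP => i; exact: (h (Some i)).
Qed.

Lemma pen_gt0 a z : z <> a -> 0 < pen a z.
Proof.
move=> za; have [k hk] : exists k, zcoord k z != zcoord k a.
  apply: contrapT => H; apply: za; apply: coord_inj => k.
  by apply/eqP; apply: contrapT => /negP nk; apply: H; exists k.
by apply: lt_le_trans (pen_ge a z k); rewrite theta_gt0// subr_eq0.
Qed.

Lemma cv_ball_compact (r : R) : compact [set x : 'cV[R]_d | `|x| <= r].
Proof.
have K : compact [set v : 'rV[R]_d | forall i, `[(- r), r]%classic (v ord0 i)].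
  apply: (@rV_compact _ _ (fun=> `[(- r), r]%classic)) => _.
  exact: segment_compact.
have ct : continuous (fun v : 'rV[R]_d => (v^T : 'cV[R]_d)).
  apply: (@lipschitz_continuous _ _ _ _ 1) => v w; rewrite mul1r.
  apply: norm_le_coord => // i; rewrite !mxE.
  have := @mx_normrE R 1 d (v - w) => E.
  rewrite [leRHS]/Num.norm /= E; apply/bigmax_geP; right; exists (0, i) => //=.
  by rewrite !mxE.
have KT : compact ((fun v : 'rV[R]_d => (v^T : 'cV[R]_d)) @`
    [set v : 'rV[R]_d | forall i, `[(- r), r]%classic (v ord0 i)]).
  by apply: continuous_compact => //; exact: continuous_subspaceT.
apply: subclosed_compact KT _.
  rewrite (_ : mkset _ = [set x : 'cV[R]_d | `|x| \in `]-oo, r]%R]); last first.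
    by apply/seteqP; split=> x /=; rewrite in_itv.
  apply: (@closed_comp _ _ (fun x : 'cV[R]_d => `|x|) `]-oo, r]%classic).
    by move=> x _; exact: norm_continuous.
  exact: interval_closed.
move=> x /= xr; exists x^T; last by rewrite trmxK.
move=> i /=; rewrite in_itv/= mxE -ler_norml.
exact: le_trans (coord_le_norm _ _) xr.
Qed.

Lemma cylinder_compact (T r : R) :
  compact [set z : QT | (0 <= z.1 <= T) /\ `|z.2| <= r].
Proof.
have := compact_setX (@segment_compact R 0 T) (@cv_ball_compact r).
by congr compact; apply/seteqP; split=> -[s x] /=; rewrite in_itv.
Qed.

End Penalty.

Section Touch.
Context {R : realType} {d : nat}.
Notation QT := (R * 'cV[R]_d)%type.

(** A first small penalty makes the supremum of the difference attained; a
    second penalty, flat to second order at the contact point, makes the maximum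
    strict and dominates the difference at times after [T]. *)
Lemma touch_above (u phi : QT -> R) p1 p2 (T M kappa : R) (z0 : QT) :
  T <= 1 -> {within Q, continuous u} -> (forall z, Q z -> `|u z| <= M) ->
  jet phi p1 p2 -> (forall x, u (T, x) <= phi (T, x)) ->
  0 <= z0.1 <= T -> phi z0 < u z0 -> 0 < kappa ->
  exists psi q1 q2 (z : QT), [/\ jet psi q1 q2, 0 <= z.1 < T,
    strict_max_on Q0 (fun w => u w - psi w) z,
    forall k, `|q1 k z - p1 k z| <= kappa &
    forall k l, `|q2 k l z - p2 k l z| <= kappa].
Proof.
move=> T1 cu uM jphi uphi z0T phiu kappa0.
have [/bcP[cphi [Mp phiM]] _ _] := jphi.
have [r1 [r2 [B [jp r1B r2B r10 r20]]]] := @jet_pen R d.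
have inQ z : 0 <= z.1 <= T -> Q z.
  by move=> /andP[a b]; rewrite /Q/= a (le_trans b).
pose D z := u z - phi z.
have DM z : Q z -> D z <= M + Mp.
  move=> Qz; rewrite /D lerD//; first exact: le_trans (ler_norm _) (uM _ Qz).
  by rewrite (le_trans (ler_norm _))// normrN.
pose S := D @` [set z | 0 <= z.1 <= T].
have hS : has_sup S.
  split; first by exists (D z0), z0.
  by exists (M + Mp) => _ [z zT <-]; exact/DM/inQ.
have S0 : 0 < sup S.
  apply: (@lt_le_trans _ _ (D z0)); first by rewrite subr_gt0.
  by apply: sup_upper_bound => //; exists z0.
have B0 : 0 <= B by apply: le_trans (r1B z0 None z0).
(* The weight of the first penalty is small enough for the derivatives and for the
   difference to stay positive, yet its value at distance one beats the default [ka / 8]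
   in the supremum. *)
pose ka := Num.min (sup S) (kappa / (B + 1)).
have B1 : 0 < B + 1 by rewrite ltr_wpDl.
have ka0 : 0 < ka by rewrite lt_min S0 divr_gt0.
have kaB : ka * B <= kappa.
  apply: (@le_trans _ _ (kappa / (B + 1) * B)).
    by rewrite ler_wpM2r// ge_min lexx orbT.
  by rewrite mulrAC ler_pdivrMr// ler_wpM2l ?lerDl// ltW.
have ka8 : 0 < ka / 8 by rewrite divr_gt0.
have [_ [z1 z1T <-] z1S] := sup_adherent ka8 hS.
have Dz1 : 0 < D z1.
  apply: lt_trans z1S; have : ka <= sup S by rewrite ge_min lexx.
  move: ka0; lra.
pose D1 z := D z - ka * pen z1 z.
have D1z1 : D1 z1 = D z1 by rewrite /D1 pen_self mulr0 subr0.
pose K := [set z : QT | (0 <= z.1 <= T) /\ `|z.2| <= `|z1.2| + 1].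
have cK : compact K by exact: cylinder_compact.
have Kz1 : K z1 by split => //; rewrite lerDl.
have cD1 : {within K, continuous D1}.
  have ck : {within K, continuous u}.
    by apply: continuous_subspaceW cu => z [zT _]; exact: inQ.
  have cphiK : {within K, continuous phi} by exact: continuous_subspaceT.
  have cpen : {within K, continuous (pen z1)}.
    by apply: continuous_subspaceT; have [/bcP[]] := jp z1.
  apply: contD; first by apply: contD => //; exact: contN.
  by apply: contN; apply: contM => //; exact: cst_continuous.
have [|z2 /set_mem[z2T _] z2max] := compact_EVT_max _ cK cD1; first by exists z1.
have z2K w : K w -> D1 w <= D1 z2 by move=> Kw; apply: z2max; exact/mem_set.
have z12 : D z1 <= D1 z2 by rewrite -D1z1; exact: z2K.
have D1max w : 0 <= w.1 <= T -> D1 w <= D1 z2.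
  move=> wT; have [wK|wK] := lerP `|w.2| (`|z1.2| + 1); first exact: z2K.
  apply: le_trans z12; apply: ltW; apply: le_lt_trans z1S.
  have [i hi] : exists i, 1 <= `|w.2 i 0 - z1.2 i 0|.
    apply: contrapT => H; move: wK; rewrite ltNge => /negP; apply.
    rewrite -[w.2](subrK z1.2) addrC (le_trans (ler_normD _ _))// lerD2l.
    apply: norm_le_coord => // i; rewrite !mxE leNgt; apply/negP => hi.
    by apply: H; exists i; exact: ltW.
  have t4 : 4^-1 <= pen z1 w.
    by apply: le_trans (pen_ge z1 w (Some i)); exact: theta_ge.
  have DS : D w <= sup S by apply: sup_upper_bound => //; exists w.
  rewrite /D1; apply: lerD => //; rewrite lerN2.
  apply: (@le_trans _ _ (ka * 4^-1)); last by rewrite ler_wpM2l// ltW.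
  move: ka0; lra.
have D1z2 : 0 < D1 z2 by exact: lt_le_trans z12.
have Dz2 : 0 < D z2.
  apply: lt_le_trans D1z2 _; rewrite /D1 lerBlDr lerDl.
  by rewrite mulr_ge0 ?pen_ge0// ltW.
have z2T' : z2.1 < T.
  rewrite lt_neqAle; case/andP: (z2T) => _ ->; rewrite andbT; apply/eqP => zT.
  move: Dz2; rewrite /D subr_gt0 ltNge => /negP; apply.
  by have := uphi z2.2; rewrite -zT; case: (z2).
(* After [T] no inequality between [u] and [phi] is available, so the second penalty has to
   exceed the crude bound [M + Mp] there. *)
pose th := theta (T - z2.1).
have th0 : 0 < th by rewrite theta_gt0// subr_eq0 gt_eqF.
pose C := (`|M + Mp| + 1) / th.
have C0 : 0 < C by rewrite divr_gt0// ltr_wpDl.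
have := jetD (jetD jphi (jetZ ka (jp z1))) (jetZ C (jp z2)).
set psi := (X in jet X _ _); set s1 := (X in jet _ X _); set s2 := (X in jet _ _ X).
move=> jpsi; exists psi, s1, s2, z2; split=> //.
- by case/andP: z2T => -> _.
- split; first by rewrite /Q0/=; case/andP: z2T => -> _ /=; exact: lt_le_trans z2T' T1.
  move=> w; rewrite /Q0 /= => /andP[w0 w1] wz2.
  have -> : u z2 - psi z2 = D1 z2.
    by rewrite /psi /D1 /D pen_self mulr0 addr0 opprD addrA.
  have -> : u w - psi w = D1 w - C * pen z2 w by rewrite /psi /D1 /D !opprD !addrA.
  have [wT|wT] := lerP w.1 T.
    apply: (@lt_le_trans _ _ (D1 w)); last by apply: D1max; rewrite w0 wT.
    by rewrite ltrBlDr ltrDl mulr_gt0// pen_gt0.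
  apply: lt_trans D1z2; rewrite subr_lt0.
  apply: (@le_lt_trans _ _ (M + Mp)).
    have : Q w by rewrite /Q/= w0 ltW.
    move/DM; apply: le_trans; rewrite /D1 lerBlDr lerDl mulr_ge0 ?pen_ge0//.
    exact: ltW.
  apply: (@lt_le_trans _ _ (C * th)).
    by rewrite divfK ?gt_eqF// (le_lt_trans (ler_norm _))// ltrDl.
  apply: ler_wpM2l; first exact: ltW.
  apply: le_trans (pen_ge z2 w None).
  by apply: theta_le; rewrite ?subr_ge0 ?lerD2r ltW.
- move=> k; rewrite /s1 r10 mulr0 addr0 addrC addKr normrM gtr0_norm//.
  by apply: le_trans kaB; rewrite ler_wpM2l// ltW.
- move=> k l; rewrite /s2 r20 mulr0 addr0 addrC addKr normrM gtr0_norm//.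
  by apply: le_trans kaB; rewrite ler_wpM2l// ltW.
Qed.

End Touch.

(** * Comparison over one time step *)

Section Tau.
Context {R : realType}.

(** Equal to [4 * r / (4 + r ^ 2)]: a bounded smooth substitute for [r] on the unit
    interval, needed since test functions are bounded together with their derivatives. *)
Definition tau (r : R) : R := 4 * agn 4 r.
Definition tau1 (r : R) : R := 4 * (- wit 4 r + 2 * 4 * wit 4 r ^+ 2).

Lemma tau_facts (r : R) : 0 <= r <= 1 ->
  [/\ 0 <= tau r, tau r <= r, r - tau r <= r ^+ 2 &
      [/\ 4^-1 <= tau1 r, tau1 r <= 1 & 1 - tau1 r <= tau r]].
Proof.
move=> /andP[r0 r1]; rewrite /tau /tau1 /agn -/(wit 4 r).
have c1 : 1 <= 4 :> R by lra.
have w0 := wit_gt0 c1 r.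
have wE : 4 * wit 4 r + r ^+ 2 * wit 4 r = 1.
  by rewrite -mulrDl divff// gt_eqF// -invr_gt0.
move: (wit 4 r) w0 wE => w w0 wE.
have w1 : 1 - 4 * w = r ^+ 2 * w by move: wE; move: (_ * w) => v; lra.
have rr : 0 <= r ^+ 2 <= 1 by rewrite sqr_ge0 expr_le1.
have rr2 : r ^+ 2 <= r by rewrite expr2 ler_piMl.
have w4 : w <= 4^-1 by move: rr wE => /andP[]; move: (r ^+ 2) => u; nra.
have w5 : 5^-1 <= w by move: rr wE => /andP[]; move: (r ^+ 2) => u; nra.
have rw : r ^+ 2 * w <= r * w by rewrite ler_wpM2r// ltW.
split; [|by nra| |split].
- by rewrite mulr_ge0// mulr_ge0// ltW.
- have -> : r - 4 * (r * w) = r * (1 - 4 * w) by ring.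
  by rewrite w1; nra.
- nra.
- nra.
- rewrite (_ : 1 - 4 * (- w + 2 * 4 * w ^+ 2) = (1 - 4 * w) * (1 + 8 * w)); last by ring.
  by rewrite w1; nra.
Qed.

Lemma tau_jet (T : R) : exists t2,
  jet1 (fun s => tau (T - s)) (fun s => - tau1 (T - s)) t2.
Proof.
have c1 : 1 <= 4 :> R by lra.
have J := jet1_affine T (-1) (jet1M (jet1_cst 4) (jet1_agn c1)).
eexists; move: J; congr jet1; apply/funext => s; rewrite /tau /tau1 mulN1r//.
by rewrite mul0r add0r mulN1r.
Qed.

End Tau.

Section OneStep.
Context {R : realType} {d : nat}.
Notation QT := (R * 'cV[R]_d)%type.

Definition hess (g : 'cV[R]_d -> R) (x : 'cV[R]_d) : 'M[R]_d :=
  \matrix_(i, j) 'D_(ev j) ('D_(ev i) g) x.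

Lemma hessE g x i j : hess g x i j = 'D_(ev j) ('D_(ev i) g) x.
Proof. by rewrite /hess mxE. Qed.

(** All that the one-step estimate requires of the nonlinearity, which makes it apply both to
    [G] and to the generator of a single control. *)
Definition lip_op (F : 'M[R]_d -> R) (c : R) := forall (S S' : 'M[R]_d) (k : R),
  (forall i j, `|S i j - S' i j| <= k) -> F S <= F S' + c * k.

(** The test function is [g] corrected linearly in time by a multiple of [g1], the
    bounded function [tau] playing the role of the time to go; the quadratic
    correction absorbs all errors caused by the variation of [g1]. *)
Lemma one_step (F : 'M[R]_d -> R) (c : R) (u : QT -> R) (M : R)
    (g g1 : 'cV[R]_d -> R) (K0 K e t T : R) :
  lip_op F c -> 0 <= c ->
  {within Q, continuous u} -> (forall z, Q z -> `|u z| <= M) ->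
  (forall phi z, C2b phi -> strict_max_on Q0 (fun w => u w - phi w) z ->
     - time_derivative phi z - F (hessian phi z) <= 0) ->
  0 <= t <= T -> T <= 1 -> 0 <= e ->
  sm 2 K0 g -> sm 2 K g1 ->
  (forall x, u (T, x) <= g x) ->
  (forall x, F (hess g x) <= g1 x + e) ->
  forall x, u (t, x) <= g x + (T - t) * (g1 x + e) + (5 + 4 * c) * (K + e) * (T - t) ^+ 2.
Proof.
move=> Fl c0 cu uM Fsub /andP[t0 tT] T1 e0 gK g1K ug Fg x.
apply/ler_addgt0Pr => h h0.
pose eta := h / 6; have eta0 : 0 < eta by rewrite divr_gt0.
have K_ge0 : 0 <= K := cb_ge0 (sm_cb g1K).
(* Twice [C * tau * tau1] must absorb the defect [(1 - tau1) * (K + e + eta)] of the linear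
   correction and the variation [c * tau * K] of the nonlinearity, and [tau1 >= 1 / 4]. *)
pose C := 4 * (K + e + eta) + 4 * c * K.
have [t2 J] := tau_jet T.
have Jt := @jet_coord R d _ _ _ None J.
have := jetD (jetD (jet_space gK) (jetM Jt (jet_space g1K)))
             (jetD (jetZ (e + eta) Jt) (jetZ C (jetM Jt Jt))).
set phi := (X in jet X _ _); set p1 := (X in jet _ X _); set p2 := (X in jet _ _ X).
move=> Jphi.
have phiE (z : QT) : phi z = g z.2 + tau (T - z.1) * g1 z.2 +
    ((e + eta) * tau (T - z.1) + C * (tau (T - z.1) * tau (T - z.1))) by [].
have p1E (z : QT) : p1 None z = - tau1 (T - z.1) * g1 z.2 - (e + eta) * tau1 (T - z.1)
      - C * (2 * (tau (T - z.1) * tau1 (T - z.1))).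
  by rewrite /p1 /=; ring.
have p2E (z : QT) i j : p2 (Some i) (Some j) z =
    hess g z.2 i j + tau (T - z.1) * hess g1 z.2 i j.
  transitivity ('D_(ev j) ('D_(ev i) g) z.2 + tau (T - z.1) * 'D_(ev j) ('D_(ev i) g1) z.2).
    rewrite /p2 /=.
    move: ('D_(ev j) ('D_(ev i) g) z.2) ('D_(ev j) ('D_(ev i) g1) z.2)
      ('D_(ev j) g1 z.2) ('D_(ev i) g1 z.2) => *; ring.
  by congr (_ + _ * _); rewrite hessE.
clearbody phi p1 p2.
have C0 : 0 <= C.
  by rewrite /C addr_ge0// mulr_ge0// ?mulr_ge0// !addr_ge0// ltW.
have tau0 : tau (0 : R) = 0 by rewrite /tau /agn mul0r mulr0.
have key : u (t, x) <= phi (t, x).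
  rewrite leNgt; apply/negP => phiu.
  pose ka := eta / (2 * (1 + c)).
  have c1 : 0 < 2 * (1 + c) by rewrite mulr_gt0// ltr_pwDl.
  have ka0 : 0 < ka by rewrite divr_gt0.
  have [||psi [q1 [q2 [z [Jpsi zT zmax q1E q2E]]]]] :=
    touch_above T1 cu uM Jphi _ _ phiu ka0.
  - by move=> y; rewrite phiE /= subrr tau0 !mul0r !mulr0 !addr0; exact: ug.
  - by rewrite /= t0.
  have [Cpsi tpsi hpsi] := jetE Jpsi.
  have := Fsub psi z Cpsi zmax; rewrite tpsi leNgt => /negP; apply.
  have r01 : 0 <= T - z.1 <= 1.
    by case/andP: zT => a b; rewrite subr_ge0 (ltW b)/= lerBlDr (le_trans T1)// lerDl.
  have [ta0 tar _ [t1l t1u t1t]] := tau_facts r01.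
  have F1 : F (hessian psi z) <= F (hess g z.2) + c * (tau (T - z.1) * K + ka).
    apply: (Fl (hessian psi z) (hess g z.2) (tau (T - z.1) * K + ka)) => i j.
    have := q2E (Some i) (Some j); rewrite p2E -hpsi => H1.
    rewrite -[_ - _](subrK (tau (T - z.1) * hess g1 z.2 i j)).
    rewrite [X in _ <= X]addrC -[X in `|X + _|]addrA -opprD.
    apply: le_trans (ler_normD _ _) _; apply: lerD => //.
    rewrite hessE.
    rewrite normrM ger0_norm// ler_wpM2l//.
    exact: (sm_cb (sm_D j (sm_D i g1K))).2.
  have := q1E None; rewrite p1E ler_norml => /andP[_ q1u].
  have gb : g1 z.2 <= K := le_trans (ler_norm _) ((sm_cb g1K).2 z.2).
  have Fgz := Fg z.2.
  rewrite subr_gt0; apply: le_lt_trans F1 _.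
  have kaE : ka * (1 + c) = eta / 2 by rewrite /ka; field; rewrite gt_eqF// ltr_pwDl.
  apply: (@le_lt_trans _ _ (g1 z.2 + e + c * tau (T - z.1) * K + c * ka)).
    by rewrite mulrDr mulrA addrA !lerD2r.
  rewrite ltrNr; apply: le_lt_trans (_ : _ <= p1 None z + ka) _; first by rewrite p1E; lra.
  rewrite p1E.
  move: (tau (T - z.1)) (tau1 (T - z.1)) (g1 z.2) (F _) ta0 t1l t1u t1t gb Fgz
    => ta ta1 G1 FF ta0 t1l t1u t1t gb Fgz.
  have h1 : 0 <= (1 - ta1) * (K + e + eta - (G1 + e + eta)).
    by rewrite mulr_ge0// subr_ge0// !lerD2r.
  have h2 : (1 - ta1) * (K + e + eta) <= ta * (K + e + eta).
    by rewrite ler_wpM2r// !addr_ge0// ltW.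
  have h3 : C * (2 * (ta * 4^-1)) <= C * (2 * (ta * ta1)).
    by rewrite !ler_wpM2l.
  have h4 : C * (2 * (ta * 4^-1)) = 2 * (ta * (K + e + eta)) + 2 * (c * ta * K).
    by rewrite /C; field.
  have h5 : 0 <= ta * (K + e + eta) by rewrite mulr_ge0// !addr_ge0// ltW.
  have h6 : 0 <= c * ta * K by rewrite !mulr_ge0.
  rewrite -ltrNr; lra.
apply: le_trans key _; rewrite phiE /=.
have r01 : 0 <= T - t <= 1.
  by rewrite subr_ge0 tT/= lerBlDr (le_trans T1)// lerDl.
have [ta0 tar tar2 _] := tau_facts r01.
case/andP: r01; move: (T - t) ta0 tar tar2 => r; move: (tau r) => ta ta0 tar tar2 r0 r1.
have gb : `|g1 x| <= K := (sm_cb g1K).2 x.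
have h1 : ta * (g1 x + e + eta) <= r * (g1 x + e + eta) + r ^+ 2 * (K + e + eta).
  rewrite -lerBlDl -mulrBl; apply: le_trans (ler_norm _) _; rewrite normrM.
  apply: ler_pM => //; first by rewrite distrC ger0_norm// subr_ge0.
  by move: gb; rewrite !ler_norml => /andP[? ?]; apply/andP; split; lra.
have h2 : C * (ta * ta) <= C * r ^+ 2 by rewrite ler_wpM2l// expr2 ler_pM.
have r2 : r ^+ 2 <= r by rewrite expr2 ler_piMl.
have h3 : r ^+ 2 * (c * e) >= 0 by rewrite !mulr_ge0// sqr_ge0.
have h4 : eta * r ^+ 2 <= eta by rewrite ler_piMr// ?(le_trans r2 r1)// ltW.
have h5 : eta * r <= eta by rewrite ler_piMr// ltW.
have hE : h = 6 * eta by rewrite /eta; field.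
rewrite hE.
have -> : g x + ta * g1 x + ((e + eta) * ta + C * (ta * ta)) =
  g x + ta * (g1 x + e + eta) + C * (ta * ta) by ring.
apply: le_trans (lerD (lerD (lexx (g x)) h1) h2) _.
have -> : g x + (r * (g1 x + e + eta) + r ^+ 2 * (K + e + eta)) + C * r ^+ 2 =
  g x + r * (g1 x + e) + (5 + 4 * c) * (K + e) * r ^+ 2 +
  (eta * r + 5 * (eta * r ^+ 2) - 4 * (r ^+ 2 * (c * e))) by rewrite /C; ring.
rewrite lerD2l; lra.
Qed.

End OneStep.

Section SmN.
Context {R : realType} {d : nat}.
Implicit Types (g : 'cV[R]_d -> R).

Lemma deriveN_fun g i : (forall x, derivable g x (ev i)) ->
  'D_(ev i) (fun x => - g x) = (fun x => - 'D_(ev i) g x).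
Proof. by move=> dg; apply/funext => x; exact: deriveN. Qed.

Lemma smN n K g : sm n K g -> sm n K (fun x => - g x).
Proof.
elim: n g => [|n IH] g gK; split; try exact: cbN (sm_cb gK); first by [].
move=> i; have dg x : derivable g x (ev i) by exact: sm_derivable gK.
rewrite deriveN_fun//; split; last by apply: IH; exact: sm_D gK.
by move=> x; apply: derivableN.
Qed.

Lemma hessN K g x : sm 2 K g -> hess (fun x => - g x) x = - hess g x.
Proof.
move=> gK; apply/matrixP => i j; rewrite hessE [RHS]mxE hessE.
rewrite deriveN_fun; last by move=> y; exact: sm_derivable gK.
have dg y : derivable ('D_(ev i) g) y (ev j) by exact: sm_derivable (sm_D i gK).
exact: (congr1 (fun F => F x) (deriveN_fun dg)).
Qed.

End SmN.

Section Generators.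
Context {R : realType} {d : nat}.
Implicit Types (A S : 'M[R]_d).

(** The generator of the diffusion with matrix [A], as a function of the Hessian. *)
Definition gen A S : R := 2^-1 * \tr (A *m A^T *m S).

Lemma entry_le_norm A i j : `|A i j| <= `|A|.
Proof.
rewrite [leRHS]/Num.norm /= mx_normrE.
by apply/bigmax_geP; right; exists (i, j).
Qed.

Lemma compact_entries (Lambda : set 'M[R]_d) : compact Lambda ->
  exists a, 0 <= a /\ forall A, Lambda A -> forall i j, `|A i j| <= a.
Proof.
move=> /compact_bounded[M [_ hM]]; exists (`|M| + 1); split; first by rewrite addr_ge0.
move=> A LA i j; apply: le_trans (entry_le_norm A i j) _; apply: hM => //.
by rewrite (le_lt_trans (ler_norm _))// ltrDl.
Qed.

Definition gen_bound (a : R) : R := d%:R ^+ 3 * a ^+ 2.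

Lemma gen_bound_ge0 a : 0 <= gen_bound a.
Proof. by rewrite mulr_ge0 ?sqr_ge0 ?exprn_ge0. Qed.

Lemma sum_norm_le (F : 'I_d -> R) c : (forall i, `|F i| <= c) -> `|\sum_i F i| <= d%:R * c.
Proof.
move=> Fc; apply: le_trans (ler_norm_sum _ _ _) _.
apply: le_trans (ler_sum _ (fun i _ => Fc i)) _.
by rewrite sumr_const card_ord mulr_natl.
Qed.

Lemma trace_bound a k A S : (forall i j, `|A i j| <= a) -> (forall i j, `|S i j| <= k) ->
  `|\tr (A *m A^T *m S)| <= gen_bound a * k.
Proof.
move=> Aa Sk.
have -> : gen_bound a * k = d%:R * (d%:R * (d%:R * (a * a) * k)) by rewrite /gen_bound; ring.
apply: sum_norm_le => i; rewrite mxE; apply: sum_norm_le => j.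
rewrite normrM ler_pM//; rewrite mxE; apply: sum_norm_le => l.
by rewrite mxE normrM ler_pM.
Qed.

Lemma genB A S S' : gen A S - gen A S' = gen A (S - S').
Proof. by rewrite /gen -mulrBr mulmxBr raddfB. Qed.

Lemma genN A S : gen A (- S) = - gen A S.
Proof. by rewrite /gen mulmxN raddfN mulrN. Qed.

Lemma gen_norm a k A S : (forall i j, `|A i j| <= a) -> (forall i j, `|S i j| <= k) ->
  `|gen A S| <= gen_bound a * k.
Proof.
move=> Aa Sk; have tb := trace_bound Aa Sk; apply: le_trans tb.
by rewrite /gen normrM ger0_norm ?invr_ge0// ler_piMl// invf_le1// ler1n.
Qed.

Lemma gen_lip a A : (forall i j, `|A i j| <= a) -> lip_op (gen A) (gen_bound a).
Proof.
move=> Aa S S' k SS'; rewrite -lerBlDl genB; apply: le_trans (ler_norm _) _.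
by apply: gen_norm => // i j; rewrite !mxE.
Qed.

Section G.
Variables (Lambda : set 'M[R]_d) (a : R).
Hypothesis Lambda0 : Lambda !=set0.
Hypothesis Lambda_a : forall A, Lambda A -> forall i j, `|A i j| <= a.

Let entry_bound S : exists k, forall i j, `|S i j| <= k.
Proof. by exists `|S| => i j; exact: entry_le_norm. Qed.

Let has_supG S : has_sup [set \tr (A *m A^T *m S) | A in Lambda].
Proof.
have [k Sk] := entry_bound S; split.
  by have [A LA] := Lambda0; exists (\tr (A *m A^T *m S)), A.
exists (gen_bound a * k) => _ [A LA <-].
by apply: le_trans (ler_norm _) _; apply: trace_bound => //; exact: Lambda_a.
Qed.

Lemma gen_le_G A S : Lambda A -> gen A S <= G Lambda S.
Proof.
move=> LA; rewrite ler_wpM2l ?invr_ge0//; apply: sup_upper_bound => //.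
by exists A.
Qed.

Lemma G_le S c : (forall A, Lambda A -> gen A S <= c) -> G Lambda S <= c.
Proof.
move=> h; rewrite /G mulrC ler_pdivrMr//; apply: sup_le_ub; first by case: (has_supG S).
move=> _ [A LA <-]; have := h A LA; rewrite /gen mulrC ler_pdivrMr//.
Qed.

Lemma G_lip : lip_op (G Lambda) (gen_bound a).
Proof.
move=> S S' k SS'; apply: G_le => A LA.
apply: le_trans (gen_lip (Lambda_a LA) SS') _.
by rewrite lerD2r; exact: gen_le_G.
Qed.

End G.
End Generators.

Section Steps.
Context {R : realType} {d : nat}.
Variables (Lambda : set 'M[R]_d) (a : R).
Hypothesis Lambda0 : Lambda !=set0.
Hypothesis Lambda_a : forall A, Lambda A -> forall i j, `|A i j| <= a.
Variables (f : 'cV[R]_d -> R) (v : R * 'cV[R]_d -> R).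
Hypothesis hv : viscosity_solution Lambda f v.

Definition step_const : R := 5 + 4 * @gen_bound R d a.

Lemma visc_bound : exists M, forall z, Q z -> `|v z| <= M.
Proof.
have [[M [_ vM]] _ _ _] := hv.
exists (`|M| + 1) => z Qz; apply: vM => //.
by rewrite (le_lt_trans (ler_norm _))// ltrDl.
Qed.

Lemma slice_cb M t : (forall z, Q z -> `|v z| <= M) -> 0 <= t <= 1 ->
  cb (fun x => v (t, x)) M.
Proof.
move=> vM t01; have [_ cv _ _] := hv; split=> [|x]; last exact: vM.
have /subspace_continuousP cQ := cv.
have H (W : normedModType R) (w : R * W -> R) (D : set (R * W)) :
    (forall z, D z -> w @ within D (nbhs z) --> w z) -> (forall x, D (t, x)) ->
    continuous (fun x => w (t, x)).
  move=> cw Dt x B /(cw _ (Dt x)) /= hB.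
  have cp : continuous (fun y : W => (t, y) : R * W).
    apply: (@lipschitz_continuous _ _ _ _ 1) => y z; rewrite mul1r.
    by rewrite prod_normE /= subrr normr0 ge_max normr_ge0 lexx.
  have := cp x _ hB; rewrite !nbhs_simpl /=.
  by apply: filterS => y /(_ (Dt y)).
exact: (H 'cV[R]_d v Q).
Qed.

(** The function [g1] stands for a smooth upper bound of [G (D^2 g)], which need not be
    smooth itself. *)
Lemma subsolution_step (g g1 : 'cV[R]_d -> R) (K0 K e t T : R) :
  0 <= t <= T -> T <= 1 -> 0 <= e -> sm 2 K0 g -> sm 2 K g1 ->
  (forall x, v (T, x) <= g x) ->
  (forall x, G Lambda (hess g x) <= g1 x + e) ->
  forall x, v (t, x) <= g x + (T - t) * (g1 x + e) + step_const * (K + e) * (T - t) ^+ 2.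
Proof.
move=> tT T1 e0 gK g1K vg Gg; have [M vM] := visc_bound.
have [_ cv [_ _ _ sub] _] := hv.
exact: (one_step (G_lip Lambda0 Lambda_a) (gen_bound_ge0 a) cv vM sub tT T1 e0 gK g1K vg Gg).
Qed.

(** Changing signs turns a supersolution for the supremum into a subsolution for the linear
    generator of any single control, as [G] dominates it. *)
Lemma supersolution_step (A : 'M[R]_d) (g g1 : 'cV[R]_d -> R) (K0 K e t T : R) :
  Lambda A ->
  0 <= t <= T -> T <= 1 -> 0 <= e -> sm 2 K0 g -> sm 2 K g1 ->
  (forall x, g x <= v (T, x)) ->
  (forall x, g1 x <= gen A (hess g x) + e) ->
  forall x, g x + (T - t) * (g1 x - e) - step_const * (K + e) * (T - t) ^+ 2 <= v (t, x).
Proof.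
move=> LA tT T1 e0 gK g1K vg Gg x; have [M vM] := visc_bound.
have [_ cv _ [_ _ _ sup]] := hv.
have cv' : {within Q, continuous (fun z => - v z)} by exact: contN.
have vM' z : Q z -> `|- v z| <= M by move=> /vM; rewrite normrN.
have sup' (phi : R * 'cV[R]_d -> R) z : C2b phi -> strict_max_on Q0 (fun w => - v w - phi w) z ->
    - time_derivative phi z - gen A (hessian phi z) <= 0.
  move=> Cphi [Dz smax].
  have J := jetZ (-1) (C2b_jet Cphi); have [CN tN hN] := jetE J.
  have [_ tE hE] := jetE (C2b_jet Cphi).
  have smin : strict_min_on Q0 (fun w => v w - (-1 * phi w)) z.
    by split=> // w Dw wz; have := smax w Dw wz; rewrite !mulN1r; lra.
  have := sup _ _ CN smin; rewrite tN mulN1r opprK -tE.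
  rewrite (_ : hessian _ z = - hessian phi z); last first.
    by apply/matrixP => i j; rewrite hN [RHS]mxE hE mulN1r.
  have := gen_le_G Lambda0 Lambda_a (- hessian phi z) LA; rewrite genN; lra.
have := one_step (gen_lip (Lambda_a LA)) (gen_bound_ge0 a) cv' vM' sup' tT T1 e0 (smN gK) (smN g1K).
move=> H.
have : - v (t, x) <= - g x + (T - t) * (- g1 x + e) + step_const * (K + e) * (T - t) ^+ 2.
  apply: H => y; first by rewrite lerN2.
  by rewrite (hessN _ gK) genN; have := Gg y; lra.
have -> : (T - t) * (- g1 x + e) = - ((T - t) * (g1 x - e)) by ring.
move: ((T - t) * (g1 x - e)) (step_const * _ * _) => X Y; lra.
Qed.

End Steps.

(** * Independence *)

Lemma mean_product {R : realType} {disp} {Omega : measurableType disp}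
    (P : probability Omega R) (X Y : Omega -> R) (C : R) :
  measurable_fun setT X -> measurable_fun setT Y ->
  P.-integrable setT (EFin \o X) -> (forall w, `|Y w| <= C) ->
  (forall A B : set R, measurable A -> measurable B ->
     P (X @^-1` A `&` Y @^-1` B) = (P (X @^-1` A) * P (Y @^-1` B))%E) ->
  \int[P]_w (X w * Y w) = (\int[P]_w X w) * (\int[P]_w Y w).
Proof.
move=> mX mY iX YC ind.
pose X' : {mfun Omega >-> R} := mfun_Sub (mem_set mX).
pose Y' : {mfun Omega >-> R} := mfun_Sub (mem_set mY).
have mXY : measurable_fun setT (fun w => (X w, Y w)) by exact: measurable_fun_pair.
pose XY : {mfun Omega >-> (R * R)%type} := mfun_Sub (mem_set mXY).
pose mu1 := distribution P X'; pose mu2 := distribution P Y'.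
pose m' := distribution P XY.
have E A : measurable A -> (mu1 \x mu2)%E A = m' A.
  by apply: product_measure_unique => B1 B2 mB1 mB2; exact: ind.
pose F (z : R * R) := (z.1 * z.2)%:E : \bar R.
have mF : measurable_fun setT F.
  apply/measurable_EFinP; apply: measurable_funM; [exact: measurable_fst|exact: measurable_snd].
have iXY : P.-integrable setT (EFin \o (fun w => X w * Y w)).
  apply: (le_integrable measurableT (g := fun w => (C * X w)%:E)).
  - by apply/measurable_EFinP; exact: measurable_funM.
  - move=> w _ /=; rewrite lee_fin !normrM mulrC ler_wpM2r//.
    by apply: le_trans (YC w) (ler_norm _).
  - under eq_fun do rewrite EFinM.
    exact: (integrableZl measurableT C iX).
have iF' : m'.-integrable setT F by exact: (integrable_pushforward mXY mF iXY).
have e2 : (\int[m']_z F z = \int[(mu1 \x mu2)%E]_z F z)%E.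
  by apply: eq_measure_integral => A mA _; exact/esym/E.
have iF : (mu1 \x mu2)%E.-integrable setT F.
  apply/integrableP; split => //; have /integrableP[_] := iF'.
  by rewrite (eq_measure_integral (mu1 \x mu2)%E)// => A mA _; exact/esym/E.
have iY : P.-integrable setT (EFin \o Y) by exact: bounded_integrable mY YC.
have e1 : (\int[P]_w (X w * Y w)%:E = \int[m']_z F z)%E.
  by apply/esym; exact: (integral_pushforward mXY mF iXY measurableT).
have mid : measurable_fun setT (EFin : R -> \bar R) by apply/measurable_EFinP.
have eX : (\int[mu1]_x x%:E = \int[P]_w (X w)%:E)%E.
  exact: (integral_pushforward mX mid iX measurableT).
have eY : (\int[mu2]_x x%:E = \int[P]_w (Y w)%:E)%E.
  exact: (integral_pushforward mY mid iY measurableT).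
have imu1 : mu1.-integrable setT (EFin : R -> \bar R) by exact: (integrable_pushforward mX mid iX measurableT).
have imu2 : mu2.-integrable setT (EFin : R -> \bar R) by exact: (integrable_pushforward mY mid iY measurableT).
have fY : (\int[P]_w (Y w)%:E)%E \is a fin_num by exact: integrable_fin_num iY.
have fX : (\int[P]_w (X w)%:E)%E \is a fin_num by exact: integrable_fin_num iX.
have e3 := integral12_prod_meas1 iF.
have e4 : (\int[P]_w (X w * Y w)%:E = (\int[P]_w (Y w)%:E) * \int[P]_w (X w)%:E)%E.
  rewrite e1 e2 -e3 -eX -(fineK fY) -(integralZl measurableT)//.
  apply: eq_integral => x _; rewrite fineK// -eY muleC -(integralZl measurableT)//.
by rewrite /Rintegral e4 fineM// mulrC.
Qed.

Section Gmeas.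
Context {R : realType} {disp : measure_display} {Omega : measurableType disp}.
Implicit Types (G : set (set Omega)) (Y : Omega -> R).

(** Phrased as measurability on the generated space, so that the closure properties of
    measurable functions apply. *)
Definition gmeas G Y := @measurable_fun _ _ (g_sigma_algebraType G) R setT Y.

Definition gcmeas {d : nat} G (Z : Omega -> 'cV[R]_d) := @cmeas R d _ (g_sigma_algebraType G) Z.

Lemma gcmeas_comp {d : nat} G (Z : Omega -> 'cV[R]_d) (h : 'cV[R]_d -> R) :
  continuous h -> gcmeas G Z -> gmeas G (fun w => h (Z w)).
Proof. by move=> ch mZ; exact: (@cmeas_comp R d _ (g_sigma_algebraType G) h Z ch mZ). Qed.

Lemma gmeas_preimage G Y (B : set R) : sigma_algebra setT G -> gmeas G Y ->
  measurable B -> G (Y @^-1` B).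
Proof.
move=> sG mY mB; have := mY measurableT B mB; rewrite setTI.
by rewrite /measurable /= sigma_algebra_id.
Qed.

Lemma gmeas_sub G G' Y : G `<=` G' -> gmeas G Y -> gmeas G' Y.
Proof.
move=> GG' mY _ B mB; have := mY measurableT B mB.
exact: sub_smallest2r.
Qed.

Lemma gmeas_measurable G Y : G `<=` measurable -> gmeas G Y -> measurable_fun setT Y.
Proof.
move=> Gm mY _ B mB; have := mY measurableT B mB; rewrite /measurable /=.
by apply: smallest_sub => //; exact: sigma_algebra_measurable.
Qed.

Lemma gmeas_preimageP G Y : (forall B, measurable B -> G (Y @^-1` B)) -> gmeas G Y.
Proof. by move=> h _ B mB; rewrite setTI; apply: sub_sigma_algebra; exact: h. Qed.

Lemma borel_preimage {T : ptopologicalType} (c : T -> R) (B : set R) :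
  continuous c -> measurable B -> borel (c @^-1` B).
Proof.
move=> cc mB; have mc : @measurable_fun _ _ (g_sigma_algebraType (@open T)) R setT c.
  apply: (measurability _ (RGenOpens.measurableE R)).
  move=> _ [_ [a [b ->] <-]]; rewrite setTI.
  apply: sub_sigma_algebra; apply: open_comp; last exact: itv_open.
  by move=> x _; exact: cc.
by have := mc measurableT B mB; rewrite setTI.
Qed.

Lemma wrt_gmeas {T : ptopologicalType} G (X : Omega -> T) (c : T -> R) :
  measurable_wrt G X -> continuous c -> gmeas G (fun w => c (X w)).
Proof.
move=> mX cc; apply: gmeas_preimageP => B mB.
exact: (mX _ (borel_preimage cc mB)).
Qed.

Lemma indep_mean {T : ptopologicalType} (P : probability Omega R) G (X : Omega -> T)
    (c : T -> R) (Y : Omega -> R) (C : R) :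
  sigma_algebra setT G -> G `<=` measurable -> independent_of P G X ->
  continuous c -> P.-integrable setT (EFin \o (fun w => c (X w))) ->
  gmeas G Y -> (forall w, `|Y w| <= C) ->
  \int[P]_w (c (X w) * Y w) = (\int[P]_w c (X w)) * (\int[P]_w Y w).
Proof.
move=> sG Gm ind cc iX mY YC.
apply: mean_product YC _ => //.
- by apply/measurable_EFinP; have /integrableP[] := iX.
- exact: gmeas_measurable mY.
- move=> A B mA mB; apply: (ind (c @^-1` A)); first exact: borel_preimage.
  exact: gmeas_preimage.
Qed.

End Gmeas.

(** * Mean Taylor expansions *)

Section Algebra.
Context {R : realType} {d : nat}.
Implicit Types (g : 'cV[R]_d -> R) (x y : 'cV[R]_d) (A : 'M[R]_d) (s : R).

Lemma norm_mulmx_le a A y : (forall i j, `|A i j| <= a) -> `|A *m y| <= d%:R * a * `|y|.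
Proof.
move=> Aa; case: (posnP d) => [d0|dp].
  rewrite [A *m y](_ : _ = 0) ?normr0; last first.
    by apply/colP => i; have := ltn_ord i; rewrite [X in (_ < X)%N]d0.
  have -> : (d%:R : R) = 0 by rewrite d0.
  by rewrite !mul0r.
have a0 : 0 <= a by apply: le_trans (Aa (Ordinal dp) (Ordinal dp)).
apply: norm_le_coord => [|i]; first by rewrite !mulr_ge0.
rewrite mxE -mulrA; apply: sum_norm_le => j; rewrite normrM ler_pM//.
exact: coord_le_norm.
Qed.

Lemma grad_dot_lin g x y A s : grad_dot g x (s *: (A *m y)) =
  \sum_k y k 0 * (s * \sum_i A i k * 'D_(ev i) g x).
Proof.
rewrite /grad_dot; under eq_bigr => i _ do rewrite 2!mxE mulr_sumr mulr_suml.
rewrite exchange_big /=; apply: eq_bigr => k _; rewrite !mulr_sumr.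
by apply: eq_bigr => i _; move: ('D_(ev i) g x) => D; ring.
Qed.

Lemma quadratic_form_mulmx (D : 'I_d -> 'I_d -> R) (y : 'I_d -> R) A s :
  \sum_i \sum_j (s * \sum_k A i k * y k) * (s * \sum_k A j k * y k) * D i j =
  \sum_k \sum_l (y k * y l) * (s ^+ 2 * \sum_i \sum_j A i k * A j l * D i j).
Proof.
transitivity (\sum_i \sum_j \sum_k \sum_l (y k * y l) * (s ^+ 2 * (A i k * A j l * D i j))).
  apply: eq_bigr => i _; apply: eq_bigr => j _.
  set p := \sum_(k < d) _; set q := \sum_(k < d) _.
  have -> : s * p * (s * q) * D i j = (s ^+ 2 * D i j) * (p * q) by ring.
  rewrite big_distrlr /= mulr_sumr; apply: eq_bigr => k _.
  by rewrite mulr_sumr; apply: eq_bigr => l _; ring.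
transitivity (\sum_i \sum_k \sum_l \sum_j (y k * y l) * (s ^+ 2 * (A i k * A j l * D i j))).
  apply: eq_bigr => i _; rewrite exchange_big /=; apply: eq_bigr => k _.
  by rewrite exchange_big.
rewrite exchange_big /=; apply: eq_bigr => k _.
rewrite exchange_big /=; apply: eq_bigr => l _.
rewrite !mulr_sumr; apply: eq_bigr => i _; by rewrite !mulr_sumr.
Qed.

Lemma hess_dot_quad g x y A s : hess_dot g x (s *: (A *m y)) =
  \sum_k \sum_l (y k 0 * y l 0) *
    (s ^+ 2 * \sum_i \sum_j A i k * A j l * 'D_(ev j) ('D_(ev i) g) x).
Proof.
rewrite -(quadratic_form_mulmx (fun i j => 'D_(ev j) ('D_(ev i) g) x) (fun k => y k 0)).
apply: eq_bigr => i _; apply: eq_bigr => j _.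
by congr (_ * _ * _); rewrite 2!mxE.
Qed.

Lemma quadratic_form_trace (D : 'I_d -> 'I_d -> R) A :
  \sum_k \sum_i \sum_j A i k * A j k * D i j =
  \sum_i \sum_j (\sum_k A i k * A j k) * D i j.
Proof.
rewrite exchange_big /=; apply: eq_bigr => i _.
rewrite exchange_big /=; apply: eq_bigr => j _.
by rewrite mulr_suml.
Qed.

Lemma trace_quad g x A s : (forall i j, 'D_(ev j) ('D_(ev i) g) = 'D_(ev i) ('D_(ev j) g)) ->
  \sum_k (s ^+ 2 * \sum_i \sum_j A i k * A j k * 'D_(ev j) ('D_(ev i) g) x) =
  2 * (s ^+ 2 * gen A (hess g x)).
Proof.
move=> sym; rewrite -mulr_sumr /gen mulrCA; congr (_ * _).
rewrite mulrA divff ?mul1r//.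
rewrite (quadratic_form_trace (fun i j => 'D_(ev j) ('D_(ev i) g) x)).
apply: eq_bigr => i _; rewrite mxE; apply: eq_bigr => j _.
apply: (f_equal2 *%R); first by rewrite mxE; apply: eq_bigr => k _; rewrite mxE.
by rewrite hessE; exact: (congr1 (fun F => F x) (sym i j)).
Qed.

End Algebra.

Section Mean.
Context {R : realType} {disp : measure_display} {Omega : measurableType disp}.
Variable P : probability Omega R.

Lemma integrable_dom (f g : Omega -> R) : measurable_fun setT f ->
  (forall w, `|f w| <= g w) -> P.-integrable setT (EFin \o g) ->
  P.-integrable setT (EFin \o f).
Proof.
move=> mf fg ig; apply: (le_integrable measurableT _ _ ig); first exact/measurable_EFinP.
by move=> w _ /=; rewrite lee_fin (le_trans (fg w))// ler_norm.
Qed.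

Lemma meanD (f g : Omega -> R) : P.-integrable setT (EFin \o f) ->
  P.-integrable setT (EFin \o g) -> \int[P]_w (f w + g w) = \int[P]_w f w + \int[P]_w g w.
Proof. by move=> *; rewrite RintegralD. Qed.

Lemma meanB (f g : Omega -> R) : P.-integrable setT (EFin \o f) ->
  P.-integrable setT (EFin \o g) -> \int[P]_w (f w - g w) = \int[P]_w f w - \int[P]_w g w.
Proof. by move=> *; rewrite RintegralB. Qed.

Lemma meanZ c (f : Omega -> R) : P.-integrable setT (EFin \o f) ->
  \int[P]_w (c * f w) = c * \int[P]_w f w.
Proof. by move=> *; rewrite RintegralZl. Qed.

Lemma integrable_sum_fun (I : Type) (r : seq I) (F : I -> Omega -> R) :
  (forall i, P.-integrable setT (EFin \o F i)) ->
  P.-integrable setT (EFin \o (fun w => \sum_(i <- r) F i w)).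
Proof.
move=> iF; rewrite (_ : EFin \o _ = (fun w => (\sum_(i <- r) (F i w)%:E)%E)).
  by apply: (integrable_sum measurableT) => i _; exact: iF.
by apply/funext => w /=; rewrite sumEFin.
Qed.

Lemma mean_sum (I : Type) (r : seq I) (F : I -> Omega -> R) :
  (forall i, P.-integrable setT (EFin \o F i)) ->
  \int[P]_w (\sum_(i <- r) F i w) = \sum_(i <- r) \int[P]_w F i w.
Proof.
move=> iF; elim: r => [|i r IH].
  by rewrite big_nil; under eq_Rintegral do rewrite big_nil; exact: mean_cst.
rewrite big_cons -IH; under eq_Rintegral do rewrite big_cons.
by rewrite meanD//; exact: integrable_sum_fun.
Qed.

Lemma mean_norm_dom (f g : Omega -> R) : measurable_fun setT f ->
  (forall w, `|f w| <= g w) -> P.-integrable setT (EFin \o g) ->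
  `|\int[P]_w f w| <= \int[P]_w g w.
Proof.
move=> mf fg ig; have fi := integrable_dom mf fg ig.
apply: le_trans (le_normr_Rintegral measurableT fi) _; apply: mean_le => //.
apply: integrable_dom ig; first exact: measurableT_comp.
by move=> w; rewrite normr_id.
Qed.

End Mean.

(** * One random step *)

Section RandomStep.
Context {R : realType} {d : nat} {disp : measure_display} {Omega : measurableType disp}.
Variable P : probability Omega R.

Definition whitened (xi : Omega -> 'cV[R]_d) :=
  [/\ cmeas xi,
      forall r, P.-integrable setT (EFin \o (fun w => xi w r 0)),
      forall r, \int[P]_w xi w r 0 = 0,
      forall r l, P.-integrable setT (EFin \o (fun w => xi w r 0 * xi w l 0)) &
      forall r l, \int[P]_w (xi w r 0 * xi w l 0) = (r == l)%:R].

Variable xi : Omega -> 'cV[R]_d.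
Hypothesis W : whitened xi.

Lemma norm_sq_le (x : 'cV[R]_d) : `|x| ^+ 2 <= \sum_r x r 0 * x r 0.
Proof.
have S0 : 0 <= \sum_r x r 0 * x r 0 by apply: sumr_ge0 => r _; rewrite -expr2 sqr_ge0.
rewrite -[leRHS]sqr_sqrtr// lerXn2r ?nnegrE ?sqrtr_ge0//.
apply: norm_le_coord => [|i]; first exact: sqrtr_ge0.
rewrite -[leLHS]sqrtr_sqr ler_wsqrtr// (bigD1 i)//= -expr2 lerDl.
by apply: sumr_ge0 => r _; rewrite -expr2 sqr_ge0.
Qed.

Let mnorm : measurable_fun setT (fun w => `|xi w|).
Proof.
by case: W => mxi _ _ _ _; apply: (cmeas_comp _ mxi); exact: norm_continuous.
Qed.

(** A finite second moment is the only integrability at hand. *)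
Lemma whitened_sq_integrable : P.-integrable setT (EFin \o (fun w => `|xi w| ^+ 2)).
Proof.
case: W => _ _ _ i2 _.
apply: (integrable_dom (g := fun w => \sum_r xi w r 0 * xi w r 0)).
- exact: measurable_funX.
- by move=> w; rewrite ger0_norm ?sqr_ge0// norm_sq_le.
- by apply: integrable_sum_fun => r; exact: i2.
Qed.

Lemma whitened_sq_mean : \int[P]_w (`|xi w| ^+ 2) <= d%:R.
Proof.
case: W => _ _ _ i2 m2.
apply: (@le_trans _ _ (\int[P]_w \sum_r xi w r 0 * xi w r 0)).
  apply: mean_le; first exact: whitened_sq_integrable.
    by apply: integrable_sum_fun => r; exact: i2.
  by move=> w; exact: norm_sq_le.
rewrite mean_sum; last by move=> r; exact: i2.
under eq_bigr do rewrite m2 eqxx.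
by rewrite sumr_const card_ord.
Qed.

(** The mean of the Taylor remainder of [taylor_second], up to scaling; it plays the role of
    a third moment, which may be infinite. *)
Definition rho (s : R) : R := \int[P]_w (`|xi w| ^+ 2 * Num.min 1 (s * `|xi w|)).

Lemma rho_measurable s : measurable_fun setT (fun w => `|xi w| ^+ 2 * Num.min 1 (s * `|xi w|)).
Proof.
apply: measurable_funM; first exact: measurable_funX.
by apply: measurable_minr => //; apply: measurable_funM.
Qed.

Lemma min1_le s (w : Omega) : 0 <= s ->
  0 <= `|xi w| ^+ 2 * Num.min 1 (s * `|xi w|) <= `|xi w| ^+ 2.
Proof.
move=> s0; rewrite mulr_ge0 ?sqr_ge0//=; last by rewrite le_min ler01 mulr_ge0.
by rewrite ler_piMr ?sqr_ge0// ge_min lexx.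
Qed.

Lemma rho_integrable s : 0 <= s ->
  P.-integrable setT (EFin \o (fun w => `|xi w| ^+ 2 * Num.min 1 (s * `|xi w|))).
Proof.
move=> s0; apply: integrable_dom whitened_sq_integrable; first exact: rho_measurable.
by move=> w; have /andP[h1 h2] := min1_le w s0; rewrite ger0_norm.
Qed.

Lemma rho_le s s' : 0 <= s -> s <= s' -> rho s <= rho s'.
Proof.
move=> s0 ss'; apply: mean_le; [exact: rho_integrable|apply: rho_integrable; exact: le_trans ss'|].
move=> w; rewrite ler_wpM2l ?sqr_ge0// le_min ge_min lexx/= ge_min.
by rewrite ler_wpM2r ?orbT.
Qed.

Lemma rho_small e : 0 < e -> exists s, 0 < s /\ rho s <= e.
Proof.
move=> e0; have cv : rho n.+1%:R^-1 @[n --> \oo] --> rho 0.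
  apply: (@mean_cvg _ _ _ _ _ _ (fun w => `|xi w| ^+ 2)).
  - by move=> n; exact: rho_measurable.
  - exact: rho_measurable.
  - exact: whitened_sq_integrable.
  - move=> n w; have /andP[h1 h2] : 0 <= `|xi w| ^+ 2 * Num.min 1 (n.+1%:R^-1 * `|xi w|) <= `|xi w| ^+ 2.
      by apply: min1_le; rewrite invr_ge0.
    by rewrite ger0_norm.
  - move=> w; apply: cvgM; first exact: cvg_cst.
    apply: (@continuous_cvg _ _ _ _ _ _ (fun x : R => Num.min 1 x)).
      by apply: continuous_min; [exact: cst_continuous|exact: cvg_id].
    by apply: cvgM; [exact: cvg_harmonic|exact: cvg_cst].
have r0 : rho 0 = 0.
  rewrite /rho -[RHS](mean_cst P); apply: eq_Rintegral => w _.
  by rewrite mul0r min_r// mulr0.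
rewrite r0 in cv.
have /cvgrPdist_le/(_ e e0)[N _ /(_ N (leqnn N))] := cv.
rewrite sub0r normrN => h; exists N.+1%:R^-1; split; first by rewrite invr_gt0.
exact: le_trans (ler_norm _) h.
Qed.

Variables (F : set (set Omega)).
Hypotheses (sF : sigma_algebra setT F) (Fm : F `<=` measurable).
Hypothesis ind : independent_of P F xi.

Variables (a : R).
Hypothesis a0 : 0 <= a.
Notation c0 := (d%:R * a).

Lemma c0_ge0 : 0 <= c0. Proof. exact: mulr_ge0. Qed.

Section Increment.
Variables (Z : Omega -> 'cV[R]_d) (A : Omega -> 'M[R]_d) (eta : R).
Hypotheses (mZ : gcmeas F Z) (mA : forall i j, gmeas F (fun w => A w i j)).
Hypothesis Aa : forall w i j, `|A w i j| <= a.
Hypothesis eta0 : 0 <= eta.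

Definition incr (w : Omega) : 'cV[R]_d := Num.sqrt eta *: (A w *m xi w).

Lemma incr_norm w : `|incr w| <= Num.sqrt eta * c0 * `|xi w|.
Proof.
rewrite normrZ ger0_norm ?sqrtr_ge0// -mulrA ler_wpM2l ?sqrtr_ge0//.
exact: norm_mulmx_le.
Qed.

Lemma incr_sq w : `|incr w| ^+ 2 <= eta * c0 ^+ 2 * `|xi w| ^+ 2.
Proof.
rewrite -[X in X * c0 ^+ 2](sqr_sqrtr eta0) -!exprMn lerXn2r ?nnegrE ?incr_norm//.
by rewrite !mulr_ge0 ?sqrtr_ge0.
Qed.

Lemma cmeas_incr : cmeas incr.
Proof.
case: W => mxi _ _ _ _; apply: cmeasZ; apply: cmeasM => // i j.
exact: gmeas_measurable (mA i j).
Qed.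

Lemma cmeas_Z : cmeas Z.
Proof. by move=> i; exact: gmeas_measurable (mZ i). Qed.

(** The linear term has mean zero because the coefficient is independent of [xi]. *)
Lemma grad_term K g : sm 2 K g ->
  P.-integrable setT (EFin \o (fun w => grad_dot g (Z w) (incr w))) /\
  \int[P]_w grad_dot g (Z w) (incr w) = 0.
Proof.
move=> gK; case: (W) => mxi i1 m1 i2 m2.
pose Y k w := Num.sqrt eta * \sum_i A w i k * 'D_(ev i) g (Z w).
have mY k : gmeas F (Y k).
  apply: measurable_funM => //; apply: measurable_sum => i.
  apply: measurable_funM; first exact: mA.
  exact: gcmeas_comp (sm_cb (sm_D i gK)).1 mZ.
have YC k : exists C, forall w, `|Y k w| <= C.
  exists (Num.sqrt eta * (d%:R * (a * K))) => w; rewrite normrM ger0_norm ?sqrtr_ge0//.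
  rewrite ler_wpM2l ?sqrtr_ge0//; apply: sum_norm_le => i; rewrite normrM ler_pM//.
  exact: (sm_cb (sm_D i gK)).2.
have ik k : P.-integrable setT (EFin \o (fun w => xi w k 0 * Y k w)).
  have [C YkC] := YC k.
  apply: (integrable_dom (g := fun w => C * `|xi w k 0|)).
  - apply: measurable_funM; first exact: mxi.
    exact: gmeas_measurable (mY k).
  - by move=> w; rewrite normrM mulrC ler_wpM2r.
  - have : P.-integrable setT (fun w => (C%:E * `|(xi w k 0)%:E|)%E).
      by apply: integrableZl => //; apply: integrable_abse; exact: i1.
    by [].
have -> : (fun w => grad_dot g (Z w) (incr w)) = (fun w => \sum_k xi w k 0 * Y k w).
  by apply/funext => w; exact: grad_dot_lin.
split; first exact: (integrable_sum_fun _ ik).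
rewrite mean_sum// big1// => k _.
have [C YkC] := YC k.
by rewrite (@indep_mean _ _ _ _ P F xi (fun x => x k 0) (Y k) C sF Fm ind
  (@coord_continuous _ _ _ k 0) (i1 k) (mY k) YkC) m1 mul0r.
Qed.

Lemma gen_hess_gmeas K g : sm 2 K g -> gmeas F (fun w => gen (A w) (hess g (Z w))).
Proof.
move=> gK.
have -> : (fun w => gen (A w) (hess g (Z w))) = (fun w => 2^-1 *
    \sum_i \sum_j (\sum_k A w i k * A w j k) * 'D_(ev i) ('D_(ev j) g) (Z w)).
  apply/funext => w; rewrite /gen /mxtrace; congr (_ * _); apply: eq_bigr => i _.
  rewrite mxE; apply: eq_bigr => j _.
  apply: (f_equal2 *%R); last by rewrite hessE.
  by rewrite mxE; apply: eq_bigr => k _; rewrite mxE.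
apply: measurable_funM => //; apply: measurable_sum => i; apply: measurable_sum => j.
apply: measurable_funM; last exact: gcmeas_comp (sm_cb (sm_D i (sm_D j gK))).1 mZ.
by apply: measurable_sum => k; apply: measurable_funM; exact: mA.
Qed.

Lemma gen_hess_norm K g w : sm 2 K g -> `|gen (A w) (hess g (Z w))| <= @gen_bound R d a * K.
Proof.
move=> gK; apply: gen_norm; first exact: Aa.
by move=> i j; rewrite hessE; exact: (sm_cb (sm_D j (sm_D i gK))).2.
Qed.

(** The covariance of [xi] is the identity, so that the mean of the quadratic term is a
    trace. *)
Lemma hess_term K g : sm 2 K g ->
  (forall i j, 'D_(ev j) ('D_(ev i) g) = 'D_(ev i) ('D_(ev j) g)) ->
  P.-integrable setT (EFin \o (fun w => hess_dot g (Z w) (incr w))) /\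
  \int[P]_w hess_dot g (Z w) (incr w) = 2 * (eta * \int[P]_w gen (A w) (hess g (Z w))).
Proof.
move=> gK sym; case: (W) => mxi i1 m1 i2 m2.
pose D i j w := 'D_(ev j) ('D_(ev i) g) (Z w).
have mD i j : gmeas F (D i j).
  exact: gcmeas_comp (sm_cb (sm_D j (sm_D i gK))).1 mZ.
have DK i j w : `|D i j w| <= K by exact: (sm_cb (sm_D j (sm_D i gK))).2.
pose Y k l w := Num.sqrt eta ^+ 2 * \sum_i \sum_j A w i k * A w j l * D i j w.
have mY k l : gmeas F (Y k l).
  apply: measurable_funM => //; apply: measurable_sum => i; apply: measurable_sum => j.
  by apply: measurable_funM; [apply: measurable_funM; exact: mA|exact: mD].
have YC k l : exists C, forall w, `|Y k l w| <= C.
  exists (Num.sqrt eta ^+ 2 * (d%:R * (d%:R * (a * a * K)))) => w; rewrite normrM ger0_norm ?sqr_ge0//.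
  rewrite ler_wpM2l ?sqr_ge0//; apply: sum_norm_le => i; apply: sum_norm_le => j.
  by rewrite !normrM ler_pM// ler_pM.
have bY k l : P.-integrable setT (EFin \o Y k l).
  have [C YkC] := YC k l; apply: (bounded_integrable _ _ YkC).
  exact: gmeas_measurable (mY k l).
have ik k l : P.-integrable setT (EFin \o (fun w => xi w k 0 * xi w l 0 * Y k l w)).
  have [C YkC] := YC k l.
  apply: (integrable_dom (g := fun w => C * `|xi w k 0 * xi w l 0|)).
  - apply: measurable_funM; first by apply: measurable_funM; exact: mxi.
    exact: gmeas_measurable (mY k l).
  - by move=> w; rewrite normrM mulrC ler_wpM2r.
  - have : P.-integrable setT (fun w => (C%:E * `|(xi w k 0 * xi w l 0)%:E|)%E).
      by apply: integrableZl => //; apply: integrable_abse; exact: i2.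
    by [].
have -> : (fun w => hess_dot g (Z w) (incr w)) =
    (fun w => \sum_k \sum_l xi w k 0 * xi w l 0 * Y k l w).
  by apply/funext => w; exact: hess_dot_quad.
have ik2 k : P.-integrable setT (EFin \o (fun w => \sum_l xi w k 0 * xi w l 0 * Y k l w)).
  exact: integrable_sum_fun.
split; first exact: integrable_sum_fun.
rewrite mean_sum//.
transitivity (\sum_k \int[P]_w Y k k w).
  apply: eq_bigr => k _; rewrite mean_sum// (bigD1 k)//= big1 ?addr0 => [|l lk].
    have [C YkC] := YC k k.
    by rewrite (@indep_mean _ _ _ _ P F xi (fun x => x k 0 * x k 0) (Y k k) C sF Fm ind
      (contM (@coord_continuous _ _ _ k 0) (@coord_continuous _ _ _ k 0)) (i2 k k)
      (mY k k) YkC) m2 eqxx mul1r.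
  have [C YkC] := YC k l.
  by rewrite (@indep_mean _ _ _ _ P F xi (fun x => x k 0 * x l 0) (Y k l) C sF Fm ind
    (contM (@coord_continuous _ _ _ k 0) (@coord_continuous _ _ _ l 0)) (i2 k l)
    (mY k l) YkC) m2 eq_sym (negbTE lk) mul0r.
rewrite -mean_sum//.
have T w : \sum_k Y k k w = 2 * eta * gen (A w) (hess g (Z w)).
  by rewrite [LHS](trace_quad (Z w) (A w) (Num.sqrt eta) sym) sqr_sqrtr// mulrA.
under eq_Rintegral do rewrite T.
rewrite mulrA meanZ//.
apply: bounded_integrable (fun w => gen_hess_norm w gK).
exact: gmeas_measurable (gen_hess_gmeas gK).
Qed.

Lemma value_integrable g K : cb g K ->
  P.-integrable setT (EFin \o (fun w => g (Z w + incr w))) /\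
  P.-integrable setT (EFin \o (fun w => g (Z w))).
Proof.
move=> gK; split; apply: (@bounded_integrable _ _ _ _ _ K).
- by apply: (cmeas_comp gK.1); apply: cmeasD; [exact: cmeas_Z|exact: cmeas_incr].
- by move=> w; exact: gK.2.
- by apply: (cmeas_comp gK.1); exact: cmeas_Z.
- by move=> w; exact: gK.2.
Qed.

(** The first derivatives have a bound [K] of their own, which is small for the barrier
    [beta r] although its values are not. *)
Lemma mean_first K0 K g : sm 2 K0 g -> 0 <= K -> (forall i, sm 1 K ('D_(ev i) g)) ->
  `|\int[P]_w g (Z w + incr w) - \int[P]_w g (Z w)| <= eta * (K * d%:R ^+ 3 * c0 ^+ 2).
Proof.
move=> gK Kp hK.
have [i1 i2] := value_integrable (sm_cb gK); have [i3 e3] := grad_term gK.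
have i12 := integrableB measurableT i1 i2.
have i123 := integrableB measurableT i12 i3.
have -> : \int[P]_w g (Z w + incr w) - \int[P]_w g (Z w) =
    \int[P]_w (g (Z w + incr w) - g (Z w) - grad_dot g (Z w) (incr w)).
  by rewrite meanB// e3 subr0 meanB.
pose B := K * d%:R ^+ 2 * (eta * c0 ^+ 2).
have B0 : 0 <= B by rewrite !mulr_ge0 ?sqr_ge0 ?exprn_ge0.
apply: le_trans (mean_norm_dom (g := fun w => B * `|xi w| ^+ 2) _ _ _) _.
- by apply/measurable_EFinP; have /integrableP[] := i123.
- move=> w; apply: le_trans (taylor_first (Z w) (incr w) Kp (fun i z => @sm_derivable _ _ _ _ _ i z gK) hK) _.
  by rewrite /B -[leRHS]mulrA ler_wpM2l ?incr_sq// mulr_ge0// exprn_ge0.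
- exact: (integrableZl measurableT B whitened_sq_integrable).
rewrite meanZ; last exact: whitened_sq_integrable.
apply: le_trans (ler_wpM2l B0 whitened_sq_mean) _.
by rewrite le_eqVlt; apply/orP; left; apply/eqP; rewrite /B; ring.
Qed.

(** The two first moments of [xi] are those of the Gaussian, so that the mean of a
    smooth function moves according to the generator up to a negligible error. *)
Lemma mean_second K g : sm 3 K g ->
  (forall i j, 'D_(ev j) ('D_(ev i) g) = 'D_(ev i) ('D_(ev j) g)) ->
  `|\int[P]_w g (Z w + incr w) - \int[P]_w g (Z w)
    - eta * \int[P]_w gen (A w) (hess g (Z w))|
  <= eta * (K * (2 * d%:R ^+ 3 * c0 ^+ 2) * rho (Num.sqrt eta * c0)).
Proof.
move=> gK sym; have K0 := cb_ge0 (sm_cb gK).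
have [i1 i2] := value_integrable (sm_cb gK); have [i3 e3] := grad_term (sm_pred gK).
have [i4 e4] := hess_term (sm_pred gK) sym.
have e5 : \int[P]_w (2^-1 * hess_dot g (Z w) (incr w)) =
    eta * \int[P]_w gen (A w) (hess g (Z w)).
  by rewrite (meanZ _ i4) e4 mulrA mulVf ?mul1r.
have i12 := integrableB measurableT i1 i2.
have i123 := integrableB measurableT i12 i3.
have i4' := integrableZl measurableT 2^-1 i4.
have i1234 := integrableB measurableT i123 i4'.
have -> : \int[P]_w g (Z w + incr w) - \int[P]_w g (Z w)
    - eta * \int[P]_w gen (A w) (hess g (Z w)) =
    \int[P]_w (g (Z w + incr w) - g (Z w) - grad_dot g (Z w) (incr w)
      - 2^-1 * hess_dot g (Z w) (incr w)).
  by rewrite meanB// [X in _ = X - _]meanB// e3 subr0 meanB// e5.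
pose s := Num.sqrt eta * c0.
have s0 : 0 <= s by rewrite mulr_ge0 ?sqrtr_ge0 ?c0_ge0.
pose B := K * 2 * d%:R ^+ 3 * (eta * c0 ^+ 2).
have B0 : 0 <= B by rewrite !mulr_ge0 ?sqr_ge0 ?exprn_ge0.
apply: le_trans (mean_norm_dom (g := fun w => B * (`|xi w| ^+ 2 * Num.min 1 (s * `|xi w|))) _ _ _) _.
- by apply/measurable_EFinP; have /integrableP[] := i1234.
- move=> w; apply: le_trans (taylor_second (Z w) (incr w) gK sym) _.
  rewrite /B -[leRHS]mulrA; apply: ler_wpM2l; first by rewrite !mulr_ge0// exprn_ge0.
  rewrite mulrA ler_pM ?sqr_ge0 ?incr_sq//.
  by rewrite le_min ge_min lexx/= ge_min incr_norm orbT.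
- exact: (integrableZl measurableT B (rho_integrable s0)).
rewrite meanZ; last exact: rho_integrable.
by rewrite -/(rho s) le_eqVlt; apply/orP; left; apply/eqP; rewrite /B; ring.
Qed.

End Increment.
End RandomStep.

(** * Mollification *)

Section Mol.
Context {R : realType} {d : nat}.
Implicit Types (h : 'cV[R]_d -> R) (delta : R).

(** Four averages per direction, hence four derivatives. *)
Definition four_each : seq 'I_d := flatten (nseq 4 (enum 'I_d)).

Lemma count_four_each i : count_mem i four_each = 4%N.
Proof. by rewrite /four_each /= !count_cat/= !count_uniq_mem ?enum_uniq// !mem_enum. Qed.

Definition mol delta h := boxes delta four_each h.

Definition molK delta : R := (1 + 2 / delta) ^+ 4.

Lemma mol_sm delta h C : 0 < delta -> cb h C -> sm 4 (C * molK delta) (mol delta h).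
Proof. by move=> d0 hC; apply: boxes_sm => // i; rewrite count_four_each. Qed.

Lemma mol_sym delta h C i j : 0 < delta -> cb h C ->
  'D_(ev j) ('D_(ev i) (mol delta h)) = 'D_(ev i) ('D_(ev j) (mol delta h)).
Proof. by move=> d0 hC; apply: boxes_sym hC => // k; rewrite count_four_each. Qed.

Definition mol_range delta : R := delta *+ size four_each.

Lemma mol_range_lin delta : mol_range delta = delta * mol_range 1.
Proof. by rewrite /mol_range -mulr_natr -[1 *+ _]mulr_natr mul1r. Qed.

Lemma mol_range_ge0 : 0 <= mol_range 1.
Proof. by rewrite /mol_range mulrn_wge0. Qed.

Lemma mol_near delta h C x c e : 0 < delta -> cb h C ->
  (forall y, `|y| <= delta * mol_range 1 -> `|h (x + y) - c| <= e) ->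
  `|mol delta h x - c| <= e.
Proof.
move=> d0 hC H; apply: (boxes_near d0 hC) => y yl; apply: H.
by rewrite -mol_range_lin.
Qed.

Lemma uniform_on_ball (u : 'cV[R]_d -> R) (r e : R) : continuous u -> 0 < e ->
  exists2 del, 0 < del & forall x y, `|x| <= r -> `|y| <= del -> `|u (x + y) - u x| <= e.
Proof.
move=> cu e0; have K := @cv_ball_compact R d r.
have /compact_near_coveringP K' := K.
have e2 : 0 < e / 2 by rewrite divr_gt0.
have H : \forall del \near (0 : R)^'+, [set x : 'cV[R]_d | `|x| <= r] `<=`
    (fun x => forall y, `|y| <= del -> `|u (x + y) - u x| <= e).
  apply: K' => x xr.
  have /cvgrPdist_le/(_ _ e2) := cu x; rewrite -nbhs_ballE => -[r0 /= r00 hr].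
  exists (ball x (r0 / 2), [set del | del < r0 / 2]) => /=.
    split; first by apply: nbhsx_ballx; rewrite divr_gt0.
    by apply: nbhs_right_lt; rewrite divr_gt0.
  move=> [x' del] /= [xx' dr] y yd.
  have h1 : `|u x - u x'| <= e / 2.
    by apply: hr; apply: le_ball xx'; move: r00; lra.
  have h2 : `|u x - u (x' + y)| <= e / 2.
    apply: hr; move: xx'; rewrite -ball_normE /ball_/= => xx'.
    rewrite opprD addrA (le_lt_trans (ler_normB _ _))//.
    by rewrite [ltRHS]splitr ltrD// (le_lt_trans yd).
  rewrite -[u (x' + y)](subrK (u x)) -addrA (le_trans (ler_normD _ _))//.
  by rewrite [leRHS]splitr lerD// distrC.
have [del /= [d0 hd]] := filter_ex (filterI (nbhs_right_gt (0 : R)) H).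
by exists del => // x y xr yd; exact: hd.
Qed.


Lemma boxes_shift delta l h y x : boxes delta l (fun z => h (z + y)) x = boxes delta l h (x + y).
Proof.
elim: l x => //= i l IH x.
rewrite (_ : boxes delta l _ = (fun z => boxes delta l h (z + y))); last exact/funext.
exact: avg_shift.
Qed.

Lemma boxes_lip delta l h C (Lp : R) : 0 < delta -> cb h C ->
  (forall x y, `|h (x + y) - h x| <= Lp * `|y|) ->
  forall x y, `|boxes delta l h (x + y) - boxes delta l h x| <= Lp * `|y|.
Proof.
move=> d0 hC hL x y; rewrite -boxes_shift -(boxesB _ _ _ (cb_shift y hC) hC).
have [cD _] := cbB (cb_shift y hC) hC.
by apply: (boxes_cb delta l (conj cD _)).2 => z; exact: hL.
Qed.

Definition cutoff (r : R) (x : 'cV[R]_d) : R := Num.min 1 (`|x| / r).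

(** A smooth barrier equal to one far away, while its value at the origin and all its
    derivatives are of order [r ^-1]. *)
Definition beta (r : R) := mol 1 (cutoff r).

Section Barrier.
Variable r : R.
Hypothesis r0 : 0 < r.

Lemma min1_lip (p q : R) : `|Num.min 1 p - Num.min 1 q| <= `|p - q|.
Proof.
have := ler_norm (p - q); have := ler_norm (q - p); rewrite (distrC q).
move: `|p - q| => X h1 h2; rewrite ler_norml.
by have [?|?] := lerP 1 p; have [?|?] := lerP 1 q; apply/andP; split; lra.
Qed.

Lemma cutoff_lip x y : `|cutoff r (x + y) - cutoff r x| <= r^-1 * `|y|.
Proof.
apply: le_trans (min1_lip _ _) _; rewrite -mulrBl normrM mulrC normfV (gtr0_norm r0).
apply: ler_wpM2l; first by rewrite invr_ge0 ltW.
by have := ler_dist_dist (x + y) x; rewrite [x + y]addrC addrK.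
Qed.

Lemma cutoff_ge0 x : 0 <= cutoff r x.
Proof. by rewrite le_min ler01 divr_ge0 // ltW. Qed.

Lemma cutoff_cb : cb (cutoff r) 1.
Proof.
split=> [|x]; last by rewrite ger0_norm ?cutoff_ge0// ge_min lexx.
apply: (@lipschitz_continuous _ _ _ _ r^-1) => x y.
by have := cutoff_lip y (x - y); rewrite [y + _]addrC subrK.
Qed.

Lemma cutoff_far x : r <= `|x| -> cutoff r x = 1.
Proof. by move=> rx; rewrite /cutoff min_l// ler_pdivlMr// mul1r. Qed.

Lemma beta_cb : cb (beta r) 1.
Proof. exact: boxes_cb cutoff_cb. Qed.

Lemma mol_const delta h x (c : R) C : 0 < delta -> cb h C ->
  (forall y, `|y| <= delta * mol_range 1 -> h (x + y) = c) -> mol delta h x = c.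
Proof.
move=> d0 hC H; apply/eqP; rewrite -subr_eq0 -normr_le0.
by apply: (mol_near d0 hC) => y /H ->; rewrite subrr normr0.
Qed.

Lemma norm_shift_ge (x y : 'cV[R]_d) (s t : R) : s + t <= `|x| -> `|y| <= t -> s <= `|x + y|.
Proof.
move=> sx yt; have := ler_normB (x + y) y; rewrite addrK; lra.
Qed.

Lemma beta_far x : r + mol_range 1 <= `|x| -> beta r x = 1.
Proof.
move=> rx; apply: (mol_const ltr01 cutoff_cb) => y; rewrite mul1r => yl.
by apply: cutoff_far; exact: norm_shift_ge rx yl.
Qed.

Lemma mol_beta_far delta x : 0 < delta -> delta <= 1 -> r + mol_range 1 + mol_range 1 <= `|x| ->
  mol delta (beta r) x = 1.
Proof.
move=> d0 d1 rx; apply: (mol_const d0 beta_cb) => y yl; apply: beta_far.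
apply: norm_shift_ge rx (le_trans yl _).
by rewrite ler_piMl// mol_range_ge0.
Qed.

Lemma mol_ge0 delta h C x : 0 < delta -> cb h C -> (forall x, 0 <= h x) -> 0 <= mol delta h x.
Proof.
move=> d0 hC h0; rewrite -(boxes_cst delta four_each (0 : R) x).
exact: (boxes_le _ _ _ (cb_cst 0) hC).
Qed.

Lemma beta_ge0 x : 0 <= beta r x.
Proof. exact: (mol_ge0 _ ltr01 cutoff_cb cutoff_ge0). Qed.

Lemma beta_lip x y : `|beta r (x + y) - beta r x| <= r^-1 * `|y|.
Proof. exact: (boxes_lip _ ltr01 cutoff_cb cutoff_lip). Qed.

Lemma mol_beta_near delta x : 0 < delta -> delta <= 1 ->
  `|mol delta (beta r) x - beta r x| <= mol_range 1 / r.
Proof.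
move=> d0 d1; apply: (mol_near d0 beta_cb) => y yl.
apply: le_trans (beta_lip x y) _; rewrite mulrC ler_wpM2r ?invr_ge0 ?(ltW r0)//.
by apply: le_trans yl _; rewrite ler_piMl// mol_range_ge0.
Qed.

Lemma beta_le x : beta r x <= (`|x| + mol_range 1) / r.
Proof.
have : `|beta r x - cutoff r x| <= mol_range 1 / r.
  apply: (mol_near ltr01 cutoff_cb) => y; rewrite mul1r => yl.
  by apply: le_trans (cutoff_lip x y) _; rewrite mulrC ler_wpM2r// invr_ge0 ltW.
have : cutoff r x <= `|x| / r by rewrite ge_min lexx orbT.
move=> h1 /ler_normlW h2; rewrite mulrDl; move: h1 h2.
by move: (_ / r) (_ / r) => X Y; lra.
Qed.

Lemma beta_sm : sm 4 (molK 1) (beta r).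
Proof. by have := mol_sm ltr01 cutoff_cb; rewrite mul1r. Qed.

Lemma beta_D_sm i : sm 1 (3 / r) ('D_(ev i) (beta r)).
Proof.
have il : i \in four_each by rewrite -has_pred1 has_count count_four_each.
rewrite (boxes_deriveE ltr01 cutoff_cb il).
have cdq : cb (dq 1 i (cutoff r)) r^-1.
  have [cc _] := dq_cb ltr01 i cutoff_cb; split => // x.
  rewrite /dq divr1 scale1r; apply: le_trans (cutoff_lip x _) _.
  rewrite ler_piMr ?invr_ge0 ?(ltW r0)//.
  by have := @norm_ev_le R d 1 i; rewrite scale1r normr1.
have := @boxes_sm R d 1 1 (rem i four_each) _ _ ltr01 _ cdq.
rewrite expr1 divr1 (_ : r^-1 * (1 + 2) = 3 / r); last by rewrite mulrC; congr (_ / _); ring.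
apply => j; rewrite count_mem_rem count_four_each.
by case: (_ == _).
Qed.

(** Mollification converges locally uniformly; the barrier takes care of infinity. *)
Lemma mol_approx u M e : cb u M -> 0 < e ->
  exists delta0, [/\ 0 < delta0, delta0 <= 1 & forall delta, 0 < delta -> delta <= delta0 ->
    forall x, `|mol delta u x - u x| <= e + 2 * M * mol delta (beta r) x].
Proof.
move=> uM e0; have M0 := cb_ge0 uM.
have [del del0 hdel] := uniform_on_ball (r + mol_range 1 + mol_range 1) uM.1 e0.
have k0 := mol_range_ge0.
have k1 : 0 < mol_range 1 + 1 by rewrite ltr_wpDl.
exists (Num.min 1 (del / (mol_range 1 + 1))); split=> [||delta d0].
- by rewrite lt_min ltr01 divr_gt0.
- by rewrite ge_min lexx.
rewrite le_min => /andP[d1 dk] x.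
have dd : delta * mol_range 1 <= del.
  apply: (@le_trans _ _ (del / (mol_range 1 + 1) * mol_range 1)); first by rewrite ler_wpM2r.
  by rewrite mulrAC ler_pdivrMr// ler_wpM2l ?lerDl// ltW.
have b0 := mol_ge0 x d0 beta_cb beta_ge0.
have [xr|xr] := lerP `|x| (r + mol_range 1 + mol_range 1).
  apply: (@le_trans _ _ e); last by rewrite lerDl !mulr_ge0.
  apply: (mol_near d0 uM) => y yl; apply: hdel => //; exact: le_trans yl dd.
rewrite mol_beta_far ?(ltW xr)// mulr1 (le_trans (ler_normB _ _))//.
have h1 := (boxes_cb delta four_each uM).2 x; have h2 := uM.2 x.
rewrite -/(mol delta u) in h1; lra.
Qed.

End Barrier.
End Mol.

(** * Transition operators *)

Section Transition.
Context {R : realType} {d : nat} {disp : measure_display} {Omega : measurableType disp}.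
Variables (P : probability Omega R) (xi : Omega -> 'cV[R]_d).
Hypothesis W : whitened P xi.
Implicit Types (h g : 'cV[R]_d -> R) (A : 'M[R]_d).

Definition trans A (eta : R) h := avg P (fun w => Num.sqrt eta *: (A *m xi w)) h.

Lemma cmeas_trans A eta : cmeas (fun w => Num.sqrt eta *: (A *m xi w)).
Proof.
by case: W => mxi _ _ _ _; apply: cmeasZ; apply: cmeasM.
Qed.

Lemma trans_cb A eta h C : cb h C -> cb (trans A eta h) C.
Proof. by apply: avg_cb; exact: cmeas_trans. Qed.

Lemma iter_trans_cb A eta m h C : cb h C -> cb (iter m (trans A eta) h) C.
Proof. by move=> hC; elim: m => //= m; exact: trans_cb. Qed.

Lemma transB A eta h g C D x : cb h C -> cb g D ->
  trans A eta (fun y => h y - g y) x = trans A eta h x - trans A eta g x.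
Proof. by apply: avgB; exact: cmeas_trans. Qed.

Lemma transD A eta h g C D x : cb h C -> cb g D ->
  trans A eta (fun y => h y + g y) x = trans A eta h x + trans A eta g x.
Proof. by apply: avgD; exact: cmeas_trans. Qed.

Lemma transZ A eta h C c x : cb h C ->
  trans A eta (fun y => c * h y) x = c * trans A eta h x.
Proof. by apply: avgZ; exact: cmeas_trans. Qed.

Lemma trans_cst A eta (c x : _) : trans A eta (fun=> c) x = c.
Proof. exact: avg_cst. Qed.

Lemma trans_le A eta h g C D x : cb h C -> cb g D -> (forall y, h y <= g y) ->
  trans A eta h x <= trans A eta g x.
Proof. by apply: avg_le; exact: cmeas_trans. Qed.

Lemma iter_trans_le A eta m h g C D x : cb h C -> cb g D -> (forall y, h y <= g y) ->
  iter m (trans A eta) h x <= iter m (trans A eta) g x.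
Proof.
move=> hC gD hg; elim: m x => //= m IH x.
by apply: (trans_le _ _ _ (iter_trans_cb A eta m hC) (iter_trans_cb A eta m gD)).
Qed.

Lemma iter_transB A eta m h g C D x : cb h C -> cb g D ->
  iter m (trans A eta) (fun y => h y - g y) x =
  iter m (trans A eta) h x - iter m (trans A eta) g x.
Proof.
move=> hC gD; elim: m x => //= m IH x.
have -> : iter m (trans A eta) (fun y => h y - g y) =
    (fun y => iter m (trans A eta) h y - iter m (trans A eta) g y) by exact/funext.
exact: (transB _ _ _ (iter_trans_cb A eta m hC) (iter_trans_cb A eta m gD)).
Qed.

Lemma iter_transZ A eta m h C c x : cb h C ->
  iter m (trans A eta) (fun y => c * h y) x = c * iter m (trans A eta) h x.
Proof.
move=> hC; elim: m x => //= m IH x.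
have -> : iter m (trans A eta) (fun y => c * h y) =
    (fun y => c * iter m (trans A eta) h y) by exact/funext.
exact: (transZ _ _ _ _ (iter_trans_cb A eta m hC)).
Qed.

Lemma iter_trans_cst A eta m c x : iter m (trans A eta) (fun=> c) x = c.
Proof.
elim: m x => //= m IH x; have -> : iter m (trans A eta) (fun=> c) = (fun=> c) by exact/funext.
exact: trans_cst.
Qed.

Lemma boxes_trans delta l A eta h C : cb h C ->
  boxes delta l (trans A eta h) = trans A eta (boxes delta l h).
Proof. exact: (boxes_avg _ _ _ (cmeas_trans A eta)). Qed.

Lemma boxes_iter_trans delta l A eta m h C : cb h C ->
  boxes delta l (iter m (trans A eta) h) = iter m (trans A eta) (boxes delta l h).
Proof.
move=> hC; elim: m => //= m <-.
exact: (boxes_trans _ _ _ _ (iter_trans_cb A eta m hC)).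
Qed.

Lemma trans_dq delta i A eta h C : cb h C -> 
  trans A eta (dq delta i h) = dq delta i (trans A eta h).
Proof. by apply: avg_dq; exact: cmeas_trans. Qed.

Lemma iter_trans_dq delta i A eta m h C : cb h C ->
  iter m (trans A eta) (dq delta i h) = dq delta i (iter m (trans A eta) h).
Proof.
move=> hC; elim: m => //= m ->.
exact: trans_dq (iter_trans_cb A eta m hC).
Qed.

(** The operator is a contraction for the uniform norm, so that the increments of the
    iterates do not grow. *)
Lemma iter_trans_near A eta m h C B x : cb h C ->
  (forall y, `|trans A eta h y - h y| <= B) ->
  `|iter m (trans A eta) h x - h x| <= m%:R * B.
Proof.
move=> hC hB; elim: m x => [|m IH] x; first by rewrite subrr normr0 mul0r.
rewrite /= -[_ - h x](subrK (trans A eta h x)) addrAC -addrA addrC.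
have hm := iter_trans_cb A eta m hC.
rewrite -natr1 mulrDl mul1r addrA.
apply: le_trans (_ : `|trans A eta (iter m (trans A eta) h) x - trans A eta h x
  + (trans A eta h x - h x)| <= _).
  by rewrite addrA subrK [X in `|X|](_ : _ = trans A eta (iter m (trans A eta) h) x - h x)//; ring.
apply: le_trans (ler_normD _ _) _; apply: lerD => //.
rewrite -(transB _ _ _ hm hC).
have [cD _] := cbB hm hC.
by have := (trans_cb A eta (conj cD (fun y => IH y))).2 x.
Qed.

Variables (F : set (set Omega)).
Hypotheses (sF : sigma_algebra setT F) (Fm : F `<=` measurable).
Hypothesis ind : independent_of P F xi.
Variables (a : R) (A : 'M[R]_d) (eta : R).
Hypothesis (a0 : 0 <= a) (eta0 : 0 <= eta).
Hypothesis Aa : forall i j, `|A i j| <= a.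

Definition first_const : R := d%:R ^+ 3 * (d%:R * a) ^+ 2.
Definition second_err : R := 2 * d%:R ^+ 3 * (d%:R * a) ^+ 2 * rho P xi (Num.sqrt eta * (d%:R * a)).

Lemma first_const_ge0 : 0 <= first_const.
Proof. by rewrite mulr_ge0 ?sqr_ge0 ?exprn_ge0. Qed.

Lemma trans_first K0 K g x : sm 2 K0 g -> 0 <= K -> (forall i, sm 1 K ('D_(ev i) g)) ->
  `|trans A eta g x - g x| <= eta * (K * first_const).
Proof.
move=> gK Kp hK.
have mZ : gcmeas F (fun=> x : 'cV[R]_d) by move=> i; exact: measurable_cst.
have mA i j : gmeas F (fun=> A i j) by exact: measurable_cst.
have := mean_first W sF Fm ind a0 (A := fun=> A) mZ mA (fun _ => Aa) eta0 gK Kp hK.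
by rewrite mean_cst (_ : K * first_const = K * d%:R ^+ 3 * (d%:R * a) ^+ 2)// /first_const mulrA.
Qed.

Lemma trans_second K g x : sm 3 K g ->
  (forall i j, 'D_(ev j) ('D_(ev i) g) = 'D_(ev i) ('D_(ev j) g)) ->
  `|trans A eta g x - g x - eta * gen A (hess g x)| <= eta * (K * second_err).
Proof.
move=> gK sym.
have mZ : gcmeas F (fun=> x : 'cV[R]_d) by move=> i; exact: measurable_cst.
have mA i j : gmeas F (fun=> A i j) by exact: measurable_cst.
have := mean_second W sF Fm ind a0 (A := fun=> A) mZ mA (fun _ => Aa) eta0 gK sym.
rewrite !mean_cst (_ : K * second_err = K * (2 * d%:R ^+ 3 * (d%:R * a) ^+ 2) *
  rho P xi (Num.sqrt eta * (d%:R * a)))// /second_err mulrA//.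
Qed.

(** A Lipschitz function varies by the square root of the step, while a smooth one varies by
    the step; compare [trans_first]. *)
Lemma trans_lip h C Lp x : cb h C -> 0 <= Lp ->
  (forall x y, `|h (x + y) - h x| <= Lp * `|y|) ->
  `|trans A eta h x - h x| <= Lp * (Num.sqrt eta * (d%:R * a * (1 + d%:R))).
Proof.
move=> hC Lp0 hL; have s0 : 0 <= Num.sqrt eta by exact: sqrtr_ge0.
have ih := avg_integrable P (cmeas_trans A eta) x hC.
rewrite -[h x](mean_cst P) /trans /avg -meanB//; last first.
  by apply: (@bounded_integrable _ _ _ _ _ `|h x|).
have i2 := whitened_sq_integrable W.
have i1 : P.-integrable setT (EFin \o (fun=> 1 : R)).
  by apply: (@bounded_integrable _ _ _ _ _ 1) => // w; rewrite normr1.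
pose B := Lp * (Num.sqrt eta * (d%:R * a)).
have B0 : 0 <= B by rewrite !mulr_ge0.
have i12 : P.-integrable setT (EFin \o (fun w => 1 + `|xi w| ^+ 2)).
  exact: (integrableD measurableT i1 i2).
apply: le_trans (mean_norm_dom (g := fun w => B * (1 + `|xi w| ^+ 2)) _ _ _) _.
- apply: measurable_funB => //; first by apply/measurable_EFinP; have /integrableP[] := ih.
- move=> w; apply: le_trans (hL x _) _; rewrite /B -[leRHS]mulrA ler_wpM2l//.
  rewrite normrZ ger0_norm// -[leRHS]mulrA ler_wpM2l//.
  apply: le_trans (norm_mulmx_le _ Aa) _; rewrite ler_wpM2l ?mulr_ge0//.
  have := sqr_ge0 (`|xi w| - 1); rewrite sqrrB1; have := normr_ge0 (xi w).
  move: (`|xi w| ^+ 2) => X; lra.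
- exact: (integrableZl measurableT B i12).
rewrite meanZ// meanD// mean_cst.
rewrite /B -!mulrA !ler_wpM2l// lerD2l.
exact: whitened_sq_mean.
Qed.

End Transition.

(** * Upper bound for constant controls *)

Lemma expand_arith {R : realType} (J eta X1 X2 X3 X4 X5 X6 X7 : R) :
  - (eta * X7) <= X3 - X4 - eta * X2 -> X5 + J * X1 - J * X7 - J ^+ 2 * X6 <= X4 ->
  eta * X1 <= eta * X2 + eta * J * X6 -> (J ^+ 2 + eta * J) * X6 <= (J + eta) ^+ 2 * X6 ->
  X5 + (J + eta) * X1 - (J + eta) * X7 - (J + eta) ^+ 2 * X6 <= X3.
Proof. lra. Qed.

Lemma below_arith {R : realType} (M e r X B B' Y k c l V : R) :
  X - (2 * e + 4 * M * (k / r)) - 4 * M * B' <= Y ->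
  M * (B' - B) <= M * (3 / r * c) -> Y - l <= V -> l <= e ->
  X - 4 * M * B - (3 * e + 4 * M * (3 * c + k) / r) <= V.
Proof.
rewrite -(mulrA _ (3 * c + k)) [(3 * c + k) * _]mulrDl [3 * c * _]mulrAC mulrBr; move: (k / r) (3 / r * c) => Z Z'; lra.
Qed.

Lemma upper_arith {R : realType} (M e B B' Y k X I J l V Z : R) :
  X + I - l - Z <= J -> J - 4 * M * B - (3 * e + k) <= V ->
  B - B' <= Y -> 4 * M * (B' + Y) + k <= e -> 0 <= M -> l <= e ->
  X + I - Z <= V + e * 5.
Proof.
move=> h1 h2 h3 h4 M0 h5.
have := ler_wpM2l M0 h3; lra.
Qed.

Section ConstantControl.
Context {R : realType} {d : nat} {disp : measure_display} {Omega : measurableType disp}.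
Variables (P : probability Omega R) (xi : Omega -> 'cV[R]_d).
Hypothesis W : whitened P xi.
Variables (F : set (set Omega)).
Hypotheses (sF : sigma_algebra setT F) (Fm : F `<=` measurable).
Hypothesis ind : independent_of P F xi.
Variables (a : R).
Hypothesis a0 : 0 <= a.
Variable A : 'M[R]_d.
Hypothesis Aa : forall i j, `|A i j| <= a.
Implicit Types (h g : 'cV[R]_d -> R) (eta : R).

Notation c1 := (@first_const R d a).
Notation err := (@second_err R d _ _ P xi a).

Lemma sm_first K g eta x : sm 2 K g -> 0 <= eta ->
  `|trans P xi A eta g x - g x| <= eta * (K * c1).
Proof.
move=> gK e0; apply: (trans_first W sF Fm ind a0 e0 Aa _ gK).
- exact: cb_ge0 (sm_cb gK).
- by move=> i; exact: sm_D gK.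
Qed.

Lemma boxes_increment eta delta l h C x : cb h C ->
  boxes delta l (fun y => eta^-1 * (trans P xi A eta h y - h y)) x =
  eta^-1 * (trans P xi A eta (boxes delta l h) x - boxes delta l h x).
Proof.
move=> hC; have hT := trans_cb W A eta hC.
rewrite (boxesZ _ _ _ _ (cbB hT hC)) (boxesB _ _ _ hT hC).
by rewrite (boxes_trans W _ _ _ _ hC).
Qed.

Lemma increment_cb eta delta l h C m : 0 < eta -> 0 < delta ->
  (forall i, (2 <= count_mem i l)%N) -> (2 <= m)%N -> cb h C ->
  cb (boxes delta l (fun y => eta^-1 * (trans P xi A eta h y - h y)))
     (C * (1 + 2 / delta) ^+ m * c1).
Proof.
move=> eta0 d0 l2 m2 hC; have C0 := cb_ge0 hC.
have q0 : 0 <= 2 / delta by rewrite divr_ge0 ?ltW.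
have hT := trans_cb W A eta hC.
have hk := cbZ eta^-1 (cbB hT hC).
split=> [|x]; first exact: (boxes_cb _ _ hk).1.
rewrite (boxes_increment _ _ _ _ hC) normrM gtr0_norm ?invr_gt0// ler_pdivrMl//.
apply: le_trans (sm_first x (boxes_sm d0 l2 hC) (ltW eta0)) _.
apply: ler_wpM2l; first exact: ltW.
apply: ler_wpM2r; first exact: first_const_ge0.
apply: ler_wpM2l => //.
by apply: ler_weXn2l => //; rewrite lerDl.
Qed.

(** Difference quotients and averages commute with the transition operator, so that the
    derivatives of an increment are increments of smooth functions, of order [eta]. This is
    needed to use the increment quotient as [g1] in [supersolution_step]. *)
Lemma increment_sm eta delta n l h C : 0 < eta -> 0 < delta ->
  (forall i, (n.+2 <= count_mem i l)%N) -> cb h C ->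
  sm n (C * (1 + 2 / delta) ^+ n.+2 * c1)
    (boxes delta l (fun y => eta^-1 * (trans P xi A eta h y - h y))).
Proof.
move=> eta0 d0; elim: n l h C => [|n IH] l h C nl hC.
  by split => //; exact: increment_cb.
have C0 := cb_ge0 hC.
have q0 : 0 <= 2 / delta by rewrite divr_ge0 ?ltW.
have hT := trans_cb W A eta hC.
have hk := cbZ eta^-1 (cbB hT hC).
split; first by apply: increment_cb => // i; apply: leq_trans (nl i).
move=> i; have il : i \in l by rewrite -has_pred1 has_count; apply: leq_trans (nl i).
split=> [x|]; first by have [] := boxes_derive d0 x hk il.
rewrite (boxes_deriveE d0 hk il).
have -> : dq delta i (fun y => eta^-1 * (trans P xi A eta h y - h y)) =
    (fun y => eta^-1 * (trans P xi A eta (dq delta i h) y - dq delta i h y)).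
  by rewrite (trans_dq W _ _ _ _ hC); apply/funext => y; rewrite /dq; ring.
apply: sm_le (IH (rem i l) (dq delta i h) _ _ (dq_cb d0 i hC)).
  apply: ler_wpM2r; first exact: first_const_ge0.
  rewrite [in leRHS]exprS [leRHS]mulrA; apply: ler_wpM2r; first by rewrite exprn_ge0 ?addr_ge0.
  by apply: ler_wpM2l => //; lra.
move=> j; rewrite count_mem_rem; case: eqVneq => _; last by rewrite subn0 ltnW.
by rewrite subn1 -ltnS prednK// (leq_ltn_trans _ (nl j)).
Qed.

Lemma hess_addcst delta h C c x : 0 < delta -> cb h C ->
  hess (mol delta (fun y => h y + c)) x = hess (mol delta h) x.
Proof.
move=> d0 hC; have hc := cbD hC (cb_cst c).
have E i : 'D_(ev i) (mol delta (fun y => h y + c)) = 'D_(ev i) (mol delta h).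
  have il : i \in four_each by rewrite -has_pred1 has_count count_four_each.
  rewrite (boxes_deriveE d0 hc il) (boxes_deriveE d0 hC il).
  by congr boxes; apply/funext => y; rewrite /dq; congr (_ / _); ring.
by apply: eq_mx => i j; rewrite E.
Qed.

Variables (Lambda : set 'M[R]_d).
Hypothesis Lambda0 : Lambda !=set0.
Hypothesis Lambda_a : forall A, Lambda A -> forall i j, `|A i j| <= a.
Variables (f : 'cV[R]_d -> R) (v : R * 'cV[R]_d -> R).
Hypothesis hv : viscosity_solution Lambda f v.
Hypothesis LA : Lambda A.

Definition step_loss (C delta eta : R) : R :=
  let e := C * molK delta * err eta in
  e + @step_const R d a * (C * molK delta * c1 + e) * eta.

(** The new minorant is again the mollification of a bounded function, with the same bound,
    up to a constant: the step can be iterated without losing regularity. *)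
Lemma super_step delta h C c t T : 0 < delta -> cb h C -> 0 <= t < T -> T <= 1 ->
  (forall x, mol delta h x + c <= v (T, x)) ->
  forall x, mol delta (trans P xi A (T - t) h) x + c - (T - t) * step_loss C delta (T - t)
    <= v (t, x).
Proof.
move=> d0 hC /andP[t0 tT] T1 hvT x.
set eta := T - t; have eta0 : 0 < eta by rewrite subr_gt0.
have C0 := cb_ge0 hC.
have hk := trans_cb W A eta hC.
have molc y : mol delta (fun y => h y + c) y = mol delta h y + c.
  by rewrite /mol (boxesD _ _ _ hC (cb_cst c)) boxes_cst.
have mK0 : 0 <= molK delta by rewrite exprn_ge0// addr_ge0// divr_ge0// ltW.
have er0 : 0 <= err eta.
  rewrite /second_err mulr_ge0 ?mulr_ge0 ?sqr_ge0 ?exprn_ge0//.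
  have s0 : 0 <= Num.sqrt eta * (d%:R * a) by rewrite !mulr_ge0 ?sqrtr_ge0.
  by apply: Rintegral_ge0 => w _; have /andP[] := min1_le xi w s0.
have qsm := mol_sm d0 hC.
have n4 i : (4 <= count_mem i (@four_each d))%N by rewrite count_four_each.
have q_at y : mol delta (fun y => eta^-1 * (trans P xi A eta h y - h y)) y =
  eta^-1 * (trans P xi A eta (mol delta h) y - mol delta h y) :=
  boxes_increment eta delta four_each y hC.
have H := @supersolution_step R d Lambda a Lambda0 Lambda_a f v hv A
  (mol delta (fun y => h y + c))
  (mol delta (fun y => eta^-1 * (trans P xi A eta h y - h y))) _
  (C * molK delta * c1) (C * molK delta * err eta) t T LA.
have := H _ _ T1 _ (sm_pred (sm_pred (mol_sm d0 (cbD hC (cb_cst c)))))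
  (increment_sm eta0 d0 n4 hC) _ _ x.
rewrite molc q_at -/eta t0 (ltW tT) => G.
apply: le_trans (G isT _ _ _).
- rewrite /step_loss /mol (boxes_trans W _ _ _ _ hC) -/(mol delta h).
  cbv zeta.
  move: (mol delta h x) (trans P xi A eta (mol delta h) x) (C * molK delta) => X Y Z.
  rewrite le_eqVlt; apply/orP; left; apply/eqP.
  by field; rewrite gt_eqF.
- exact: (mulr_ge0 (mulr_ge0 C0 mK0) er0).
- by move=> y; rewrite molc.
- move=> y; rewrite (hess_addcst _ _ d0 hC) q_at ler_pdivrMl// mulrDr.
  have := trans_second W sF Fm ind a0 (ltW eta0) Aa y (sm_pred qsm) (fun i j => mol_sym i j d0 hC).
  by move=> /ler_normlW; rewrite -/(mol delta h); lra.
Qed.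

Lemma super_iter delta h C t T m : 0 < delta -> cb h C -> 0 <= t -> t < T -> T <= 1 -> (0 < m)%N ->
  (forall x, mol delta h x <= v (T, x)) ->
  forall x, mol delta (iter m (trans P xi A ((T - t) / m%:R)) h) x
    - (T - t) * step_loss C delta ((T - t) / m%:R) <= v (t, x).
Proof.
move=> d0 hC t0 tT T1 m0 hvT.
set eta := (T - t) / m%:R.
have m0' : (0 : R) < m%:R by rewrite ltr0n.
have eta0 : 0 < eta by rewrite divr_gt0// subr_gt0.
have etam : m%:R * eta = T - t by rewrite mulrC divfK ?gt_eqF.
have H j : (j <= m)%N -> forall x, mol delta (iter j (trans P xi A eta) h) x
    + - (j%:R * (eta * step_loss C delta eta)) <= v (T - j%:R * eta, x).
  elim: j => [|j IH] jm x; first by rewrite !mul0r !subr0.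
  have jm' : j.+1%:R * eta <= T - t.
    by rewrite -etam ler_wpM2r ?(ltW eta0)// ler_nat.
  have E : T - j%:R * eta - (T - j.+1%:R * eta) = eta.
    by rewrite -natr1; ring.
  have := super_step (t := T - j.+1%:R * eta) d0 (iter_trans_cb W A eta j hC) _ _ (IH (ltnW jm)) x.
  rewrite E => G.
  have -> : - (j.+1%:R * (eta * step_loss C delta eta)) =
    - (j%:R * (eta * step_loss C delta eta)) - eta * step_loss C delta eta.
    by rewrite -natr1; ring.
  rewrite addrA; apply: G.
    apply/andP; split; first by rewrite -natr1 in jm' *; lra.
    by rewrite ltrD2l ltrN2 ltr_pM2r// ltr_nat.
  by rewrite lerBlDr (le_trans T1)// lerDl mulr_ge0// ltW.
move=> x; have := H m (leqnn m) x; rewrite mulrA etam.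
by have -> : T - (T - t) = t by ring.
Qed.

Lemma err_small e : 0 < e -> exists2 eta0, 0 < eta0 &
  forall eta, 0 <= eta -> eta <= eta0 -> err eta <= e.
Proof.
move=> e0; pose k := 2 * d%:R ^+ 3 * (d%:R * a) ^+ 2.
have k0 : 0 <= k by rewrite !mulr_ge0 ?sqr_ge0 ?exprn_ge0.
have k1 : 0 < k + 1 by rewrite ltr_wpDl.
have [s [s0 rs]] := rho_small W (divr_gt0 e0 k1).
have c0 : 0 <= d%:R * a by rewrite mulr_ge0.
have c1' : 0 < d%:R * a + 1 by rewrite ltr_wpDl.
exists ((s / (d%:R * a + 1)) ^+ 2); first by rewrite exprn_gt0// divr_gt0.
move=> eta eta0 etas.
have sq : Num.sqrt eta <= s / (d%:R * a + 1).
  have p0 : 0 <= s / (d%:R * a + 1) by rewrite divr_ge0 // ltW.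
  by rewrite -[leRHS](ger0_norm p0) -sqrtr_sqr ler_wsqrtr.
have ss : Num.sqrt eta * (d%:R * a) <= s.
  apply: (@le_trans _ _ (s / (d%:R * a + 1) * (d%:R * a))); first by rewrite ler_wpM2r.
  by rewrite mulrAC ler_pdivrMr// ler_wpM2l ?lerDl// ltW.
rewrite /second_err -/k; apply: (@le_trans _ _ (k * (e / (k + 1)))).
  rewrite ler_wpM2l// (le_trans _ rs)// rho_le// mulr_ge0// sqrtr_ge0.
by rewrite mulrCA ler_piMr ?(ltW e0)// ler_pdivrMr// mul1r lerDl.
Qed.

Lemma err_ge0 eta : 0 <= err eta.
Proof.
rewrite /second_err mulr_ge0 ?mulr_ge0 ?sqr_ge0 ?exprn_ge0//.
have s0 : 0 <= Num.sqrt eta * (d%:R * a) by rewrite !mulr_ge0 ?sqrtr_ge0.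
by apply: Rintegral_ge0 => w _; have /andP[] := min1_le xi w s0.
Qed.

Lemma molK_ge0 (delta : R) : 0 < delta -> 0 <= molK delta.
Proof. by move=> d0; rewrite exprn_ge0// addr_ge0// divr_ge0// ltW. Qed.

Lemma step_const_ge0 : 0 <= @step_const R d a.
Proof. by rewrite addr_ge0// mulr_ge0// gen_bound_ge0. Qed.

Lemma loss_small C delta e : 0 <= C -> 0 < delta -> 0 < e -> exists2 eta0, 0 < eta0 &
  forall eta, 0 <= eta -> eta <= eta0 -> step_loss C delta eta <= e.
Proof.
move=> C0 d0 e0; pose K := C * molK delta.
have K0 : 0 <= K by rewrite mulr_ge0 ?molK_ge0.
have K1 : 0 < K + 1 by rewrite ltr_wpDl.
pose B := @step_const R d a * (K * c1 + K).
have B0 : 0 <= B.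
  by rewrite mulr_ge0 ?step_const_ge0// addr_ge0// mulr_ge0// first_const_ge0.
have B1 : 0 < B + 1 by rewrite ltr_wpDl.
have e2 : 0 < Num.min 1 (e / 2 / (K + 1)) by rewrite lt_min ltr01 !divr_gt0.
have [r r0 hr] := err_small e2.
exists (Num.min r (e / 2 / (B + 1))); first by rewrite lt_min r0 !divr_gt0.
move=> eta eta0; rewrite le_min => /andP[/(hr _ eta0) er eB].
have er1 : err eta <= 1 by apply: le_trans er _; rewrite ge_min lexx.
have er2 : err eta <= e / 2 / (K + 1) by apply: le_trans er _; rewrite ge_min lexx orbT.
rewrite /step_loss -/K; cbv zeta; rewrite [e]splitr; apply: lerD.
  apply: (@le_trans _ _ (K * (e / 2 / (K + 1)))); first by rewrite ler_wpM2l.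
  by rewrite mulrCA ler_piMr ?divr_ge0 ?(ltW e0)// ler_pdivrMr// mul1r lerDl.
apply: (@le_trans _ _ (B * (e / 2 / (B + 1)))); last first.
  by rewrite mulrCA ler_piMr ?divr_ge0 ?(ltW e0)// ler_pdivrMr// mul1r lerDl.
apply: ler_pM => //.
  apply: mulr_ge0; first exact: step_const_ge0.
  by apply: addr_ge0; apply: mulr_ge0 => //; [exact: first_const_ge0|exact: err_ge0].
apply: ler_wpM2l; first exact: step_const_ge0.
by rewrite lerD2l ler_piMr.
Qed.

Lemma D2_iter_trans eta j delta u M i k x : 0 < delta -> cb u M ->
  'D_(ev k) ('D_(ev i) (mol delta (iter j (trans P xi A eta) u))) x =
  iter j (trans P xi A eta) ('D_(ev k) ('D_(ev i) (mol delta u))) x.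
Proof.
move=> d0 uM; have il l : l \in @four_each d by rewrite -has_pred1 has_count count_four_each.
have il2 l l' : l \in rem l' (@four_each d).
  by rewrite -has_pred1 has_count count_mem_rem count_four_each; case: (_ == _).
have uj := iter_trans_cb W A eta j uM.
have E1 := boxes_deriveE d0 uj (il i); rewrite -/(mol delta _) in E1.
have E2 := boxes_deriveE d0 uM (il i); rewrite -/(mol delta _) in E2.
rewrite E1 E2.
have [_ ->] := boxes_derive d0 x (dq_cb d0 i uj) (il2 k i).
have -> := boxes_deriveE d0 (dq_cb d0 i uM) (il2 k i).
rewrite -(boxes_iter_trans W _ _ _ _ _ (dq_cb d0 k (dq_cb d0 i uM))).
by rewrite (iter_trans_dq W _ _ _ _ _ (dq_cb d0 i uM)) (iter_trans_dq W _ _ _ _ _ uM).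
Qed.

(** Derivatives commute with the transition operator, so the Hessian of the [j]-th iterate
    stays within [j * eta] of the initial one; this gives the quadratic error. *)
Lemma iter_expand eta j delta u M x : 0 <= eta -> 0 < delta -> cb u M ->
  mol delta u x + (j%:R * eta) * gen A (hess (mol delta u) x)
    - (j%:R * eta) * (M * molK delta * err eta)
    - (j%:R * eta) ^+ 2 * (@gen_bound R d a * (M * molK delta * c1))
  <= iter j (trans P xi A eta) (mol delta u) x.
Proof.
set q := mol delta u; set K := M * molK delta; move=> eta0 d0 uM.
have qK : sm 4 K q := mol_sm d0 uM.
have K0 : 0 <= K := cb_ge0 (sm_cb qK).
have gb0 : 0 <= @gen_bound R d a * (K * c1).
  by rewrite mulr_ge0 ?gen_bound_ge0// mulr_ge0// first_const_ge0.
elim: j => [|j IH]; first by rewrite !mul0r expr0n/= mul0r !subr0 addr0.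
set uj := iter j (trans P xi A eta) u.
have ujM : cb uj M := iter_trans_cb W A eta j uM.
have qjE : iter j (trans P xi A eta) q = mol delta uj by rewrite /mol (boxes_iter_trans W _ _ _ _ _ uM).
have := trans_second W sF Fm ind a0 eta0 Aa x (sm_pred (mol_sm d0 ujM)) (fun i k => mol_sym i k d0 ujM).
rewrite iterS qjE -/K ler_norml => /andP[H1 _].
have Hik i k : `|hess q x i k - hess (mol delta uj) x i k| <= j%:R * (eta * (K * c1)).
  have qik := sm_D k (sm_D i qK).
  have := @iter_trans_near _ _ _ _ P xi W A eta j _ _ _ x (sm_cb qik)
    (fun y => sm_first y qik eta0).
  rewrite -(D2_iter_trans eta j i k x d0 uM) distrC.
  by rewrite -(hessE (mol delta uj)) -(hessE q).
have H2 := gen_lip Aa Hik.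
have H3 := ler_wpM2l eta0 H2.
rewrite qjE in IH.
set J := j%:R * eta in IH *.
have J0 : 0 <= J by rewrite mulr_ge0.
have JE : j.+1%:R * eta = J + eta by rewrite -natr1 mulrDl mul1r.
have H4 : J ^+ 2 + eta * J <= (J + eta) ^+ 2.
  rewrite sqrrD -addrA lerD2l mulr2n [eta * J]mulrC -addrA lerDl.
  by rewrite addr_ge0 ?sqr_ge0// mulr_ge0.
have H5 := ler_wpM2r gb0 H4.
rewrite JE.
have E3 : eta * (gen A (hess (mol delta uj) x) + @gen_bound R d a * (j%:R * (eta * (K * c1)))) =
  eta * gen A (hess (mol delta uj) x) + eta * J * (@gen_bound R d a * (K * c1)).
  by rewrite /J; ring.
rewrite E3 in H3.
exact: expand_arith H1 IH H3 H5.
Qed.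

(** The bound for the constant control [A] survives mollification. The smooth minorants
    degenerate as they approach [v], but at fixed minorant the loss vanishes when the
    time step is refined. *)
Lemma iter_below_value (M t T e r : R) : (forall z, Q z -> `|v z| <= M) -> 0 <= t -> t < T -> T <= 1 ->
  0 < e -> 0 < r -> exists m0 : nat, forall m, (m0 <= m)%N -> (0 < m)%N -> forall x,
  iter m (trans P xi A ((T - t) / m%:R)) (fun y => v (T, y)) x - 4 * M * beta r x
    - (3 * e + 4 * M * (3 * c1 + @mol_range R d 1) / r) <= v (t, x).
Proof.
move=> vM t0 tT T1 e0 r0.
pose u y := v (T, y).
have T0 : 0 <= T by apply: le_trans (ltW tT).
have uM : cb u M by apply: (slice_cb hv vM); rewrite T0.
have M0 := cb_ge0 uM.
have [dl [d0 d1 hd]] := mol_approx r0 uM e0; have {}hd := hd _ d0 (lexx dl).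
have bM := cbZ (2 * M) (@beta_cb R d r r0).
(* Subtracting the bound of [mol_approx] turns the mollification into a minorant of [u]. *)
pose h0 y := u y - e - 2 * M * beta r y.
have ue := cbB uM (cb_cst e).
have h0C := cbB ue bM; rewrite -/h0 in h0C.
set C := _ + _ in h0C.
have molh0 x : mol dl h0 x = mol dl u x - e - 2 * M * mol dl (beta r) x.
  rewrite /mol (boxesB _ _ _ ue bM) (boxesB _ _ _ uM (cb_cst e)) boxes_cst.
  by rewrite (boxesZ _ _ _ _ (beta_cb r0)).
have h0u x : mol dl h0 x <= v (T, x).
  by rewrite molh0; have /ler_normlW := hd x; rewrite -/(u x); lra.
have [eta0 eta00 hloss] := loss_small (cb_ge0 h0C) d0 e0.
have h1 : 0 < T - t by rewrite subr_gt0.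
have h1' : T - t <= 1 by lra.
pose m0 := (Num.truncn ((T - t) / eta0)).+1.
exists m0 => m mm0 m00 x.
have m0' : (0 : R) < m%:R by rewrite ltr0n.
set eta := (T - t) / m%:R.
have eta_ge0 : 0 <= eta by rewrite divr_ge0// ltW.
have etas : eta <= eta0.
  rewrite /eta ler_pdivrMr// mulrC -ler_pdivrMr//.
  apply: ltW; apply: lt_le_trans (_ : m0%:R <= _); last by rewrite ler_nat.
  by rewrite /m0 truncnS_gt.
have H := super_iter d0 h0C t0 tT T1 m00 h0u x.
rewrite -/eta in H.
have L : (T - t) * step_loss C dl eta <= e.
  apply: le_trans (ler_wpM2l (ltW h1) (hloss _ eta_ge0 etas)) _.
  by rewrite ler_piMl// ltW.
rewrite /mol (boxes_iter_trans W _ _ _ _ _ h0C) -/(mol dl h0) in H.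
pose c := 2 * e + 4 * M * (@mol_range R d 1 / r).
have low y : u y - c - 4 * M * beta r y <= mol dl h0 y.
  rewrite molh0; have := hd y; rewrite ler_norml => /andP[h2 _].
  have /ler_normlW h3 := mol_beta_near r0 y d0 d1.
  have := ler_wpM2l M0 h3; rewrite /c.
  move: (@mol_range R d 1 / r) (mol dl (beta r) y) (beta r y) h2 => X Y Z; lra.
have bM4 := cbZ (4 * M) (@beta_cb R d r r0).
have uc := cbB uM (cb_cst c).
have H2 := iter_trans_le W A eta m x (cbB uc bM4) (boxes_cb dl four_each h0C) low.
rewrite (iter_transB W _ _ _ _ uc bM4) (iter_transB W _ _ _ _ uM (cb_cst c)) iter_trans_cst in H2.
rewrite (iter_transZ W _ _ _ _ _ (beta_cb r0)) in H2.
have B1 : `|iter m (trans P xi A eta) (beta r) x - beta r x| <= m%:R * (eta * (3 / r * c1)).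
  apply: (@iter_trans_near R d _ _ P xi W A eta m (beta r) 1 _ x (@beta_cb R d r r0)) => y.
  apply: (trans_first W sF Fm ind a0 eta_ge0 Aa _ (sm_pred (sm_pred (beta_sm r0)))).
    by rewrite divr_ge0// ltW.
  by move=> i; exact: beta_D_sm.
have etam : m%:R * eta = T - t by rewrite mulrC divfK ?gt_eqF.
rewrite mulrA etam in B1; move/ler_normlW in B1.
have c0 : 0 <= c1 by exact: first_const_ge0.
have B2 : (T - t) * (3 / r * c1) <= 3 / r * c1.
  by rewrite ler_piMl// mulr_ge0// divr_ge0// ltW.
have B3 := ler_wpM2l M0 (le_trans B1 B2).
move: H2 B3 H L; rewrite /c -/(u x).
exact: below_arith.
Qed.

(** The scale [delta] is fixed while the time step and the barrier of [iter_below_value]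
    disappear in the limit. The remaining error is quadratic in [T - t]. *)
Lemma upper_generator (M t T delta : R) x : (forall z, Q z -> `|v z| <= M) ->
  0 < delta -> delta <= 1 -> 0 <= t -> t < T -> T <= 1 ->
  mol delta (fun y => v (T, y)) x + (T - t) * gen A (hess (mol delta (fun y => v (T, y))) x)
    - (T - t) ^+ 2 * (@gen_bound R d a * (M * molK delta * c1))
  <= mol delta (fun y => v (t, y)) x.
Proof.
move=> vM d0 d1 t0 tT T1.
apply/ler_addgt0Pr => e' e'0; pose e := e' / 5.
have e0 : 0 < e by rewrite divr_gt0.
have -> : e' = e * 5 by rewrite divfK// pnatr_eq0.
have T0 : 0 <= T by apply: le_trans (ltW tT).
have h1 : 0 < T - t by rewrite subr_gt0.
have h1' : T - t <= 1 by lra.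
have uM : cb (fun y => v (T, y)) M by apply: (slice_cb hv vM); rewrite T0.
have vtM : cb (fun y => v (t, y)) M.
  by apply: (slice_cb hv vM); rewrite t0 (le_trans (ltW tT)).
have M0 := cb_ge0 uM; have mr0 := @mol_range_ge0 R d.
have c0 : 0 <= c1 by exact: first_const_ge0.
pose mr := @mol_range R d 1.
pose k := 4 * M * (`|x| + mr + mr + (3 * c1 + mr)).
have k0 : 0 <= k by rewrite !mulr_ge0 ?addr_ge0// mulr_ge0.
have k1 : 0 < k + 1 by rewrite ltr_wpDl.
(* All the barrier terms at [x] are at most [k / r]. *)
pose r := (k + 1) / e; have r0 : 0 < r by rewrite divr_gt0.
have kr : k / r <= e.
  by rewrite /r invf_div mulrCA ler_piMr ?(ltW e0)// ler_pdivrMr// mul1r lerDl.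
have K0 : 0 <= M * molK delta by rewrite mulr_ge0 ?molK_ge0.
have K1 : 0 < M * molK delta + 1 by rewrite ltr_wpDl.
have [eta0 eta00 herr] := err_small (divr_gt0 e0 K1).
have [m0 hm0] := iter_below_value vM t0 tT T1 e0 r0.
pose m := (maxn m0 (Num.truncn ((T - t) / eta0)).+1).
have m1 : (0 < m)%N by rewrite leq_max orbT.
have m0' : (0 : R) < m%:R by rewrite ltr0n.
have H := hm0 m (leq_maxl _ _) m1.
set eta := (T - t) / m%:R in H.
have eta_ge0 : 0 <= eta by rewrite divr_ge0// ltW.
have etas : eta <= eta0.
  rewrite /eta ler_pdivrMr// mulrC -ler_pdivrMr//.
  apply: ltW; apply: lt_le_trans (truncnS_gt _) _.
  by rewrite ler_nat leq_maxr.
have etam : m%:R * eta = T - t by rewrite mulrC divfK ?gt_eqF.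
have X1 := iter_expand m x eta_ge0 d0 uM; rewrite etam in X1.
have bM4 := cbZ (4 * M) (@beta_cb R d r r0).
have iuM := iter_trans_cb W A eta m uM.
set kr2 := 3 * e + _ in H.
have := boxes_le delta four_each x (cbB (cbB iuM bM4) (cb_cst kr2)) vtM H.
rewrite (boxesB _ _ _ (cbB iuM bM4) (cb_cst kr2)) (boxesB _ _ _ iuM bM4) boxes_cst.
rewrite (boxesZ _ _ _ _ (@beta_cb R d r r0)) (boxes_iter_trans W _ _ _ _ _ uM).
rewrite -!/(mol delta _) => H2.
have /ler_normlW B1 := @mol_beta_near R d r r0 delta x d0 d1.
have B2 := @beta_le R d r r0 x.
apply: (upper_arith X1 H2 B1 _ M0).
- apply: le_trans kr; rewrite /k [leRHS]mulrAC -!mulrA -!mulrDr.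
  have := ler_wpM2l M0 B2; rewrite -/mr; lra.
- apply: (@le_trans _ _ (M * molK delta * (e / (M * molK delta + 1)))).
    apply: (@le_trans _ _ (M * molK delta * err eta)).
      by rewrite ler_piMl// mulr_ge0// err_ge0.
    by rewrite ler_wpM2l// herr.
  by rewrite mulrCA ler_piMr ?(ltW e0)// ler_pdivrMr// mul1r lerDl.
Qed.

End ConstantControl.

(** * Random walks driven by a control *)

(** Independence makes the joint law a product measure; the rest is Fubini. *)
Lemma mean_independent {R : realType} {d0 d1 d2} {Omega : measurableType d0}
    {T1 : measurableType d1} {T2 : measurableType d2} (P : probability Omega R)
    (X : Omega -> T1) (Y : Omega -> T2) (Phi : T1 * T2 -> R) (C : R) :
  measurable_fun setT X -> measurable_fun setT Y -> measurable_fun setT Phi ->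
  (forall z, `|Phi z| <= C) ->
  (forall A B, measurable A -> measurable B ->
     P (X @^-1` A `&` Y @^-1` B) = (P (X @^-1` A) * P (Y @^-1` B))%E) ->
  \int[P]_w Phi (X w, Y w) = \int[P]_w (\int[P]_w' Phi (X w, Y w')).
Proof.
move=> mX mY mPhi PC ind.
pose X' : {mfun Omega >-> T1} := mfun_Sub (mem_set mX).
pose Y' : {mfun Omega >-> T2} := mfun_Sub (mem_set mY).
have mXY : measurable_fun setT (fun w => (X w, Y w)) by exact: measurable_fun_pair.
pose XY : {mfun Omega >-> (T1 * T2)%type} := mfun_Sub (mem_set mXY).
pose mu1 := distribution P X'; pose mu2 := distribution P Y'.
pose m' := distribution P XY.
have E A : measurable A -> (mu1 \x mu2)%E A = m' A.
  by apply: product_measure_unique => B1 B2 mB1 mB2; exact: ind.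
have mF : measurable_fun setT (EFin \o Phi) by apply/measurable_EFinP.
have iXY : P.-integrable setT (EFin \o (fun w => Phi (X w, Y w))).
  apply: (@bounded_integrable _ _ _ _ _ C) => [|w]; last exact: PC.
  exact: (measurableT_comp mPhi mXY).
have iF' : m'.-integrable setT (EFin \o Phi) by exact: (integrable_pushforward mXY mF iXY).
have e2 : (\int[m']_z (Phi z)%:E = \int[(mu1 \x mu2)%E]_z (Phi z)%:E)%E.
  by apply: eq_measure_integral => A mA _; exact/esym/E.
have iF : (mu1 \x mu2)%E.-integrable setT (EFin \o Phi).
  apply/integrableP; split => //; have /integrableP[_] := iF'.
  by rewrite (eq_measure_integral (mu1 \x mu2)%E)// => A mA _; exact/esym/E.
have e1 : (\int[P]_w (Phi (X w, Y w))%:E = \int[m']_z (Phi z)%:E)%E.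
  by apply/esym; exact: (integral_pushforward mXY mF iXY measurableT).
have mx x : measurable_fun setT (fun y => Phi (x, y)) by exact: measurableT_comp mPhi _.
have e3 x : (\int[mu2]_y (Phi (x, y))%:E = (\int[P]_w' Phi (x, Y w'))%:E)%E.
  have i1 : P.-integrable setT (EFin \o (fun w' => Phi (x, Y w'))).
    apply: (@bounded_integrable _ _ _ _ _ C) => [|w]; last exact: PC.
    exact: (measurableT_comp (mx x) mY).
  rewrite fineK; last exact: integrable_fin_num.
  apply: (integral_pushforward mY _ i1 measurableT).
  by apply/measurable_EFinP; exact: mx.
have mI : measurable_fun setT (fun x => \int[P]_w' Phi (x, Y w')).
  apply/measurable_EFinP; rewrite (_ : _ \o _ = (fun x => \int[mu2]_y (EFin \o Phi) (x, y))%E).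
    exact: (measurable_fubini_F iF).
  by apply/funext => x; rewrite /= e3.
congr fine; rewrite e1 e2 -(integral12_prod_meas1 iF).
rewrite (eq_integral (fun x => (\int[P]_w' Phi (x, Y w'))%:E)); last by move=> x _; exact: e3.
apply: (integral_pushforward mX _ _ measurableT).
  by apply/measurable_EFinP.
apply: (@bounded_integrable _ _ _ _ _ C) => [|w]; first exact: (measurableT_comp mI mX).
by apply: mean_norm_le => // w'; exact: (measurableT_comp (mx _) mY).
Qed.

Section Freeze.
Context {R : realType} {d : nat} {disp : measure_display} {Omega : measurableType disp}.
Variables (P : probability Omega R) (F : set (set Omega)) (xi : Omega -> 'cV[R]_d).
Hypotheses (sF : sigma_algebra setT F) (Fm : F `<=` measurable).
Hypotheses (mxi : cmeas xi) (ind : independent_of P F xi).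

Lemma sigma_algebra_gen : <<s F >> = F.
Proof. exact: sigma_algebra_id. Qed.

(** Given the past, the position and the control are constants. *)
Lemma mean_freeze (Z : Omega -> 'cV[R]_d) (A : Omega -> 'M[R]_d) eta h C :
  gcmeas F Z -> (forall i j, gmeas F (fun w => A w i j)) -> cb h C ->
  \int[P]_w h (Z w + incr xi A eta w) = \int[P]_w trans P xi (A w) eta h (Z w).
Proof.
move=> mZ mA hC.
pose T1 := g_sigma_algebraType F; pose T2 := g_sigma_algebraType (@open 'cV[R]_d).
pose Phi (z : T1 * T2) := h (Z z.1 + Num.sqrt eta *: (A z.1 *m (z.2 : 'cV[R]_d))).
apply: (@mean_independent _ _ _ _ Omega T1 T2 P idfun xi Phi C).
- by move=> _ B mB; rewrite setTI; apply: Fm; rewrite -sigma_algebra_gen.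
- apply: (@measurability _ _ Omega T2 setT xi (@open 'cV[R]_d)) => // _ [B oB <-].
  by rewrite setTI; exact: cmeas_open.
- apply: (cmeas_comp hC.1); apply: cmeasD; first by move=> i; exact: (measurableT_comp (mZ i)).
  apply: cmeasZ; apply: cmeasM; first by move=> i j; exact: (measurableT_comp (mA i j)).
  move=> i; apply: (@measurableT_comp _ _ _ _ _ _ (fun y : T2 => (y : 'cV[R]_d) i 0)) => //.
  move=> _ B mB; rewrite setTI; apply: borel_preimage mB.
  exact: coord_continuous.
- by move=> z; exact: hC.2.
- move=> B1 B2 mB1 mB2; rewrite setIC muleC; apply: ind => //.
  by rewrite -sigma_algebra_gen.
Qed.

End Freeze.

Lemma same_law_mean {R : realType} {d : nat} {disp} {Omega : measurableType disp}
    (P : probability Omega R) (X Y : Omega -> 'cV[R]_d) (c : 'cV[R]_d -> R) :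
  cmeas X -> cmeas Y -> (forall B, borel B -> P (X @^-1` B) = P (Y @^-1` B)) ->
  continuous c -> P.-integrable setT (EFin \o (fun w => c (X w))) ->
  P.-integrable setT (EFin \o (fun w => c (Y w))) ->
  \int[P]_w c (X w) = \int[P]_w c (Y w).
Proof.
move=> mX mY XY cc iX iY.
have mcX := cmeas_comp cc mX; have mcY := cmeas_comp cc mY.
pose X' : {mfun Omega >-> R} := mfun_Sub (mem_set mcX).
pose Y' : {mfun Omega >-> R} := mfun_Sub (mem_set mcY).
have mid : measurable_fun setT (EFin : R -> \bar R) by apply/measurable_EFinP.
have e1 : (\int[distribution P X']_x x%:E = \int[P]_w (c (X w))%:E)%E.
  exact: (integral_pushforward mcX mid iX measurableT).
have e2 : (\int[distribution P Y']_x x%:E = \int[P]_w (c (Y w))%:E)%E.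
  exact: (integral_pushforward mcY mid iY measurableT).
congr fine; rewrite -e1 -e2; apply: eq_measure_integral => B mB _.
exact: (XY _ (borel_preimage cc mB)).
Qed.

Lemma small_factor {R : realType} (K e : R) : 0 <= K -> 0 < e -> K * (e / (K + 1)) <= e.
Proof.
move=> K0 e0; rewrite mulrCA ler_piMr ?(ltW e0)// ler_pdivrMr ?mul1r ?lerDl//.
exact: ltr_wpDl.
Qed.

Section Walk.
Context {R : realType} {d : nat} {disp : measure_display} {Omega : measurableType disp}.
Variables (P : probability Omega R) (F : nat -> set (set Omega)).
Hypothesis hF : filtration F.
Variable xi : nat -> Omega -> 'cV[R]_d.
Hypothesis xi_white : forall j, whitened P (xi j.+1).
Hypothesis xi_past : forall j, gcmeas (F j.+1) (xi j.+1).
Hypothesis xi_ind : forall j, independent_of P (F j) (xi j.+1).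
Hypothesis xi_law : forall j B, borel B -> P (xi j.+1 @^-1` B) = P (xi 1%N @^-1` B).
Variables (Lambda : set 'M[R]_d) (a : R).
Hypothesis a0 : 0 <= a.
Hypothesis Lambda0 : Lambda !=set0.
Hypothesis Lambda_a : forall A, Lambda A -> forall i j, `|A i j| <= a.

Let sF k : sigma_algebra setT (F k). Proof. by have [] := hF. Qed.
Let Fm k : F k `<=` measurable. Proof. by have [] := hF. Qed.

Definition control (A : nat -> Omega -> 'M[R]_d) :=
  forall k, (forall w, Lambda (A k w)) /\ forall i j, gmeas (F k) (fun w => A k w i j).

Fixpoint walk (eta : R) (A : nat -> Omega -> 'M[R]_d) (k : nat) (w : Omega) : 'cV[R]_d :=
  if k is k'.+1 then walk eta A k' w + incr (xi k) (A k') eta w else 0.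

Lemma gcmeas_step k (Z : Omega -> 'cV[R]_d) (A : Omega -> 'M[R]_d) eta :
  gcmeas (F k) Z -> (forall i j, gmeas (F k) (fun w => A w i j)) ->
  gcmeas (F k.+1) (fun w => Z w + incr (xi k.+1) A eta w).
Proof.
move=> mZ mA; have FF : F k `<=` F k.+1 by have [_ _] := hF; exact.
apply: (@cmeasD R d _ (g_sigma_algebraType (F k.+1))).
  by move=> i; exact: gmeas_sub FF (mZ i).
apply: (@cmeasZ R d _ (g_sigma_algebraType (F k.+1))).
apply: (@cmeasM R d _ (g_sigma_algebraType (F k.+1))) => [i j|]; last exact: xi_past.
exact: gmeas_sub FF (mA i j).
Qed.

Lemma gcmeas_walk eta A k : control A -> gcmeas (F k) (walk eta A k).
Proof.
move=> cA; elim: k => [|k IH]; first by move=> i; exact: measurable_cst.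
exact: gcmeas_step IH (cA k).2.
Qed.

(** A truncated second moment only depends on the law, whence an error uniform in time. *)
Lemma second_err_law j eta : second_err P (xi j.+1) a eta = second_err P (xi 1) a eta.
Proof.
congr (_ * _); rewrite /rho.
set s := Num.sqrt eta * (d%:R * a).
have s0 : 0 <= s by rewrite !mulr_ge0 ?sqrtr_ge0.
have mxi k : cmeas (xi k.+1) by have [] := xi_white k.
apply: (same_law_mean (c := fun x => `|x| ^+ 2 * Num.min 1 (s * `|x|)) (mxi j) (mxi 0) (xi_law j)).
- have cn : continuous (fun x : 'cV[R]_d => `|x|) by exact: norm_continuous.
  apply: contM; first by apply: (contM cn cn).
  have cs : continuous (fun x : 'cV[R]_d => s * `|x|).
    by apply: (contM (f := fun=> s)) => //; exact: cst_continuous.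
  have cm : continuous (fun y : R => Num.min 1 y).
    by move=> y; apply: continuous_min; [exact: cst_continuous|exact: cvg_id].
  by move=> x; exact: (continuous_comp (cs x) (cm _)).
- exact: rho_integrable.
- exact: rho_integrable.
Qed.

Lemma walk_second K g k A eta : control A -> 0 <= eta -> sm 3 K g ->
  (forall i j, 'D_(ev j) ('D_(ev i) g) = 'D_(ev i) ('D_(ev j) g)) ->
  `|\int[P]_w g (walk eta A k.+1 w) - \int[P]_w g (walk eta A k w)
    - eta * \int[P]_w gen (A k w) (hess g (walk eta A k w))|
  <= eta * (K * second_err P (xi 1) a eta).
Proof.
move=> cA e0 gK sym.
have := mean_second (xi_white k) (sF k) (@Fm k) (@xi_ind k) a0 (gcmeas_walk eta (k := k) cA)
  (cA k).2 (fun w => Lambda_a ((cA k).1 w)) e0 gK sym.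
by rewrite -(second_err_law k) /second_err !(mulrA K).
Qed.

Lemma walk_first K0 K g k A eta : control A -> 0 <= eta -> sm 2 K0 g -> 0 <= K ->
  (forall i, sm 1 K ('D_(ev i) g)) ->
  `|\int[P]_w g (walk eta A k w) - g 0| <= k%:R * (eta * (K * @first_const R d a)).
Proof.
move=> cA e0 gK0 K0' gK; elim: k => [|k IH].
  by have -> : \int[P]_w g (walk eta A 0 w) = g 0 := mean_cst P (g 0); rewrite subrr normr0 mul0r.
have := mean_first (xi_white k) (sF k) (@Fm k) (@xi_ind k) a0 (gcmeas_walk eta (k := k) cA)
  (cA k).2 (fun w => Lambda_a ((cA k).1 w)) e0 gK0 K0' gK.
rewrite -(mulrA K) => H.
rewrite -natr1 mulrDl mul1r [leRHS]addrC.
apply: le_trans (lerD H IH).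
apply: le_trans (ler_normD _ _); rewrite le_eqVlt; apply/orP; left; apply/eqP.
congr (`|_|); ring.
Qed.

Variables (f : 'cV[R]_d -> R) (v : R * 'cV[R]_d -> R).
Hypothesis hv : viscosity_solution Lambda f v.
Variable M : R.
Hypothesis vM : forall z, Q z -> `|v z| <= M.

Definition walk_loss delta eta : R :=
  eta * (@gen_bound R d a * (M * molK delta * @first_const R d a))
  + M * molK delta * second_err P (xi 1) a eta.

(** The expansion of the walk meets [upper_generator], applied for each outcome at the
    position and the control in force. *)
Lemma walk_value_step A k delta eta t : control A -> 0 < delta -> delta <= 1 -> 0 < eta ->
  0 <= t -> t + eta <= 1 ->
  \int[P]_w mol delta (fun y => v (t + eta, y)) (walk eta A k.+1 w)
  <= \int[P]_w mol delta (fun y => v (t, y)) (walk eta A k w) + eta * walk_loss delta eta.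
Proof.
move=> cA d0 d1 e0 t0 t1.
have uM : cb (fun y => v (t + eta, y)) M.
  by apply: (slice_cb hv vM); rewrite t1 addr_ge0// ltW.
have vtM : cb (fun y => v (t, y)) M.
  by apply: (slice_cb hv vM); rewrite t0 (le_trans _ t1)// lerDl ltW.
set g := mol delta (fun y => v (t + eta, y)).
have gK := sm_pred (mol_sm d0 uM); rewrite -/g in gK.
have := walk_second k cA (ltW e0) gK (fun i j => mol_sym i j d0 uM).
move=> /ler_normlW H.
have Ak w := (cA k).1 w.
set B := @gen_bound R d a * (M * molK delta * @first_const R d a).
have pt w : g (walk eta A k w) + eta * gen (A k w) (hess g (walk eta A k w)) - eta ^+ 2 * B
    <= mol delta (fun y => v (t, y)) (walk eta A k w).
  have := @upper_generator _ _ _ _ P (xi 1) (xi_white 0) (F 0%N) (sF 0) (@Fm 0%N) (@xi_ind 0%N) a a0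
    (A k w) (Lambda_a (Ak w)) Lambda Lambda0 Lambda_a f v hv (Ak w) M t (t + eta) delta
    (walk eta A k w) vM d0 d1 t0 _ t1.
  by rewrite ltrDl [t + eta - t]addrAC subrr add0r; apply.
have mw := gcmeas_walk eta (k := k) cA.
have [_ ig] := value_integrable (xi_white k) (@Fm k) eta mw (cA k).2 (sm_cb gK).
have [_ iv] := value_integrable (xi_white k) (@Fm k) eta mw (cA k).2 (boxes_cb delta four_each vtM).
have mh := gen_hess_gmeas mw (cA k).2 (sm_pred gK).
have ih : P.-integrable setT (EFin \o (fun w => gen (A k w) (hess g (walk eta A k w)))).
  apply: (@bounded_integrable _ _ _ _ _ (@gen_bound R d a * (M * molK delta))).
    exact: gmeas_measurable (@Fm k) mh.
  by move=> w; apply: (@gen_hess_norm _ _ _ _ _ (walk eta A k) (A k) _ _ _ _ (sm_pred gK)) => w'; exact: Lambda_a (Ak w').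
have ieh : P.-integrable setT (EFin \o (fun w => eta * gen (A k w) (hess g (walk eta A k w)))).
  exact: (integrableZl measurableT eta ih).
have ighB : P.-integrable setT (EFin \o (fun w => g (walk eta A k w)
    + eta * gen (A k w) (hess g (walk eta A k w)))).
  exact: (integrableD measurableT ig ieh).
have icB : P.-integrable setT (EFin \o (fun _ : Omega => eta ^+ 2 * B)).
  by apply: (@bounded_integrable _ _ _ _ _ `|eta ^+ 2 * B|).
have iL := integrableB measurableT ighB icB.
have := mean_le iL iv pt.
rewrite (meanB ighB icB) (meanD ig ieh) (meanZ _ ih) mean_cst => H2.
rewrite /walk_loss -/B; move: H H2.
move: (\int[P]_w _) (\int[P]_w _) (\int[P]_w _) (\int[P]_w _) => X1 X2 X3 X4; lra.
Qed.

Lemma walk_value A k delta eta : control A -> 0 < delta -> delta <= 1 -> 0 < eta ->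
  k%:R * eta <= 1 ->
  \int[P]_w mol delta (fun y => v (k%:R * eta, y)) (walk eta A k w)
  <= mol delta (fun y => v (0, y)) 0 + k%:R * (eta * walk_loss delta eta).
Proof.
move=> cA d0 d1 e0; elim: k => [|k IH].
  move=> _; rewrite !mul0r addr0 le_eqVlt; apply/orP; left; apply/eqP.
  exact: (mean_cst P (mol delta (fun y => v (0, y)) 0)).
have kS (s : R) : k.+1%:R * s = k%:R * s + s by rewrite -natr1 mulrDl mul1r.
rewrite !kS => k1.
have t0 : 0 <= k%:R * eta by rewrite mulr_ge0// ltW.
apply: le_trans (walk_value_step k cA d0 d1 e0 t0 k1) _.
rewrite addrA lerD2r; apply: IH; apply: le_trans k1; by rewrite lerDl ltW.
Qed.

Lemma walk_integrable h C A eta k : control A -> cb h C ->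
  P.-integrable setT (EFin \o (fun w => h (walk eta A k w))).
Proof.
move=> cA hC.
have mw := gcmeas_walk eta (k := k) cA.
exact: (value_integrable (xi_white k) (@Fm k) eta mw (cA k).2 hC).2.
Qed.

(** Bounds [r] times the mean of the mollified barrier, both initially and along the walk. *)
Definition barrier_mass : R := 2 * @mol_range R d 1 + 3 * @first_const R d a.

Lemma barrier_mass_ge0 : 0 <= barrier_mass.
Proof.
have h1 := @mol_range_ge0 R d.
have h2 : 0 <= @first_const R d a by exact: first_const_ge0.
by rewrite /barrier_mass; lra.
Qed.

Lemma mol_barrier_origin r delta : 0 < r -> 0 < delta -> delta <= 1 ->
  mol delta (beta r) (0 : 'cV[R]_d) <= barrier_mass / r.
Proof.
move=> r0 d0 d1.
have /ler_normlW h1 := @mol_beta_near R d r r0 delta 0 d0 d1.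
have h2 := @beta_le R d r r0 0.
have c0 : 0 <= 3 * @first_const R d a / r.
  by rewrite divr_ge0 ?(ltW r0)// mulr_ge0// first_const_ge0.
rewrite normr0 add0r in h2.
rewrite /barrier_mass mulrDl -[2 * _ / r]mulrA.
move: h1 h2 c0; move: (@mol_range R d 1 / r) (3 * _ / r) => X Y; lra.
Qed.

(** The first order expansion applies to [beta r], whose derivatives are of order
    [r ^-1]: this is the tightness of the walks, uniform in the control. *)
Lemma mol_barrier_walk r delta A n eta : 0 < r -> 0 < delta -> delta <= 1 -> control A ->
  0 <= eta -> n%:R * eta <= 1 ->
  \int[P]_w mol delta (beta r) (walk eta A n w) <= barrier_mass / r.
Proof.
move=> r0 d0 d1 cA e0 n1.
have bcb := @beta_cb R d r r0.
have K0 : 0 <= 3 / r by rewrite divr_ge0// ltW.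
have h0 := walk_first n cA e0 (sm_pred (sm_pred (@beta_sm R d r r0))) K0 (@beta_D_sm R d r r0).
have c0 : 0 <= 3 / r * @first_const R d a by rewrite mulr_ge0// first_const_ge0.
have h1 : \int[P]_w beta r (walk eta A n w) - beta r (0 : 'cV[R]_d) <= 3 / r * @first_const R d a.
  move/ler_normlW: h0 => /le_trans; apply.
  by rewrite mulrA ler_piMl.
have h2 := @beta_le R d r r0 0; rewrite normr0 add0r in h2.
have iB := walk_integrable eta n cA bcb.
have iM := walk_integrable eta n cA (boxes_cb delta four_each bcb).
have ic : P.-integrable setT (EFin \o (fun _ : Omega => @mol_range R d 1 / r)).
  exact: (walk_integrable eta n cA (cb_cst _)).
have iD := integrableD measurableT iB ic.
have H : \int[P]_w mol delta (beta r) (walk eta A n w) <=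
    \int[P]_w (beta r (walk eta A n w) + @mol_range R d 1 / r).
  apply: mean_le iM iD _ => w.
  by have /ler_normlW := @mol_beta_near R d r r0 delta (walk eta A n w) d0 d1; rewrite -lerBlDl.
apply: le_trans H _; rewrite (meanD iB ic) mean_cst.
rewrite /barrier_mass mulrDl -[2 * _ / r]mulrA [3 * _ / r]mulrAC.
move: h1 h2; move: (\int[P]_w _) (@mol_range R d 1 / r) (3 / r * _) => X Y Z; lra.
Qed.

Lemma walk_loss_small delta e : 0 < delta -> 0 < e -> exists2 eta0, 0 < eta0 &
  forall eta, 0 <= eta -> eta <= eta0 -> walk_loss delta eta <= e.
Proof.
move=> d0 e0.
have M0 : 0 <= M by apply: le_trans (vM (_ : Q (0, 0))) => //=; rewrite /Q/= lexx ler01.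
have K0 : 0 <= M * molK delta by rewrite mulr_ge0// molK_ge0.
set B := @gen_bound R d a * (M * molK delta * @first_const R d a).
have B0 : 0 <= B.
  by apply: mulr_ge0; [exact: gen_bound_ge0|apply: mulr_ge0 => //; exact: first_const_ge0].
have e2 : 0 < e / 2 by rewrite divr_gt0.
have [eta1 eta10 h1] := err_small (xi_white 0) a0 (divr_gt0 e2 (ltr_wpDl K0 ltr01)).
exists (Num.min eta1 (e / 2 / (B + 1))).
  by rewrite lt_min eta10 divr_gt0// ltr_wpDl.
move=> eta eta0; rewrite le_min => /andP[/(h1 _ eta0) er eB].
rewrite /walk_loss -/B [e]splitr; apply: lerD.
  by rewrite mulrC; apply: le_trans (ler_wpM2l B0 eB) (small_factor B0 e2).
exact: le_trans (ler_wpM2l K0 er) (small_factor K0 e2).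
Qed.

Lemma terminal_value x : v (1, x) = f x.
Proof.
have [_ _ [_ _ h1 _] [_ _ h2 _]] := hv.
by apply/le_anti; rewrite h1 h2.
Qed.

(** The scale of mollification and the radius of the barrier are chosen before the time
    step, which makes the accumulated loss small. *)
Lemma walk_upper e : 0 < e -> exists2 eta0, 0 < eta0 & forall n eta A, control A ->
  0 < eta -> eta <= eta0 -> n%:R * eta = 1 ->
  \int[P]_w f (walk eta A n w) <= v (0, 0) + e.
Proof.
move=> e0; pose e1 := e / 4.
have e10 : 0 < e1 by rewrite divr_gt0.
have M0 : 0 <= M by apply: le_trans (vM (_ : Q (0, 0))) => //=; rewrite /Q/= lexx ler01.
have T0 := barrier_mass_ge0.
pose k := 4 * M * barrier_mass.
have k0 : 0 <= k by rewrite !mulr_ge0.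
pose r := (k + 1) / e1; have r0 : 0 < r by rewrite divr_gt0// ltr_wpDl.
have kr : k / r <= e1 by rewrite /r invf_div; exact: small_factor.
have fM : cb f M.
  have -> : f = (fun y => v (1, y)) by apply/funext => y; rewrite terminal_value.
  by apply: (slice_cb hv vM); rewrite ler01 lexx.
have v0M : cb (fun y => v (0, y)) M by apply: (slice_cb hv vM); rewrite lexx ler01.
have [dl1 [d10 d11 hd1]] := mol_approx r0 fM e10.
have [dl2 [d20 d21 hd2]] := mol_approx r0 v0M e10.
pose dl := Num.min dl1 dl2.
have d0 : 0 < dl by rewrite lt_min d10.
have d1 : dl <= dl1 by rewrite ge_min lexx.
have d2 : dl <= dl2 by rewrite ge_min lexx orbT.
have dl1' := le_trans d1 d11.
have {}hd1 := hd1 _ d0 d1; have {}hd2 := hd2 _ d0 d2.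
have [eta0 eta00 heta] := walk_loss_small d0 e10.
exists eta0 => // n eta A cA eta1 eta2 n1.
have H := @walk_value A n dl eta cA d0 dl1' eta1.
rewrite n1 lexx mulrA n1 mul1r in H; have {}H := H isT.
have H0 := le_trans H (lerD (lexx _) (heta _ (ltW eta1) eta2)).
have n1' : n%:R * eta <= 1 by rewrite n1.
have B1 := mol_barrier_walk r0 d0 dl1' cA (ltW eta1) n1'.
have B0 := mol_barrier_origin r0 d0 dl1'.
have bcb := boxes_cb dl four_each (@beta_cb R d r r0).
have iF := walk_integrable eta n cA fM.
have iMf := walk_integrable eta n cA (boxes_cb dl four_each fM).
have ib := walk_integrable eta n cA bcb.
have ib2 := walk_integrable eta n cA (cbZ (2 * M) bcb).
have ie := walk_integrable eta n cA (cb_cst e1).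
have iD1 := integrableD measurableT iMf ie.
have iD := integrableD measurableT iD1 ib2.
have pt w : f (walk eta A n w) <= mol dl f (walk eta A n w) + e1
    + 2 * M * mol dl (beta r) (walk eta A n w).
  have := hd1 (walk eta A n w); rewrite distrC => /ler_normlW; lra.
have := mean_le iF iD pt.
rewrite (meanD iD1 ib2) (meanD iMf ie) (meanZ _ ib) mean_cst => H1.
have E : mol dl (fun y => v (1, y)) = mol dl f.
  by congr mol; apply/funext => y; rewrite terminal_value.
rewrite E in H0.
have /ler_normlW H2 := hd2 0.
apply: le_trans H1 _.
have k1 : 2 * M * (barrier_mass / r) + 2 * M * (barrier_mass / r) <= e1.
  by apply: le_trans kr; rewrite /k -!mulrA; move: (M * _) => X; lra.
have B1' := ler_wpM2l M0 B1; have B0' := ler_wpM2l M0 B0.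
have E4 : e = 4 * e1 by rewrite /e1 mulrC divfK// pnatr_eq0.
rewrite E4 -!mulrA; move: H0 H2 k1 B1' B0'; rewrite -!mulrA.
move: (\int[P]_w _) (\int[P]_w _) => X1 X2; lra.
Qed.

End Walk.

(** * Dynamic programming over finitely many controls *)

Lemma gen_control_lip {R : realType} {d : nat} (a k rho : R) (A B S : 'M[R]_d) :
  (forall i j, `|A i j| <= a) -> (forall i j, `|B i j| <= a) ->
  (forall i j, `|(A - B) i j| <= rho) -> (forall i j, `|S i j| <= k) ->
  `|gen A S - gen B S| <= 2 * d%:R ^+ 3 * a * k * rho.
Proof.
move=> Aa Ba ABr Sk.
have -> : gen A S - gen B S = 2^-1 * \tr ((A *m A^T - B *m B^T) *m S).
  by rewrite /gen -mulrBr mulmxBl raddfB.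
rewrite normrM ger0_norm ?invr_ge0//.
apply: (@le_trans _ _ `|\tr ((A *m A^T - B *m B^T) *m S)|).
  by rewrite ler_piMl// invf_le1// ler1n.
have -> : 2 * d%:R ^+ 3 * a * k * rho = d%:R * (d%:R * (d%:R * (a * rho + rho * a) * k)) by ring.
apply: sum_norm_le => i; rewrite mxE; apply: sum_norm_le => j.
rewrite normrM ler_pM//; rewrite !mxE -sumrB; apply: sum_norm_le => l.
rewrite !mxE; have := ABr i l; have := ABr j l; rewrite !mxE => h1 h2.
have -> : A i l * A j l - B i l * B j l = A i l * (A j l - B j l) + (A i l - B i l) * B j l by ring.
apply: le_trans (ler_normD _ _) _; rewrite !normrM; apply: lerD; exact: ler_pM.
Qed.

(** On bounded Hessians the generator is Lipschitz in the control, so that a finite net of the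
    compact set nearly realizes the supremum. *)
Lemma finite_controls {R : realType} {d : nat} (Lambda : set 'M[R]_d) (a k e : R) :
  compact Lambda -> Lambda !=set0 -> (forall A, Lambda A -> forall i j, `|A i j| <= a) ->
  0 <= k -> 0 < e ->
  exists A s, (forall B, B \in A :: s -> Lambda B) /\ forall (S : 'M[R]_d) (b : R), (forall i j, `|S i j| <= k) ->
    (forall B, B \in A :: s -> gen B S <= b) -> G Lambda S <= b + e.
Proof.
move=> cL L0 La k0 e0.
have [A0 LA0] := L0.
case: (posnP d) => [d_eq0|d0].
  subst d; exists A0, [::]; split=> [B|S b Sk Bb]; first by rewrite inE => /eqP ->.
  apply: (G_le L0 La) => A LA; have -> : A = A0 by apply/matrixP => -[].
  by have := Bb A0; rewrite inE eqxx => /(_ isT); lra.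
have a0 : 0 <= a by apply: le_trans (La _ LA0 (Ordinal d0) (Ordinal d0)).
pose K := 2 * d%:R ^+ 3 * a * k.
have K0 : 0 <= K by rewrite !mulr_ge0// exprn_ge0.
pose rho := e / (K + 1).
have rho0 : 0 < rho by rewrite divr_gt0// ltr_wpDl.
move: cL; rewrite compact_cover => cL.
have cov : Lambda `<=` cover Lambda (fun A => ball A rho).
  by move=> A LA; exists A => //; exact: ballxx.
have [D DL cD] := cL _ Lambda (fun A => ball A rho) (fun A _ => ball_open A rho) cov.
exists A0, (finmap.enum_fset D); split=> [B|S b Sk Bb].
  by rewrite inE => /orP[/eqP ->//|BD]; have := DL B BD; rewrite inE.
apply: (G_le L0 La) => A LA; have [B /= BD AB] := cD A LA.
have LB : Lambda B by have := DL B BD; rewrite inE.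
have nAB i j : `|(A - B) i j| <= rho.
  apply: le_trans (entry_le_norm _ _ _) _; rewrite distrC.
  by move: AB; rewrite -ball_normE /= => /ltW.
have /ler_normlW h1 := gen_control_lip (La _ LA) (La _ LB) nAB Sk.
have h2 := small_factor K0 e0; rewrite -/rho in h2.
have h3 : gen B S <= b by apply: Bb; rewrite inE; apply/orP; right.
move: h1 h2 h3; rewrite -/K; move: (K * rho) => X; lra.
Qed.

Section Bellman.
Context {R : realType} {d : nat} {disp : measure_display} {Omega : measurableType disp}.
Variables (P : probability Omega R) (xi : Omega -> 'cV[R]_d).
Hypothesis W : whitened P xi.
Variables (a : R) (A0 : 'M[R]_d).
Hypothesis a0 : 0 <= a.
Implicit Types (h : 'cV[R]_d -> R) (s : seq 'M[R]_d) (B : 'M[R]_d).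

(** The maximizer is found by finitely many comparisons, which keeps it measurable in the
    position. *)
Fixpoint best eta h s (x : 'cV[R]_d) : 'M[R]_d :=
  if s is B :: s' then
    if trans P xi (best eta h s' x) eta h x <= trans P xi B eta h x then B else best eta h s' x
  else A0.

Definition bellman eta s h (x : 'cV[R]_d) : R := trans P xi (best eta h s x) eta h x.

Lemma best_in eta h s x : best eta h s x \in A0 :: s.
Proof.
elim: s => [|B s IH]/=; first exact: mem_head.
case: ifP => _; first by rewrite !inE eqxx orbT.
by move: IH; rewrite !inE => /orP[->//|->]; rewrite !orbT.
Qed.

Lemma bellmanS eta h B s x :
  bellman eta (B :: s) h x = Num.max (bellman eta s h x) (trans P xi B eta h x).
Proof. by rewrite /bellman /=; case: leP. Qed.

Lemma bellman_ge eta h s B x : B \in A0 :: s -> trans P xi B eta h x <= bellman eta s h x.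
Proof.
elim: s => [|C s IH]; first by rewrite inE => /eqP ->.
rewrite bellmanS le_max inE => /orP[/eqP BA|].
  by apply/orP; left; apply: IH; rewrite BA mem_head.
rewrite inE => /orP[/eqP ->|Bs]; apply/orP; [by right|left].
by apply: IH; rewrite inE Bs orbT.
Qed.

Lemma bellman_cb eta h s C : cb h C -> cb (bellman eta s h) C.
Proof.
move=> hC; split; last by move=> x; exact: (trans_cb W _ _ hC).2.
elim: s => [|B s IH]; first exact: (trans_cb W _ _ hC).1.
have -> : bellman eta (B :: s) h = (fun x => bellman eta s h x) \max trans P xi B eta h.
  by apply/funext => x; rewrite bellmanS.
by move=> x; apply: continuous_max; [exact: IH|exact: (trans_cb W _ _ hC).1].
Qed.

Lemma bellman_lip eta h s C Lp : cb h C ->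
  (forall x y, `|h (x + y) - h x| <= Lp * `|y|) ->
  forall x y, `|bellman eta s h (x + y) - bellman eta s h x| <= Lp * `|y|.
Proof.
move=> hC hL.
have up x y : bellman eta s h (x + y) <= bellman eta s h x + Lp * `|y|.
  set B := best eta h s (x + y).
  apply: (@le_trans _ _ (trans P xi B eta h x + Lp * `|y|)); last first.
    by rewrite lerD2r bellman_ge// best_in.
  rewrite /bellman -/B -[in leRHS](trans_cst P xi B eta (Lp * `|y|) x).
  rewrite -(transD W _ _ _ hC (cb_cst (Lp * `|y|))) /trans -avg_shift.
  apply: (trans_le W _ _ _ (cb_shift y hC) (cbD hC (cb_cst (Lp * `|y|)))) => z.
  by have /ler_normlW := hL z y; rewrite lerBlDl.
move=> x y; rewrite ler_distl up andbT lerBlDr.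
by have := up (x + y) (- y); rewrite addrK normrN.
Qed.

Lemma bellman_near eta h s C Lp x : (forall B, B \in A0 :: s -> forall i j, `|B i j| <= a) ->
  cb h C -> 0 <= Lp -> (forall x y, `|h (x + y) - h x| <= Lp * `|y|) ->
  `|bellman eta s h x - h x| <= Lp * (Num.sqrt eta * (d%:R * a * (1 + d%:R))).
Proof.
move=> sa hC L0 hL; rewrite /bellman; apply: (@trans_lip _ _ _ _ _ _ W a _ eta a0 _ h C Lp x hC L0 hL).
exact: sa (best_in _ _ _ _).
Qed.

Lemma gmeas_best (G : set (set Omega)) eta h s C (Z : Omega -> 'cV[R]_d) i j :
  cb h C -> gcmeas G Z -> gmeas G (fun w => best eta h s (Z w) i j).
Proof.
move=> hC mZ; elim: s => [|B s IH] /=; first exact: measurable_cst.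
have m1 : gmeas G (fun w => bellman eta s h (Z w)) := gcmeas_comp (bellman_cb eta s hC).1 mZ.
have m2 : gmeas G (fun w => trans P xi B eta h (Z w)) := gcmeas_comp (trans_cb W B eta hC).1 mZ.
rewrite (_ : (fun w => _) = (fun w =>
  if bellman eta s h (Z w) <= trans P xi B eta h (Z w) then B i j else best eta h s (Z w) i j)).
  exact: (measurable_fun_ifT (measurable_fun_ler m1 m2) (@measurable_cst _ _ _ _ setT (B i j)) IH).
by apply/funext => w; rewrite /bellman; case: ifP.
Qed.

End Bellman.

Section Comparison.
Context {R : realType} {d : nat} {disp : measure_display} {Omega : measurableType disp}.
Variables (P : probability Omega R) (xi : Omega -> 'cV[R]_d).
Hypothesis W : whitened P xi.
Variables (F : set (set Omega)).
Hypotheses (sF : sigma_algebra setT F) (Fm : F `<=` measurable).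
Hypothesis ind : independent_of P F xi.
Variables (a : R).
Hypothesis a0 : 0 <= a.
Variables (Lambda : set 'M[R]_d).
Hypothesis Lambda0 : Lambda !=set0.
Hypothesis Lambda_a : forall A, Lambda A -> forall i j, `|A i j| <= a.
Variables (f : 'cV[R]_d -> R) (v : R * 'cV[R]_d -> R).
Hypothesis hv : viscosity_solution Lambda f v.
Variables (A0 : 'M[R]_d) (s : seq 'M[R]_d).
Hypothesis s_Lambda : forall B, B \in A0 :: s -> Lambda B.
Variables (C Lp delta b : R).
Hypotheses (Lp0 : 0 <= Lp) (delta0 : 0 < delta) (b0 : 0 <= b).
Hypothesis s_net : forall (S : 'M[R]_d) (c : R), (forall i j, `|S i j| <= C * molK delta) ->
  (forall B, B \in A0 :: s -> gen B S <= c) -> G Lambda S <= c + b.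

Notation bell eta := (bellman P xi A0 eta s).
Notation spread := (d%:R * a * (1 + d%:R)).

Definition bellman_loss (eta : R) : R :=
  let e := b + C * molK delta * second_err P xi a eta in
  e + @step_const R d a * (Lp * (Num.sqrt eta * spread) * molK delta + e * eta).

Lemma bellman_loss_small e : 0 <= C -> 0 < e -> (1 + @step_const R d a) * b <= e -> 0 < b ->
  exists2 eta0, 0 < eta0 & forall eta, 0 <= eta -> eta <= eta0 -> bellman_loss eta <= e * 3.
Proof.
move=> C0 e0 be b1.
have K0 : 0 <= C * molK delta by rewrite mulr_ge0// molK_ge0.
have sc0 : 0 <= @step_const R d a := step_const_ge0 a.
pose B := @step_const R d a * (Lp * spread * molK delta).
have B0 : 0 <= B.
  apply: mulr_ge0 => //; apply: mulr_ge0; last exact: molK_ge0.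
  by rewrite !mulr_ge0// addr_ge0.
have [eta1 eta10 h1] := err_small W a0 (divr_gt0 b1 (ltr_wpDl K0 ltr01)).
have q0 : 0 < e / (B + 1) by rewrite divr_gt0// ltr_wpDl.
exists (Num.min 1 (Num.min eta1 ((e / (B + 1)) ^+ 2))).
  by rewrite !lt_min ltr01 eta10 exprn_gt0.
move=> eta eta0; rewrite !le_min => /and3P[eta_1 /(h1 _ eta0) er eB].
have sq : Num.sqrt eta <= e / (B + 1).
  by rewrite -[leRHS](ger0_norm (ltW q0)) -sqrtr_sqr ler_wsqrtr.
have h2 := le_trans (ler_wpM2l K0 er) (small_factor K0 b1).
have h3 := le_trans (ler_wpM2l B0 sq) (small_factor B0 e0).
rewrite /bellman_loss; cbv zeta.
set e' := b + _; have e'2 : e' <= 2 * b by rewrite /e' mulrDl mul1r lerD2l.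
have e'0 : 0 <= e' by rewrite addr_ge0// mulr_ge0// err_ge0.
have h4 : @step_const R d a * (e' * eta) <= @step_const R d a * (2 * b).
  by rewrite ler_wpM2l// (le_trans _ e'2)// ler_piMr.
rewrite [_ * molK delta](_ : _ = Lp * spread * molK delta * Num.sqrt eta); last by ring.
rewrite mulrDr [_ * (_ * Num.sqrt eta)]mulrA -/B.
move: h3 h4 be e'2; rewrite [(1 + _) * b]mulrDl mul1r (mulrCA _ 2 b).
move: (B * _) (_ * (e' * eta)) (step_const a * b) => X Y Z; lra.
Qed.

(** The increment quotient of the mollified values serves as [g1] in [subsolution_step]. It
    dominates the generator of each control of the net by the second order expansion, since
    averages commute with transitions and the operator dominates each transition. Its
    derivatives grow as the inverse square root of [eta], which the quadratic error
    tolerates. *)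
Lemma bellman_step h c t T : cb h C -> (forall x y, `|h (x + y) - h x| <= Lp * `|y|) ->
  0 <= t -> t < T -> T <= 1 -> (forall x, v (T, x) <= mol delta h x + c) ->
  forall x, v (t, x) <= mol delta (bell (T - t) h) x + c + (T - t) * bellman_loss (T - t).
Proof.
move=> hC hL t0 tT T1 hvT x.
set eta := T - t; have eta0 : 0 < eta by rewrite subr_gt0.
have C0 := cb_ge0 hC.
have K0 : 0 <= C * molK delta by rewrite mulr_ge0// molK_ge0.
have bC := bellman_cb W A0 eta s hC.
set e := b + C * molK delta * second_err P xi a eta.
have e0 : 0 <= e by rewrite addr_ge0// mulr_ge0// err_ge0.
set k := fun y => eta^-1 * (bell eta h y - h y).
have kC : cb k (eta^-1 * (Lp * (Num.sqrt eta * spread))).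
  split; first exact: (cbZ eta^-1 (cbB bC hC)).1.
  move=> y; rewrite /k normrM gtr0_norm ?invr_gt0//; apply: ler_wpM2l.
    by rewrite invr_ge0 ltW.
  by apply: (@bellman_near _ _ _ _ _ _ W a A0 a0 eta h s C Lp y _ hC Lp0 hL) => B /s_Lambda; exact: Lambda_a.
have mk y : mol delta k y = eta^-1 * (mol delta (bell eta h) y - mol delta h y).
  by rewrite /mol (boxesZ _ _ _ _ (cbB bC hC)) (boxesB _ _ _ bC hC).
have molc y : mol delta (fun y => h y + c) y = mol delta h y + c.
  by rewrite /mol (boxesD _ _ _ hC (cb_cst c)) boxes_cst.
have qsm := mol_sm delta0 hC.
have tT2 : 0 <= t <= T by rewrite t0 ltW.
have H := @subsolution_step R d Lambda a Lambda0 Lambda_a f v hv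
  (mol delta (fun y => h y + c)) (mol delta k) _ _ e t T tT2 T1 e0
  (sm_pred (sm_pred (mol_sm delta0 (cbD hC (cb_cst c)))))
  (sm_pred (sm_pred (mol_sm delta0 kC))).
have {}H := H _ _ x.
rewrite molc mk -/eta in H; apply: le_trans (H _ _) _.
- by move=> y; rewrite molc.
- move=> y; rewrite (hess_addcst _ _ delta0 hC) mk.
  rewrite /e [b + _]addrC addrA; apply: s_net => [i j|B Bs].
    rewrite hessE; exact: (sm_cb (sm_D j (sm_D i qsm))).2.
  have BL := Lambda_a (s_Lambda Bs).
  have := trans_second W sF Fm ind a0 (ltW eta0) BL y (sm_pred qsm)
    (fun i j => mol_sym i j delta0 hC).
  rewrite -[trans _ _ _ _ _ _]/(trans P xi B eta (boxes delta four_each h) y).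
  rewrite -(boxes_trans W _ _ _ _ hC) distrC => /ler_normlW h1.
  have h2 : boxes delta four_each (trans P xi B eta h) y <= mol delta (bell eta h) y.
    by apply: (boxes_le _ _ _ (trans_cb W B eta hC) bC) => z; exact: bellman_ge.
  rewrite -lerBlDr ler_pdivlMl// mulrBr; move: h1 h2.
  by rewrite -/(mol delta h); lra.
- rewrite le_eqVlt; apply/orP; left; apply/eqP.
  rewrite /bellman_loss -/e; cbv zeta; field.
  by rewrite gt_eqF.
Qed.

Lemma iter_bellman_cb eta h m : cb h C -> cb (iter m (bell eta) h) C.
Proof. by move=> hC; elim: m => //= m IH; exact: bellman_cb. Qed.

Lemma iter_bellman_lip eta h m : cb h C -> (forall x y, `|h (x + y) - h x| <= Lp * `|y|) ->
  forall x y, `|iter m (bell eta) h (x + y) - iter m (bell eta) h x| <= Lp * `|y|.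
Proof.
move=> hC hL; elim: m => //= m IH; exact: (bellman_lip W A0 eta s (iter_bellman_cb eta m hC) IH).
Qed.

Lemma lip_mol_near (h : 'cV[R]_d -> R) x : cb h C -> (forall x y, `|h (x + y) - h x| <= Lp * `|y|) ->
  `|mol delta h x - h x| <= Lp * (delta * @mol_range R d 1).
Proof.
move=> hC hL; apply: (mol_near delta0 hC) => y yl.
by apply: le_trans (hL x y) _; rewrite ler_wpM2l.
Qed.

(** Backward induction in time. The mollification error is paid at both ends only, since the
    induction takes place between mollified values. *)
Lemma value_le_bellman h eta n : cb h C -> (forall x y, `|h (x + y) - h x| <= Lp * `|y|) ->
  0 < eta -> n%:R * eta = 1 -> (forall x, f x <= h x) ->
  v (0, 0) <= iter n (bell eta) h 0 + 2 * (Lp * (delta * @mol_range R d 1)) + bellman_loss eta.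
Proof.
move=> hC hL eta0 n1 fh; set m := Lp * _.
have H j : (j <= n)%N -> forall x, v (1 - j%:R * eta, x) <=
    mol delta (iter j (bell eta) h) x + (m + j%:R * (eta * bellman_loss eta)).
  elim: j => [|j IH] jn x.
    rewrite !mul0r subr0 addr0 (terminal_value hv).
    have := lip_mol_near x hC hL; rewrite distrC -/m => /ler_normlW; have := fh x; rewrite /=.
    move: (mol delta _ x) => X; lra.
  have jS (z : R) : j.+1%:R * z = j%:R * z + z by rewrite -natr1 mulrDl mul1r.
  have j1 : j.+1%:R * eta <= 1 by rewrite -[leRHS]n1 ler_wpM2r ?(ltW eta0)// ler_nat.
  have E : 1 - j%:R * eta - (1 - j.+1%:R * eta) = eta by rewrite jS; ring.
  have := bellman_step (t := 1 - j.+1%:R * eta) (iter_bellman_cb eta j hC)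
    (iter_bellman_lip eta j hC hL) _ _ _ (IH (ltnW jn)) x.
  rewrite E => step.
  rewrite [in leRHS]jS [m + (_ + _)]addrA [leRHS]addrA.
  apply: step.
  - by rewrite subr_ge0.
  - by rewrite ltrD2l ltrN2 ltr_pM2r// ltr_nat.
  - by rewrite gerBl mulr_ge0// ltW.
have := H n (leqnn n) 0; rewrite n1 subrr mulrA n1 mul1r => /le_trans; apply.
have := lip_mol_near 0 (iter_bellman_cb eta n hC) (iter_bellman_lip eta n hC hL).
by rewrite -/m => /ler_normlW; move: (mol delta _ 0) (iter _ _ _ 0) => X Y; lra.
Qed.

End Comparison.

Section Selection.
Context {R : realType} {d : nat} {disp : measure_display} {Omega : measurableType disp}.
Variables (P : probability Omega R) (F : nat -> set (set Omega)).
Hypothesis hF : filtration F.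
Variable xi : nat -> Omega -> 'cV[R]_d.
Hypothesis xi_white : forall j, whitened P (xi j.+1).
Hypothesis xi_past : forall j, gcmeas (F j.+1) (xi j.+1).
Hypothesis xi_ind : forall j, independent_of P (F j) (xi j.+1).
Hypothesis xi_law : forall j B, borel B -> P (xi j.+1 @^-1` B) = P (xi 1%N @^-1` B).
Variables (Lambda : set 'M[R]_d).

Let sF k : sigma_algebra setT (F k). Proof. by have [] := hF. Qed.
Let Fm k : F k `<=` measurable. Proof. by have [] := hF. Qed.

Section Feedback.
Variables (pol : nat -> 'cV[R]_d -> 'M[R]_d) (eta : R).

(** Controls and positions determine each other, so the walk is built first and the strategy
    read off afterwards. *)
Fixpoint feedback_walk (k : nat) (w : Omega) : 'cV[R]_d :=
  if k is k'.+1
  then feedback_walk k' w + incr (xi k) (fun w => pol k' (feedback_walk k' w)) eta w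
  else 0.

Definition feedback k w := pol k (feedback_walk k w).

Lemma walk_feedback k : walk xi eta feedback k = feedback_walk k.
Proof. by apply/funext => w; elim: k => //= k ->. Qed.

Lemma control_feedback : (forall k x, Lambda (pol k x)) ->
  (forall k G (Z : Omega -> 'cV[R]_d) i j, gcmeas G Z -> gmeas G (fun w => pol k (Z w) i j)) ->
  control F Lambda feedback.
Proof.
move=> pL pm.
have mW k : gcmeas (F k) (feedback_walk k).
  elim: k => [|k IH]; first by move=> i; exact: measurable_cst.
  by apply: (gcmeas_step hF xi_past) => // i j; exact: pm.
by move=> k; split=> [w|i j]; [exact: pL|exact: pm].
Qed.

End Feedback.

Variables (A0 : 'M[R]_d) (s : seq 'M[R]_d).
Hypothesis s_Lambda : forall B, B \in A0 :: s -> Lambda B.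

Lemma trans_law j A eta h C : cb h C -> trans P (xi j.+1) A eta h = trans P (xi 1) A eta h.
Proof.
move=> hC; apply/funext => x.
have mxi k : cmeas (xi k.+1) by have [] := xi_white k.
pose c (y : 'cV[R]_d) := h (x + Num.sqrt eta *: (A *m y)).
have cc : continuous c.
  have lin : continuous (fun y : 'cV[R]_d => x + Num.sqrt eta *: (A *m y)).
    apply: (@lipschitz_continuous _ _ _ _ (Num.sqrt eta * (d%:R * `|A|))) => y z.
    rewrite opprD addrACA subrr add0r -scalerBr -mulmxBr normrZ ger0_norm ?sqrtr_ge0//.
    rewrite -mulrA ler_wpM2l ?sqrtr_ge0//; apply: norm_mulmx_le => i k.
    exact: entry_le_norm.
  by move=> y; apply: continuous_comp; [exact: lin|exact: hC.1].
have ic k : P.-integrable setT (EFin \o (fun w => c (xi k.+1 w))).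
  exact: (avg_integrable P (cmeas_trans (xi_white k) A eta) x hC).
exact: (same_law_mean (mxi j) (mxi 0%N) (xi_law j) cc (ic j) (ic 0%N)).
Qed.

Definition bellman_policy n eta h k : 'cV[R]_d -> 'M[R]_d :=
  best P (xi 1) A0 eta (iter (n - k.+1) (bellman P (xi 1) A0 eta s) h) s.

(** With past, position and control frozen, the mean of the next value is the transition of
    the control in force, which is a maximizer: the mean value is constant in time. *)
Lemma bellman_policy_value n eta h C : cb h C ->
  let A := feedback (bellman_policy n eta h) eta in
  control F Lambda A /\
  \int[P]_w h (walk xi eta A n w) = iter n (bellman P (xi 1) A0 eta s) h 0.
Proof.
move=> hC; set A := feedback _ _; cbv zeta.
have hk m : cb (iter m (bellman P (xi 1) A0 eta s) h) C.
  by apply: (iter_bellman_cb (xi_white 0)).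
have cA : control F Lambda A.
  apply: control_feedback => [k x|k G Z i j mZ].
    exact: s_Lambda (best_in _ _ _ _ _ _ _).
  exact: (gmeas_best (xi_white 0) A0 eta s i j (hk _) mZ).
split => //.
have H k : (k <= n)%N ->
    \int[P]_w iter (n - k) (bellman P (xi 1) A0 eta s) h (walk xi eta A k w) =
    iter n (bellman P (xi 1) A0 eta s) h 0.
  elim: k => [|k IH] kn.
    by rewrite subn0; exact: (mean_cst P (iter n (bellman P (xi 1) A0 eta s) h 0)).
  rewrite -(IH (ltnW kn)).
  have mxi : cmeas (xi k.+1) by have [] := xi_white k.
  have mW := gcmeas_walk hF xi_past eta (k := k) cA.
  have := mean_freeze (sF k) (@Fm k) mxi (@xi_ind k) eta mW (cA k).2 (hk (n - k.+1)%N).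
  move=> ->; apply: eq_Rintegral => w _.
  rewrite (trans_law _ _ _ (hk _)) -(subnSK kn) iterS /bellman.
  by rewrite /A walk_feedback.
by have := H n (leqnn n); rewrite subnn.
Qed.

End Selection.

Section Lower.
Context {R : realType} {d : nat} {disp : measure_display} {Omega : measurableType disp}.
Variables (P : probability Omega R) (F : nat -> set (set Omega)).
Hypothesis hF : filtration F.
Variable xi : nat -> Omega -> 'cV[R]_d.
Hypothesis xi_white : forall j, whitened P (xi j.+1).
Hypothesis xi_past : forall j, gcmeas (F j.+1) (xi j.+1).
Hypothesis xi_ind : forall j, independent_of P (F j) (xi j.+1).
Hypothesis xi_law : forall j B, borel B -> P (xi j.+1 @^-1` B) = P (xi 1%N @^-1` B).
Variables (Lambda : set 'M[R]_d) (a : R).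
Hypothesis a0 : 0 <= a.
Hypothesis cLambda : compact Lambda.
Hypothesis Lambda0 : Lambda !=set0.
Hypothesis Lambda_a : forall A, Lambda A -> forall i j, `|A i j| <= a.
Variables (f : 'cV[R]_d -> R) (v : R * 'cV[R]_d -> R).
Hypothesis hv : viscosity_solution Lambda f v.
Variable M : R.
Hypothesis vM : forall z, Q z -> `|v z| <= M.

Let sF k : sigma_algebra setT (F k). Proof. by have [] := hF. Qed.
Let Fm k : F k `<=` measurable. Proof. by have [] := hF. Qed.

(** The terminal function is first mollified and raised above [f], which makes it Lipschitz
    with a constant independent of the second scale [dl2]; then come [dl2], the net and the
    time step, in this order. *)
Lemma walk_lower e : 0 < e -> exists2 eta0, 0 < eta0 & forall n eta,
  0 < eta -> eta <= eta0 -> n%:R * eta = 1 ->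
  exists2 A, control F Lambda A & v (0, 0) - e <= \int[P]_w f (walk xi eta A n w).
Proof.
move=> e0; pose e1 := e / 8.
have e10 : 0 < e1 by rewrite divr_gt0.
have E8 : e = e1 * 8 by rewrite /e1 divfK// pnatr_eq0.
have M0 : 0 <= M by apply: le_trans (vM (_ : Q (0, 0))) => //=; rewrite /Q/= lexx ler01.
have T0 : 0 <= @barrier_mass R d a by exact: barrier_mass_ge0.
pose k := 4 * M * @barrier_mass R d a.
have k0 : 0 <= k by rewrite !mulr_ge0.
pose r := (k + 1) / e1; have r0 : 0 < r by rewrite divr_gt0// ltr_wpDl.
have kr : k / r <= e1 by rewrite /r invf_div; exact: small_factor.
have fM : cb f M.
  have -> : f = (fun y => v (1, y)) by apply/funext => y; rewrite (terminal_value hv).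
  by apply: (slice_cb hv vM); rewrite ler01 lexx.
have [dl [d0 d1 hd]] := mol_approx r0 fM e10; have {}hd := hd _ d0 (lexx dl).
have bcb := @beta_cb R d r r0.
have fe := cbD fM (cb_cst e1); have bM := cbZ (2 * M) bcb.
have h0C := cbD fe bM.
set C := _ + _ in h0C.
pose h := mol dl (fun y => f y + e1 + 2 * M * beta r y).
have hE x : h x = mol dl f x + e1 + 2 * M * mol dl (beta r) x.
  rewrite /h /mol (boxesD _ _ _ fe bM) (boxesD _ _ _ fM (cb_cst e1)) boxes_cst.
  by rewrite (boxesZ _ _ _ _ bcb).
have hC : cb h C := boxes_cb dl four_each h0C.
have fh x : f x <= h x.
  by have := hd x; rewrite distrC hE => /ler_normlW; lra.
have hf x : h x <= f x + 2 * e1 + 4 * M * mol dl (beta r) x.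
  by have := hd x; rewrite hE => /ler_normlW; lra.
have C0 := cb_ge0 hC.
pose Lp := C * molK dl * d%:R.
have Lp0 : 0 <= Lp by rewrite mulr_ge0// mulr_ge0// molK_ge0.
have hL x y : `|h (x + y) - h x| <= Lp * `|y|.
  exact: lipschitz_sm (sm_pred (sm_pred (sm_pred (mol_sm d0 h0C)))).
have mr0 := @mol_range_ge0 R d.
pose m := Lp * @mol_range R d 1.
have m0 : 0 <= m by rewrite mulr_ge0.
pose dl2 := e1 / (m + 1).
have d20 : 0 < dl2 by rewrite divr_gt0// ltr_wpDl.
have md2 : Lp * (dl2 * @mol_range R d 1) <= e1.
  by rewrite mulrCA mulrC; exact: small_factor.
have sc1 : 0 <= 1 + @step_const R d a by rewrite addr_ge0// step_const_ge0.
pose b := e1 / (1 + @step_const R d a + 1).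
have b0 : 0 < b by rewrite divr_gt0// ltr_wpDl.
have hb : (1 + @step_const R d a) * b <= e1 by exact: small_factor.
have K0 : 0 <= C * molK dl2 by rewrite mulr_ge0// molK_ge0.
have [A0 [s [sL net]]] := finite_controls cLambda Lambda0 Lambda_a K0 b0.
have [eta0 eta00 hl] := @bellman_loss_small R d _ _ P (xi 1) (xi_white 0) a a0 C Lp dl2 b
  Lp0 d20 (ltW b0) e1 C0 e10 hb b0.
exists eta0 => // n eta eta1 eta2 n1.
have [cA hA] := bellman_policy_value hF xi_white xi_past xi_ind xi_law sL n eta hC.
exists (feedback xi (bellman_policy P xi A0 s n eta h) eta) => //.
set A := feedback _ _ _ in cA hA *.
have V := value_le_bellman (xi_white 0) (sF 0) (@Fm 0%N) (@xi_ind 0%N) a0 Lambda0 Lambda_a hv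
  sL Lp0 d20 (ltW b0) net hC hL eta1 n1 fh.
rewrite -hA in V.
have n1' : n%:R * eta <= 1 by rewrite n1.
have B1 := mol_barrier_walk hF xi_white xi_past xi_ind a0 Lambda_a r0 d0 d1 cA (ltW eta1) n1'.
have int g D : cb g D -> P.-integrable setT (EFin \o (fun w => g (walk xi eta A n w))).
  move=> gD; exact: (walk_integrable hF xi_white xi_past eta n cA gD).
have bb := boxes_cb dl four_each bcb.
have ifM := int _ _ fM; have ib := int _ _ bb.
have ib2 := int _ _ (cbZ (4 * M) bb); have ie := int _ _ (cb_cst (2 * e1)).
have iD1 := integrableD measurableT ifM ie.
have iD := integrableD measurableT iD1 ib2.
have := mean_le (int _ _ hC) iD (fun w => hf (walk xi eta A n w)).
rewrite (meanD iD1 ib2) (meanD ifM ie) (meanZ _ ib) mean_cst => H1.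
have B1' := ler_wpM2l M0 B1.
have l := hl eta (ltW eta1) eta2.
have kr' : 4 * (M * (@barrier_mass R d a / r)) <= e1.
  by apply: le_trans kr; rewrite /k -!mulrA.
rewrite E8; move: V H1 B1' l md2 kr'; rewrite -mulrA.
move: (\int[P]_w _) (\int[P]_w _) (\int[P]_w _) => X1 X2 X3.
move: (Lp * _) (M * X3) (M * _) (bellman_loss _ _ _ _ _ _ _) => X4 X5 X6 X7; lra.
Qed.

End Lower.

(** * The limit *)

Lemma entries_wrt {R : realType} {disp} {Omega : measurableType disp} {m n : nat}
    (G : set (set Omega)) (A : Omega -> 'M[R]_(m, n)) : sigma_algebra setT G ->
  (forall i j, gmeas G (fun w => A w i j)) -> measurable_wrt G A.
Proof.
move=> sG mA B oB.
pose T1 := g_sigma_algebraType G; pose T2 := g_sigma_algebraType (@open 'M[R]_(m, n)).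
have mA' : @measurable_fun _ _ T1 T2 setT A.
  apply: (@measurability _ _ T1 T2 setT A (@open 'M[R]_(m, n))) => // _ [U oU <-].
  by rewrite setTI; exact: (@entries_open R _ T1 m n A U mA oU).
by have := mA' measurableT B oB; rewrite setTI /measurable /= sigma_algebra_id.
Qed.

Section Expectation.
Context {R : realType} {disp : measure_display} {Omega : measurableType disp}.
Variable P : probability Omega R.

Lemma expectation_mean (X : Omega -> R) : P.-integrable setT (EFin \o X) ->
  'E_P[X]%E = (\int[P]_w X w)%:E.
Proof. by move=> iX; rewrite unlock fineK//; exact: integrable_fin_num. Qed.

(** The diagonal of the covariance provides the square integrability. *)
Lemma whitened_moments {d : nat} (X : Omega -> 'cV[R]_d) : cmeas X ->
  (forall r, ('E_P[fun w => (X w r 0)%R] = 0)%E) ->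
  (forall r l, ('E_P[fun w => (X w r 0 * X w l 0)%R] = ((1%:M : 'M[R]_d) r l)%:E)%E) ->
  whitened P X.
Proof.
move=> mX m0 cX.
have i2 r : P.-integrable setT (EFin \o (fun w => X w r 0 * X w r 0)).
  apply/integrableP; split; first by apply/measurable_EFinP; exact: measurable_funM.
  have := cX r r; rewrite unlock => E.
  rewrite (eq_integral (fun w => (X w r 0 * X w r 0)%:E)); last first.
    by move=> w _; rewrite /= ger0_norm// -expr2 sqr_ge0.
  by rewrite [ltLHS]E ltry.
have i1 : P.-integrable setT (EFin \o (fun=> 1 : R)).
  by apply: (@bounded_integrable _ _ _ _ _ 1) => // w; rewrite normr1.
have ir r : P.-integrable setT (EFin \o (fun w => X w r 0)).
  apply: (integrable_dom (mX r) _ (integrableD measurableT i1 (i2 r))) => w /=.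
  have := sqr_ge0 (`|X w r 0| - 1); rewrite sqrrB1 -expr2 -(real_normK (num_real (X w r 0))).
  have := normr_ge0 (X w r 0); move: (`|X w r 0| ^+ 2) => Y; lra.
have irl r l : P.-integrable setT (EFin \o (fun w => X w r 0 * X w l 0)).
  apply: (integrable_dom _ _ (integrableD measurableT (i2 r) (i2 l))).
    exact: measurable_funM.
  move=> w /=; rewrite ler_norml.
  have := sqr_ge0 (X w r 0 - X w l 0); have := sqr_ge0 (X w r 0 + X w l 0).
  rewrite sqrrB sqrrD !expr2.
  have := sqr_ge0 (X w r 0); have := sqr_ge0 (X w l 0); rewrite !expr2.
  move: (X w r 0 * X w r 0) (X w r 0 * X w l 0) (X w l 0 * X w l 0) => x y z *.
  by apply/andP; split; lra.
split => // [r|r l].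
  by have := m0 r; rewrite (expectation_mean (ir r)) => -[].
by have := cX r l; rewrite (expectation_mean (irl r l)) mxE => -[].
Qed.

End Expectation.

Section Strategies.
Context {R : realType} {d : nat} {disp : measure_display} {Omega : measurableType disp}.
Variables (F : nat -> set (set Omega)) (Lambda : set 'M[R]_d).
Hypothesis hF : filtration F.

Lemma control_strategies n B : control F Lambda B ->
  strategies F Lambda n (fun j => B j).
Proof.
move=> cB j; split; first exact: (cB j).1.
by apply: entries_wrt (cB j).2; have [] := hF.
Qed.

Lemma strategies_control n A : Lambda !=set0 -> strategies F Lambda n A ->
  exists2 B, control F Lambda B & forall j : 'I_n, B j = A j.
Proof.
move=> [A0 LA0] sA.
exists (fun k => if insub k is Some i then A i else fun=> A0); last by move=> j; rewrite valK.
move=> k; case: insubP => [i _ <-|_]; last first.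
  by split=> // i j; exact: measurable_cst.
have [AL mA] := sA i; split=> // r l.
exact: (wrt_gmeas mA (@coord_continuous _ _ _ _ _)).
Qed.

Lemma walk_sum (xi : nat -> Omega -> 'cV[R]_d) eta A n w :
  walk xi eta A n w = \sum_(j < n) Num.sqrt eta *: (A j w *m xi j.+1 w).
Proof. by elim: n => [|n IH]; rewrite ?big_ord0// big_ord_recr /= -IH. Qed.

End Strategies.

Unset Implicit Arguments.

Theorem theorem1 (R : realType) (d : nat) (hd : (0 < d)%N)
    (disp : measure_display) (Omega : measurableType disp)
    (P : probability Omega R) (F : nat -> set (set Omega))
    (hF : filtration F)
    (* xi 0 is unused: the sequence is xi_1, xi_2, and so on *)
    (xi : nat -> Omega -> 'cV[R]_d)
    (xi_adapted : forall j, (1 <= j)%N -> measurable_wrt (F j) (xi j))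
    (xi_iid : iid P (fun j => xi j.+1))
    (xi_indep : forall j, (1 <= j)%N -> independent_of P (F j.-1) (xi j))
    (xi_mean : forall j, (1 <= j)%N -> forall r,
       ('E_P[fun w => (xi j w r 0)%R] = 0)%E)
    (xi_cov : forall j, (1 <= j)%N -> forall r l,
       ('E_P[fun w => (xi j w r 0 * xi j w l 0)%R] = ((1%:M : 'M[R]_d) r l)%:E)%E)
    (Lambda : set 'M[R]_d) (Lambda0 : Lambda !=set0) (hLambda : compact Lambda)
    (f : 'cV[R]_d -> R) (hf : bounded_continuous f)
    (v : R * 'cV[R]_d -> R) (hv : viscosity_solution Lambda f v) :
  ereal_sup
    [set 'E_P[fun w =>
            f (\sum_(j < n) (Num.sqrt (n%:R : R))^-1 *: (A j w *m xi j.+1 w))%R]%E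
    | A in strategies F Lambda n] @[n --> \oo] --> (v (0, 0))%:E.

Proof.
have [a [a0 La]] := compact_entries hLambda.
have [M vM] := visc_bound hv.
have sF k : sigma_algebra setT (F k) by case: hF.
have Fm k : F k `<=` measurable by case: hF.
have past j : gcmeas (F j.+1) (xi j.+1).
  by move=> i; exact: (wrt_gmeas (xi_adapted j.+1 isT) (@coord_continuous _ _ _ i 0)).
have white j : whitened P (xi j.+1).
  apply: whitened_moments => [i|r|r l]; first exact: gmeas_measurable (Fm _) (past j i).
    exact: xi_mean.
  exact: xi_cov.
have ind j : independent_of P (F j) (xi j.+1) := xi_indep j.+1 isT.
have law j B : borel B -> P (xi j.+1 @^-1` B) = P (xi 1%N @^-1` B) := xi_iid.2 j B.
have fM : cb f M.
  have -> : f = (fun y => v (1, y)) by apply/funext => y; rewrite (terminal_value hv).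
  by apply: (slice_cb hv vM); rewrite ler01 lexx.
have value n B (A : 'I_n -> Omega -> 'M[R]_d) : control F Lambda B -> (forall j : 'I_n, B j = A j) ->
    'E_P[fun w => f (\sum_(j < n) (Num.sqrt (n%:R : R))^-1 *: (A j w *m xi j.+1 w))%R]%E
    = (\int[P]_w f (walk xi n%:R^-1 B n w))%:E.
  move=> cB BA; rewrite -(expectation_mean (walk_integrable hF white past n%:R^-1 n cB fM)).
  congr expectation; apply/funext => w; rewrite walk_sum sqrtrV//.
  by congr f; apply: eq_bigr => j _; rewrite BA.
have main e : 0 < e -> \forall n \near \oo,
    ((v (0, 0) - e)%:E <= ereal_sup [set 'E_P[fun w =>
        f (\sum_(j < n) (Num.sqrt (n%:R : R))^-1 *: (A j w *m xi j.+1 w))%R]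
      | A in strategies F Lambda n] <= (v (0, 0) + e)%:E)%E.
  move=> e0.
  have [eu eu0 up] := walk_upper hF white past ind law a0 Lambda0 La hv vM e0.
  have [el el0 lo] := walk_lower hF white past ind law a0 hLambda Lambda0 La hv vM e0.
  near=> n.
  have n0 : (0 : R) < n%:R by rewrite ltr0n; near: n; exact: nbhs_infty_gt.
  have ni0 : (0 : R) < n%:R^-1 by rewrite invr_gt0.
  have nn : n%:R * n%:R^-1 = 1 :> R by rewrite divff// gt_eqF.
  have small (c : R) : 0 < c -> c^-1 < n%:R -> n%:R^-1 <= c.
    by move=> c0 cn; apply: ltW; rewrite invf_plt ?posrE.
  apply/andP; split.
    have nl : n%:R^-1 <= el by apply: small => //; near: n; exact: nbhs_infty_gtr.
    have [B cB h] := lo n _ ni0 nl nn.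
    apply: le_trans (ereal_sup_ubound _); last first.
      by exists (fun j : 'I_n => B j); [exact: control_strategies|reflexivity].
    by rewrite (value n B _ cB) ?lee_fin.
  apply: ge_ereal_sup => _ [A sA <-].
  have [B cB BA] := strategies_control Lambda0 sA.
  have nu : n%:R^-1 <= eu by apply: small => //; near: n; exact: nbhs_infty_gtr.
  by rewrite (value n B A cB BA) lee_fin; exact: up cB ni0 nu nn.
apply/fine_cvgP; split.
  near=> n.
  have : ((v (0, 0) - 1)%:E <= ereal_sup [set 'E_P[fun w =>
        f (\sum_(j < n) (Num.sqrt (n%:R : R))^-1 *: (A j w *m xi j.+1 w))%R]
      | A in strategies F Lambda n] <= (v (0, 0) + 1)%:E)%E by near: n; exact: main.
  by move: (ereal_sup _) => [x| |] /andP[].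
apply/cvgrPdist_le => e e0; near=> n.
have : ((v (0, 0) - e)%:E <= ereal_sup [set 'E_P[fun w =>
      f (\sum_(j < n) (Num.sqrt (n%:R : R))^-1 *: (A j w *m xi j.+1 w))%R]
    | A in strategies F Lambda n] <= (v (0, 0) + e)%:E)%E by near: n; exact: main.
rewrite /=; move: (ereal_sup _) => [x| |] /andP[]//=.
by rewrite !lee_fin => h1 h2; rewrite ler_distl; apply/andP; split; lra.
Unshelve. all: by end_near.
Qed.
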